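(* Let $\mathbb{K}\in\{\mathbb{R},\mathbb{C}\}$. Let $\Omega\in\mathbb{K}^{n\times\ell}$ be a Gaussian embedding over $\mathbb{K}$ or a random orthonormal embedding over $\mathbb{K}$, and consider matrices $A\in\mathbb{K}^{n\times d}$ and $B\in\mathbb{K}^{n\times p}$ for which $r:=\operatorname{rank}(A)<\ell-\alpha_{\mathbb{K}}$. Then the sketch-and-solve solution $\widehat{X}=(\Omega^*A)^+(\Omega^*B)$ satisfies, for either embedding, $$\mathbb{E}[\widehat{X}]=A^+B.$$ Moreover, if $\Omega$ is a Gaussian embedding, then $$\mathbb{E}\,\|B-A\widehat{X}\|_{\rm F}^2=\left(1+\frac{r}{\ell-r-\alpha_{\mathbb{K}}}\right)\min_{X\in\mathbb{K}^{d\times p}}\|B-AX\|_{\rm F}^2,$$ and if $\Omega$ is a random orthonormal embedding, then $$\mathbb{E}\,\|B-A\widehat{X}\|_{\rm F}^2=\left(1+\frac{n-\ell}{n-r}\,\frac{r}{\ell-r-\alpha_{\mathbb{K}}}\right)\min_{X\in\mathbb{K}^{d\times p}}\|B-AX\|_{\rm F}^2.$$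
   Context: $\mathbb{K}$ is the field of real or complex numbers, and $\alpha_{\mathbb{K}}=1$ if $\mathbb{K}=\mathbb{R}$, $\alpha_{\mathbb{K}}=0$ if $\mathbb{K}=\mathbb{C}$. ${}^*$ is the adjoint (conjugate transpose), ${}^+$ is the Moore--Penrose pseudoinverse, $\|\cdot\|_{\rm F}$ is the Frobenius norm. All matrix dimensions are positive integers. An embedding is a matrix in $\mathbb{K}^{n\times\ell}$ with $n\ge\ell$. ''Unitary'' over $\mathbb{R}$ means orthogonal. A random embedding $\Omega\in\mathbb{K}^{n\times\ell}$ is rotation-invariant if $U\Omega$ has the same distribution as $\Omega$ for every (fixed) unitary $U\in\mathbb{K}^{n\times n}$. A random orthonormal embedding (random orthonormal matrix) is a rotation-invariant random embedding with $\Omega^*\Omega=\mathbf{I}$ with probability one. A Gaussian embedding over $\mathbb{K}$ has independent $\mathcal{N}_{\mathbb{K}}(0,1)$ entries, where $\mathcal{N}_{\mathbb{R}}(0,1)$ is the real standard normal distribution and $\mathcal{N}_{\mathbb{C}}(0,1)$ is the distribution of $(g_1+\mathrm{i}g_2)/\sqrt{2}$ with $g_1,g_2\sim\mathcal{N}_{\mathbb{R}}(0,1)$ independent. *)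

(* Defs.v *)
From HB Require Import structures.
From mathcomp Require Import all_boot all_order all_algebra.
From mathcomp Require Import complex.
From mathcomp Require Import all_classical all_reals all_analysis.

Set Implicit Arguments.
Unset Strict Implicit.
Unset Printing Implicit Defensive.

Import Order.TTheory GRing.Theory Num.Theory.
Import numFieldNormedType.Exports.

Local Open Scope classical_set_scope.
Local Open Scope ring_scope.

Inductive field_kind := RealK | ComplexK.

Definition alpha (k : field_kind) : nat :=
  match k with RealK => 1 | ComplexK => 0 end.

Definition Kfield (R : realType) (k : field_kind) : Type :=
  match k with RealK => R | ComplexK => R[i] end.

Definition Kfield_numField (R : realType) (k : field_kind) : numFieldType :=
  Num.NumField.Pack
    (match k return Num.NumField (Kfield R k) with
     | RealK => Num.NumField.class R
     | ComplexK => Num.NumField.class R[i]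
     end).

HB.instance Definition _ (R : realType) (k : field_kind) :=
  Num.NumField.copy (Kfield R k) (Kfield_numField R k).

HB.instance Definition _ (R : realType) (k : field_kind) :=
  isPointed.Build (Kfield R k) 0.

Section Kfield.
Variables (R : realType) (k : field_kind).

Definition Kre : Kfield R k -> R :=
  match k with RealK => fun x => x | ComplexK => fun z => complex.Re z end.

Definition Kim : Kfield R k -> R :=
  match k with RealK => fun=> 0 | ComplexK => fun z => complex.Im z end.

Definition Kconj : Kfield R k -> Kfield R k :=
  match k with RealK => fun x => x | ComplexK => fun z => conjc z end.

(* The norm of a numFieldType takes its values in the field itself, hence the
   real part. *)
Definition Kabs (x : Kfield R k) : R := Kre `|x|.

Definition Kcoords (x : Kfield R k) : R * R := (Kre x, Kim x).

End Kfield.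

(* Borel sets of K, seen as a subspace of the plane R * R; for K = R these are
   exactly the Borel sets of R. *)
HB.instance Definition _ (R : realType) (k : field_kind) :=
  Measurable.copy (Kfield R k)
    (g_sigma_algebra_preimageType (@Kcoords R k)).

Definition measure_matrix_display : measure_display -> measure_display.
Proof. exact. Qed.

Section MeasurableMatrix.
Context {d : measure_display} {T : measurableType d}.
Variables m n : nat.

Definition matrix_measurable : set (set 'M[T]_(m, n)) :=
  <<s \bigcup_(ij in [set: 'I_m * 'I_n])
        preimage_set_system setT (fun M : 'M[T]_(m, n) => M ij.1 ij.2)
          measurable >>.

Let matrix_set0 : matrix_measurable set0.
Proof. exact: sigma_algebra0. Qed.

Let matrix_setC A : matrix_measurable A -> matrix_measurable (~` A).
Proof. exact: sigma_algebraC. Qed.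

Let matrix_bigcup (F : (set _)^nat) :
  (forall i, matrix_measurable (F i)) -> matrix_measurable (\bigcup_i (F i)).
Proof. exact: sigma_algebra_bigcup. Qed.

HB.instance Definition _ :=
  @isMeasurable.Build (measure_matrix_display d) 'M[T]_(m, n)
    matrix_measurable matrix_set0 matrix_setC matrix_bigcup.

End MeasurableMatrix.

Section LinearAlgebra.
Variables (R : realType) (k : field_kind).
Local Notation K := (Kfield R k).

Definition adjmx m n (A : 'M[K]_(m, n)) : 'M[K]_(n, m) :=
  map_mx (@Kconj R k) A^T.

Definition unitary n (U : 'M[K]_n) : Prop := adjmx U *m U = 1%:M.

Definition frobenius_norm m n (A : 'M[K]_(m, n)) : R :=
  Num.sqrt (\sum_i \sum_j Kabs (A i j) ^+ 2).

Definition penrose m n (A : 'M[K]_(m, n)) (Y : 'M[K]_(n, m)) : Prop :=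
  [/\ A *m Y *m A = A, Y *m A *m Y = Y,
      adjmx (A *m Y) = A *m Y & adjmx (Y *m A) = Y *m A].

(* Moore-Penrose pseudoinverse: the unique solution of the Penrose equations,
   see mpinvP and penrose_unique. *)
Definition mpinv m n (A : 'M[K]_(m, n)) : 'M[K]_(n, m) :=
  xget 0 [set Y | penrose A Y].

(* The infimum is a minimum, see lsq_minP. *)
Definition lsq_min n d p (A : 'M[K]_(n, d)) (B : 'M[K]_(n, p)) : R :=
  inf (range (fun X : 'M[K]_(d, p) => frobenius_norm (B - A *m X) ^+ 2)).

End LinearAlgebra.

Section KfieldTheory.
Variables (R : realType) (k : field_kind).
Local Notation K := (Kfield R k).

Lemma Kconj_zmod : zmod_morphism (@Kconj R k).
Proof. by case: k => //= x y; exact: (rmorphB (conjc : {rmorphism R[i] -> R[i]})). Qed.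

Lemma Kconj_monoid : monoid_morphism (@Kconj R k).
Proof. by case: k => //=; split => [|x y]; [exact: rmorph1|exact: rmorphM]. Qed.

HB.instance Definition _ := GRing.isZmodMorphism.Build K K (@Kconj R k) Kconj_zmod.
HB.instance Definition _ := GRing.isMonoidMorphism.Build K K (@Kconj R k) Kconj_monoid.

Lemma KconjK : involutive (@Kconj R k).
Proof. by case: k => //= -[a b] /=; rewrite opprK. Qed.

Lemma KconjM_norm (x : K) : Kconj x * x = `|x| ^+ 2.
Proof.
case: k x => /= [x|x].
  by rewrite -expr2; have := real_normK (num_real x); move->.
rewrite mulrC; exact: esym (sqr_normc x).
Qed.
End KfieldTheory.

Section PinvTheory.
Variables (R : realType) (k : field_kind).
Local Notation K := (Kfield R k).

Lemma adjmxK m n (A : 'M[K]_(m, n)) : adjmx (adjmx A) = A.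
Proof. by apply/matrixP => i j; rewrite !mxE KconjK. Qed.

Lemma adjmxM m n p (A : 'M[K]_(m, n)) (B : 'M[K]_(n, p)) :
  adjmx (A *m B) = adjmx B *m adjmx A.
Proof. by rewrite /adjmx trmx_mul map_mxM. Qed.

Lemma adjmxB m n (A B : 'M[K]_(m, n)) : adjmx (A - B) = adjmx A - adjmx B.
Proof. by rewrite /adjmx linearB /= map_mxB. Qed.

Lemma adjmxD m n (A B : 'M[K]_(m, n)) : adjmx (A + B) = adjmx A + adjmx B.
Proof. by rewrite /adjmx linearD /= map_mxD. Qed.

Lemma adjmx0 m n : adjmx (0 : 'M[K]_(m, n)) = 0.
Proof. by rewrite /adjmx trmx0 map_mx0. Qed.

Lemma gram_eq0 m n (A : 'M[K]_(m, n)) : adjmx A *m A = 0 -> A = 0.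
Proof.
move=> AA0; apply/matrixP => i j; rewrite mxE; apply/eqP.
have /matrixP/(_ j j) := AA0; rewrite !mxE.
under eq_bigr do rewrite !mxE KconjM_norm.
move=> /psumr_eq0P/(_ i isT); rewrite -normr_eq0 -sqrf_eq0 => ->// h _; rewrite exprn_ge0.
Qed.

Lemma gram_unitmx m n (A : 'M[K]_(m, n)) :
  \rank A = n -> adjmx A *m A \in unitmx.
Proof.
move=> rA; rewrite -row_free_unit -kermx_eq0; apply/eqP.
set N := kermx _.
have NA0 : A *m adjmx N = 0.
  apply: gram_eq0; rewrite adjmxM adjmxK -mulmxA (mulmxA (adjmx A)).
  by rewrite mulmxA [N *m _]mulmx_ker mul0mx.
have : (N *m adjmx A) = 0 by rewrite -[N]adjmxK -adjmxM NA0 adjmx0.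
move/eqP; rewrite mulmx_free_eq0 => [/eqP//|].
by rewrite /row_free /adjmx mxrank_map mxrank_tr rA.
Qed.

Lemma adjmx_invmx n (U : 'M[K]_n) : adjmx (invmx U) = invmx (adjmx U).
Proof. by rewrite /adjmx trmx_inv map_invmx. Qed.

Lemma penrose_unique m n (A : 'M[K]_(m, n)) (Y Z : 'M[K]_(n, m)) :
  penrose A Y -> penrose A Z -> Y = Z.
Proof.
move=> [AYA YAY AYh YAh] [AZA ZAZ AZh ZAh].
have AYAZ : A *m Y = A *m Z.
  have : adjmx (A *m Y *m (A *m Z)) = adjmx (A *m Z) by rewrite mulmxA AYA.
  by rewrite adjmxM AZh AYh mulmxA AZA.
have YAZA : Y *m A = Z *m A.
  have : adjmx (Z *m A *m (Y *m A)) = adjmx (Z *m A).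
    by rewrite -mulmxA (mulmxA A) AYA.
  by rewrite adjmxM YAh ZAh -mulmxA (mulmxA A) AZA.
by rewrite -YAY YAZA -mulmxA AYAZ mulmxA.
Qed.

Lemma penrose_full_rank m r n (C : 'M[K]_(m, r)) (F : 'M[K]_(r, n)) :
  adjmx C *m C \in unitmx -> F *m adjmx F \in unitmx ->
  penrose (C *m F)
    (adjmx F *m invmx (F *m adjmx F) *m (invmx (adjmx C *m C) *m adjmx C)).
Proof.
set G := adjmx C *m C; set H := F *m adjmx F => Gu Hu.
set Y := _ *m (_ *m adjmx C).
have AY : C *m F *m Y = C *m invmx G *m adjmx C.
  by rewrite /Y !mulmxA -(mulmxA C F) -/H mulmxK.
have YA : Y *m (C *m F) = adjmx F *m invmx H *m F.
  by rewrite /Y !mulmxA -(mulmxA _ (adjmx C) C) -/G mulmxKV.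
split.
- by rewrite AY !mulmxA -(mulmxA _ (adjmx C) C) -/G mulmxKV.
- by rewrite YA /Y !mulmxA -(mulmxA _ F) -/H mulmxKV.
- by rewrite AY !adjmxM adjmx_invmx adjmxK /G adjmxM adjmxK mulmxA.
- by rewrite YA !adjmxM adjmx_invmx adjmxK /H adjmxM adjmxK mulmxA.
Qed.

Lemma mpinvP m n (A : 'M[K]_(m, n)) : penrose A (mpinv A).
Proof.
rewrite /mpinv; case: xgetP => [Y _ //|noY]; exfalso.
have := @penrose_full_rank _ _ _ (col_base A) (row_base A).
rewrite mulmx_base => penA; apply: (noY _ (penA _ _)).
  by apply/gram_unitmx/eqP/col_base_full.
rewrite -{1}[row_base A]adjmxK; apply: gram_unitmx.
by rewrite /adjmx mxrank_map mxrank_tr; apply/eqP/row_base_free.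
Qed.

Lemma KreD (x y : K) : Kre (x + y) = Kre x + Kre y.
Proof. by case: k x y => // -[a b] [c e]. Qed.

Lemma Kre_sum (I : Type) (r : seq I) (F : I -> K) :
  Kre (\sum_(i <- r) F i) = \sum_(i <- r) Kre (F i).
Proof.
elim: r => [|i r IHr]; first by rewrite !big_nil; case: k.
by rewrite !big_cons KreD IHr.
Qed.

Lemma Kabs_sqr (x : K) : Kabs x ^+ 2 = Kre (Kconj x * x).
Proof.
rewrite KconjM_norm /Kabs; case: k x => // -[a b].
by rewrite /= !mulr0 subr0 -expr2.
Qed.

Lemma frobenius_trace m n (A : 'M[K]_(m, n)) :
  frobenius_norm A ^+ 2 = Kre (\tr (adjmx A *m A)).
Proof.
rewrite sqr_sqrtr; last by do 2!apply: sumr_ge0 => ? _; rewrite sqr_ge0.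
rewrite exchange_big /mxtrace Kre_sum; apply: eq_bigr => j _ /=.
by rewrite mxE Kre_sum; apply: eq_bigr => i _; rewrite !mxE Kabs_sqr.
Qed.

Lemma frobenius_pythagoras m n (A B : 'M[K]_(m, n)) : adjmx A *m B = 0 ->
  frobenius_norm (A + B) ^+ 2 = frobenius_norm A ^+ 2 + frobenius_norm B ^+ 2.
Proof.
move=> AB0; have BA0 : adjmx B *m A = 0.
  by rewrite -[A]adjmxK -adjmxM AB0 adjmx0.
rewrite !frobenius_trace adjmxD mulmxDl !mulmxDr AB0 BA0 addr0 add0r.
by rewrite mxtraceD KreD.
Qed.

Lemma lsq_minP n d p (A : 'M[K]_(n, d)) (B : 'M[K]_(n, p)) :
  lsq_min A B = frobenius_norm (B - A *m (mpinv A *m B)) ^+ 2 /\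
  forall X, lsq_min A B <= frobenius_norm (B - A *m X) ^+ 2.
Proof.
set E := B - A *m (mpinv A *m B); have EA : adjmx E *m A = 0.
  have [AYA _ AYh _] := mpinvP A.
  by rewrite /E mulmxA adjmxB mulmxBl adjmxM AYh -mulmxA AYA subrr.
have minE X : frobenius_norm E ^+ 2 <= frobenius_norm (B - A *m X) ^+ 2.
  have -> : B - A *m X = E + A *m (mpinv A *m B - X).
    by rewrite /E mulmxBr addrA subrK.
  by rewrite frobenius_pythagoras ?lerDl ?sqr_ge0// mulmxA EA mul0mx.
suff -> : lsq_min A B = frobenius_norm E ^+ 2 by [].
apply/le_anti/andP; split.
  apply: ge_inf; last by exists (mpinv A *m B).
  by exists (frobenius_norm E ^+ 2) => _ [X _ <-].
apply: lb_le_inf; first by exists (frobenius_norm E ^+ 2), (mpinv A *m B).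
by move=> _ [X _ <-].
Qed.
End PinvTheory.

Section Probability.
Context {disp : measure_display} {T : measurableType disp} {R : realType}.
Variable P : probability T R.

Definition has_law {disp' : measure_display} {T' : measurableType disp'}
    (X : T -> T') (mu : set T' -> \bar R) : Prop :=
  forall S, measurable S -> P (X @^-1` S) = mu S.

Definition mutually_independent {disp' : measure_display}
    {T' : measurableType disp'} (I : finType) (X : I -> T -> T') : Prop :=
  forall (J : {set I}) (S : I -> set T'),
    (forall i, measurable (S i)) ->
    P (\bigcap_(i in [set` J]) (X i @^-1` S i)) =
    (\prod_(i in J) P (X i @^-1` S i))%E.

Variable k : field_kind.
Local Notation K := (Kfield R k).

Definition Kexpectation : (T -> K) -> K :=
  match k return (T -> Kfield R k) -> Kfield R k with
  | RealK => fun X => fine 'E_P[X]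
  | ComplexK => fun X =>
      (fine 'E_P[fun w => complex.Re (X w)] +i*
       fine 'E_P[fun w => complex.Im (X w)])%C
  end.

Definition integrable_mx m n (X : T -> 'M[K]_(m, n)) : Prop :=
  forall i j,
    P.-integrable setT (fun w => (Kre (X w i j))%:E) /\
    P.-integrable setT (fun w => (Kim (X w i j))%:E).

Definition expectation_mx m n (X : T -> 'M[K]_(m, n)) : 'M[K]_(m, n) :=
  \matrix_(i, j) Kexpectation (fun w => X w i j).

End Probability.

Definition std_normal (R : realType) (k : field_kind) :
    set (Kfield R k) -> \bar R :=
  match k return set (Kfield R k) -> \bar R with
  | RealK => normal_prob 0 1
  | ComplexK =>
      pushforward (normal_prob (0 : R) 1 \x normal_prob (0 : R) 1)%E
        (fun g => ((g.1 +i* g.2) / (Num.sqrt 2)%:C)%C : Kfield R ComplexK)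
  end.

Section RandomEmbeddings.
Context {disp : measure_display} {T : measurableType disp} {R : realType}
  {k : field_kind} {n l : nat}.
Variables (P : probability T R) (Omega : {RV P >-> 'M[Kfield R k]_(n, l)}).

Definition gaussian_embedding : Prop :=
  (forall i j, has_law P (fun w => Omega w i j) (@std_normal R k)) /\
  mutually_independent P
    (fun (ij : 'I_n * 'I_l) w => Omega w ij.1 ij.2).

Definition rotation_invariant : Prop :=
  forall U : 'M[Kfield R k]_n, unitary U ->
    has_law P (fun w => U *m Omega w) (distribution P Omega).

Definition orthonormal_embedding : Prop :=
  rotation_invariant /\
  {ae P, forall w, adjmx (Omega w) *m Omega w = 1%:M}.

End RandomEmbeddings.

(* Main.v *)
(* Write A = Q F, where the columns of Q are an orthonormal basis of the range
   of A, and let E be the least-squares residual, so that Q^* E = 0.  With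
   M = Omega^* Q, as soon as M^* M is invertible the sketched residual is
   E - Q L, where L = M^+ Omega^* E is the "leak" of the residual through the
   sketch.  It remains to show that M^* M is almost surely invertible, that L
   has mean zero, and that E |L|_F^2 = v |E|_F^2 for the announced v.

   The law of M is never computed.  For t > 0 let S = (M^* M + t)^-1.
   Integrating by parts the field M S, along translations in the Gaussian case
   and along rotations mixing the range of Q with its complement in the
   orthonormal case, gives c E[tr S] + E[err_t] = kappa with explicit constants,
   where err_t vanishes with t off the singular set.  Since t tr S is bounded
   below on that set, it is negligible, and t -> 0 gives
   E |M^+|_F^2 = kappa / c.  In the Gaussian case a second integration by parts
   turns this into the variance of L.  In the orthonormal case Householder
   reflections show that E |M^+ Omega^* b|^2 is the same for all unit vectors b
   orthogonal to Q, and its sum over an orthonormal basis of these vectors is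
   E |M^+|_F^2 - r.  The mean of L vanishes by parts, respectively by the
   reflection 2 Q Q^* - 1. *)

Require Import Defs.
From HB Require Import structures.
From mathcomp Require Import all_boot all_order all_algebra.
From mathcomp Require Import complex.
From mathcomp Require Import all_classical all_reals all_analysis.
From mathcomp Require Import measurable_realfun ring lra.

Set Implicit Arguments.
Unset Strict Implicit.
Unset Printing Implicit Defensive.

Import Order.TTheory GRing.Theory Num.Theory.
Import numFieldNormedType.Exports.

Local Open Scope classical_set_scope.
Local Open Scope ring_scope.

(** * Laws, densities and random matrices *)

(** Neither the invertibility of [M^* M] nor the integrability of [M^+] is known beforehand; both
    must come out of the same identity. Hence the regularization: for fixed [t], [M S] and its
    derivatives along bounded directions are bounded uniformly in [M]. No density on matrices is
    differentiated. The law is compared with its image under a translation or rotation of size [s],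
    both sides are expanded with an error O(s^2), and the terms of order [s] must agree.

    The field involves [M^*], whose derivative carries the conjugate scalar. Its contribution is
    weighted by the sum of [u^2] over a real orthonormal basis of K, which is 1 over R and 1 + i^2 =
    0 over C: this is [alpha k]. With q the real dimension of K, c = q (l - r) - alpha, positive
    exactly when r < l - alpha, while kappa is q r in the Gaussian case and r (q (n - r) - alpha) in
    the orthonormal one. So E |M^+|_F^2 is r / (l - r - alpha), respectively r (n - r - alpha) / (l
    - r - alpha); in the latter case, subtracting r and dividing by the n - r basis vectors produces
    the factor (n - l) / (n - r). *)

Section Density.
Local Open Scope ereal_scope.
Import HBNNSimple.

(** Both sides are additive and pass to increasing limits in [f]; for indicators they agree by
    hypothesis. *)
Lemma ge0_integral_density d (T : measurableType d) (R : realType)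
    (mu nu : {measure set T -> \bar R}) (w : T -> R) :
  measurable_fun setT w -> (forall x, (0 <= w x)%R) ->
  (forall A, measurable A -> nu A = \int[mu]_(x in A) (w x)%:E) ->
  forall f : T -> \bar R, measurable_fun setT f -> (forall x, 0 <= f x) ->
    \int[nu]_x f x = \int[mu]_x (f x * (w x)%:E).
Proof.
move=> mw w0 nuE f mf f0.
pose f_ := nnsfun_approx (@measurableT _ T) mf.
have mfw n : measurable_fun setT (fun x => (f_ n x)%:E * (w x)%:E).
  by apply: emeasurable_funM; exact/measurable_EFinP.
transitivity (limn (fun n => \int[nu]_x (f_ n x)%:E)).
  rewrite -monotone_convergence//.
  - by apply: eq_integral => y _; apply/esym/cvg_lim => //; exact: cvg_nnsfun_approx.
  - by move=> n; exact/measurable_EFinP/measurable_funP.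
  - by move=> n y _; rewrite lee_fin.
  - by move=> y _ m n mn; rewrite lee_fin; exact/lefP/nd_nnsfun_approx.
transitivity (limn (fun n => \int[mu]_x ((f_ n x)%:E * (w x)%:E))); last first.
  rewrite -monotone_convergence//.
  - apply: eq_integral => y _; apply/cvg_lim => //; apply: cvgeZr => //.
    exact: cvg_nnsfun_approx.
  - by move=> n y _; rewrite mule_ge0// lee_fin.
  - move=> y _ m n mn; rewrite lee_wpmul2r ?lee_fin//.
    exact/lefP/nd_nnsfun_approx.
apply: congr_lim; apply/funext => n.
have mpre r : measurable (f_ n @^-1` [set r]) by exact: measurable_sfunP.
transitivity (\sum_(k \in range (f_ n)) k%:E * nu (f_ n @^-1` [set k])).
  under eq_integral do rewrite fimfunE -fsumEFin//.
  rewrite ge0_integral_fsum//; last 2 first.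
  - by move=> y; exact/measurable_EFinP/measurable_funM.
  - by move=> y x _; rewrite nnfun_muleindic_ge0.
  apply: eq_fsbigr => r _; rewrite integralZl_indic_nnsfun//.
  by rewrite integral_indic// setIT.
transitivity (\sum_(k \in range (f_ n))
    k%:E * \int[mu]_(x in f_ n @^-1` [set k]) (w x)%:E).
  by apply: eq_fsbigr => r _; rewrite nuE.
transitivity (\int[mu]_x \sum_(k \in range (f_ n))
    ((k * \1_(f_ n @^-1` [set k]) x)%:E * (w x)%:E)); last first.
  apply: eq_integral => x _; rewrite fimfunE -fsumEFin// ge0_mule_fsuml//.
  by move=> r; rewrite nnfun_muleindic_ge0.
rewrite ge0_integral_fsum//; last 2 first.
- move=> y; apply: emeasurable_funM; last exact/measurable_EFinP.
  exact/measurable_EFinP/measurable_funM.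
- by move=> y x _; rewrite mule_ge0 ?nnfun_muleindic_ge0 ?lee_fin.
apply: eq_fsbigr => r; rewrite inE => -[x _ <-].
rewrite integral_mkcond -ge0_integralZl_EFin//; last 2 first.
- by move=> y _; apply: erestrict_ge0 => z _; rewrite lee_fin.
- by apply/(measurable_restrictT _ _).1 => //; apply/measurable_funTS/measurable_EFinP.
apply: eq_integral => y _; rewrite patchE indicE.
by case: ifP => _; rewrite ?mulr1 ?mulr0 ?mule0 ?mul0e.
Qed.

End Density.

Section MatrixLaw.
Context {d : measure_display} {T : measurableType d} {R : realType}.
Variables m n : nat.

Definition box (S : 'I_m * 'I_n -> set T) : set 'M[T]_(m, n) :=
  [set M | forall ij, S ij (M ij.1 ij.2)].

Definition boxes : set (set 'M[T]_(m, n)) :=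
  [set B | exists2 S, (forall ij, measurable (S ij)) & B = box S].

Lemma measurable_entry (i : 'I_m) (j : 'I_n) :
  measurable_fun setT (fun M : 'M[T]_(m, n) => M i j).
Proof.
move=> _ S mS; rewrite setTI; apply: sub_sigma_algebra.
by exists (i, j) => //; exists S => //; rewrite setTI.
Qed.

Lemma boxE S : box S = \bigcap_(ij in [set: 'I_m * 'I_n])
   ((fun M : 'M[T]_(m, n) => M ij.1 ij.2) @^-1` S ij).
Proof. by apply/seteqP; split => M /= MS ij //=; exact: MS. Qed.

Lemma measurable_box S : (forall ij, measurable (S ij)) -> measurable (box S).
Proof.
move=> mS; rewrite boxE; apply: fin_bigcap_measurable => // ij _.
by rewrite -[X in measurable X]setTI; exact: measurable_entry.
Qed.

Lemma boxI S S' : box S `&` box S' = box (fun ij => S ij `&` S' ij).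
Proof.
apply/seteqP; split=> [M [h h'] ij|M h]; first by split; [exact: h|exact: h'].
by split=> ij; have [] := h ij.
Qed.

Lemma measurable_boxes :
  measurable = <<s boxes >> :> set (set 'M[T]_(m, n)).
Proof.
apply/seteqP; split.
  apply: smallest_sub; first exact: smallest_sigma_algebra.
  move=> _ [ij _ [S mS <-]]; apply: sub_sigma_algebra.
  exists (fun kl => if kl == ij then S else setT) => [kl|].
    by case: ifP.
  rewrite setTI; apply/seteqP; split=> M /= MS.
    by move=> kl; case: eqP => // ->.
  by have := MS ij; rewrite eqxx.
apply: smallest_sub; first exact: sigma_algebra_measurable.
by move=> _ [S mS ->]; exact: measurable_box.
Qed.

(** Boxes form a pi-system that generates the sigma-algebra and contains the whole space.
    Independence of the entries speaks of boxes only; this extends it to the law of the matrix. *)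
Lemma matrix_measure_unique (m1 m2 : {measure set 'M[T]_(m, n) -> \bar R}) :
  (m1 setT < +oo)%E ->
  (forall S, (forall ij, measurable (S ij)) -> m1 (box S) = m2 (box S)) ->
  forall A, measurable A -> m1 A = m2 A.
Proof.
move=> m1oo m12; apply: (measure_unique boxes (fun=> setT)).
- exact: measurable_boxes.
- move=> _ _ [S mS ->] [S' mS' ->]; rewrite boxI; eexists; last by [].
  by move=> ij; exact: measurableI.
- by move=> _; exists (fun=> setT) => //; apply/seteqP; split.
- by apply/seteqP; split => // x _; exists 0%N.
- by move=> _ [S mS ->]; exact: m12.
- by [].
Qed.

Lemma measurable_matrix d' (X : measurableType d') (f : X -> 'M[T]_(m, n)) :
  (forall i j, measurable_fun setT (fun x => f x i j)) -> measurable_fun setT f.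
Proof.
move=> mf; apply: (@measurability _ _ _ _ _ _ boxes).
  exact: measurable_boxes.
move=> _ [_ [S mS ->] <-]; rewrite setTI boxE preimage_bigcap.
apply: fin_bigcap_measurable => // ij _.
by rewrite -[X in measurable X]setTI; exact: mf.
Qed.

End MatrixLaw.

Section EqLaw.
Local Open Scope ereal_scope.

Lemma eq_law_integral d1 d2 d (T1 : measurableType d1) (T2 : measurableType d2)
    (T : measurableType d) (R : realType)
    (m1 : {measure set T1 -> \bar R}) (m2 : {measure set T2 -> \bar R})
    (X : T1 -> T) (Y : T2 -> T) :
  measurable_fun setT X -> measurable_fun setT Y ->
  (forall S, measurable S -> m1 (X @^-1` S) = m2 (Y @^-1` S)) ->
  forall f : T -> \bar R, measurable_fun setT f -> (forall x, 0 <= f x) ->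
    \int[m1]_x f (X x) = \int[m2]_y f (Y y).
Proof.
move=> mX mY XY f mf f0.
have := @ge0_integral_pushforward _ _ _ _ _ _ mX m1 setT f measurableT mf.
rewrite preimage_setT => /(_ (fun y _ => f0 y)) <-.
have := @ge0_integral_pushforward _ _ _ _ _ _ mY m2 setT f measurableT mf.
rewrite preimage_setT => /(_ (fun y _ => f0 y)) <-.
by apply: eq_measure_integral => A mA _; exact: XY.
Qed.

(** The hypothesis makes [w] the density of the law of [Y] with respect to the law of [X], so the
    integrals are compared on [T]. *)
Lemma density_law_integral d1 d2 d (T1 : measurableType d1)
    (T2 : measurableType d2) (T : measurableType d) (R : realType)
    (m1 : {measure set T1 -> \bar R}) (m2 : {measure set T2 -> \bar R})
    (X : T1 -> T) (Y : T2 -> T) (w : T -> R) :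
  measurable_fun setT X -> measurable_fun setT Y ->
  measurable_fun setT w -> (forall x, (0 <= w x)%R) ->
  (forall S, measurable S ->
    m2 (Y @^-1` S) = \int[m1]_(x in X @^-1` S) (w (X x))%:E) ->
  forall f : T -> \bar R, measurable_fun setT f -> (forall x, 0 <= f x) ->
    \int[m2]_y f (Y y) = \int[m1]_x (f (X x) * (w (X x))%:E).
Proof.
move=> mX mY mw w0 XY f mf f0.
have := @ge0_integral_pushforward _ _ _ _ _ _ mY m2 setT f measurableT mf.
rewrite preimage_setT => /(_ (fun y _ => f0 y)) <-.
have mfw : measurable_fun setT (fun y => f y * (w y)%:E).
  by apply: emeasurable_funM => //; exact/measurable_EFinP.
have := @ge0_integral_pushforward _ _ _ _ _ _ mX m1 setT _ measurableT mfw.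
rewrite preimage_setT => <-; last by move=> y _; rewrite mule_ge0// lee_fin.
pose p1 := [the measure _ _ of pushforward m1 X].
pose p2 := [the measure _ _ of pushforward m2 Y].
have p12 A : measurable A -> p2 mY A = \int[p1 mX]_(x in A) (w x)%:E.
  move=> mA; rewrite /p1 /p2 /= ge0_integral_pushforward//.
  - exact: XY.
  - by apply/measurable_funTS/measurable_EFinP.
  - by move=> x _; rewrite lee_fin.
exact: (ge0_integral_density mw w0 p12 mf f0).
Qed.

End EqLaw.

(** * Matrices over K and resolvents *)

Section KfieldBasics.
Context {R : realType} {k : field_kind}.
Local Notation K := (Kfield R k).

(** Dimension of K over the reals. *)
Definition kdim (k' : field_kind) : nat :=
  match k' with RealK => 1 | ComplexK => 2 end.

Lemma measurable_Kre : measurable_fun setT (@Kre R k).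
Proof.
move=> _ S mS; rewrite setTI.
exists (S `*` setT); first exact: measurableX.
by rewrite setTI; apply/seteqP; split => x //= -[].
Qed.

Lemma measurable_Kim : measurable_fun setT (@Kim R k).
Proof.
move=> _ S mS; rewrite setTI.
exists (setT `*` S); first exact: measurableX.
by rewrite setTI; apply/seteqP; split => x //= -[].
Qed.

Lemma measurable_toK d (X : measurableType d) (f : X -> K) :
  measurable_fun setT (fun x => Kre (f x)) ->
  measurable_fun setT (fun x => Kim (f x)) -> measurable_fun setT f.
Proof.
move=> mr mi _ _ [S mS <-]; rewrite !setTI.
have mp : measurable_fun setT (fun x => (Kre (f x), Kim (f x))).
  exact: measurable_fun_pair.
by have := mp measurableT S mS; rewrite setTI.
Qed.

Lemma KimD (x y : K) : Kim (x + y) = Kim x + Kim y.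
Proof. by case: k x y => [x y|[a b] [c e]] //=; rewrite addr0. Qed.

Lemma KreM (x y : K) : Kre (x * y) = Kre x * Kre y - Kim x * Kim y.
Proof. by case: k x y => [x y|[a b] [c e]] //=; rewrite mulr0 subr0. Qed.

Lemma KimM (x y : K) : Kim (x * y) = Kre x * Kim y + Kim x * Kre y.
Proof. by case: k x y => [x y|[a b] [c e]] //=; rewrite mulr0 mul0r addr0. Qed.

Lemma Kre_conj (x : K) : Kre (Kconj x) = Kre x.
Proof. by case: k x => [x|[a b]]. Qed.

Lemma Kim_conj (x : K) : Kim (Kconj x) = - Kim x.
Proof. by case: k x => [x|[a b]] //=; rewrite oppr0. Qed.

Lemma Kabs_sqrE (x : K) : Kabs x ^+ 2 = Kre x ^+ 2 + Kim x ^+ 2.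
Proof. by rewrite Kabs_sqr KreM Kre_conj Kim_conj mulNr opprK -!expr2. Qed.

(* Density of [g + c] with respect to [g], for [g] standard normal in K; each
   real coordinate of [g] has variance [1 / kdim k]. *)
Definition cm_weight (c z : K) : R :=
  expR ((kdim k)%:R * Kre (Kconj c * z) - (kdim k)%:R * Kabs c ^+ 2 / 2).

Lemma measurable_cm_weight c : measurable_fun setT (cm_weight c).
Proof.
apply: measurableT_comp => //; apply: measurable_funB => //.
apply: measurable_funM => //.
rewrite (_ : (fun z => _) = fun z => Kre c * Kre z + Kim c * Kim z); last first.
  by apply/funext => z; rewrite KreM Kre_conj Kim_conj mulNr opprK.
by apply: measurable_funD; apply: measurable_funM => //;
  [exact: measurable_Kre|exact: measurable_Kim].
Qed.

Lemma measurable_KDr (c : K) : measurable_fun setT (fun z : K => z + c).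
Proof.
apply: measurable_toK.
  under eq_fun do rewrite KreD.
  by apply: measurable_funD => //; exact: measurable_Kre.
under eq_fun do rewrite KimD.
by apply: measurable_funD => //; exact: measurable_Kim.
Qed.

(** Subtraction of naturals truncates, but the strict inequality forces [r + alpha k < l]. *)
Lemma alpha_gap (r l : nat) : (r < l - alpha k)%N ->
  0 < l%:R - r%:R - (alpha k)%:R :> R.
Proof.
rewrite ltn_subRL addnC -(ltr_nat R) natrD; lra.
Qed.

(** Either [kdim k] is 1 or [alpha k] is 0. This lets [kdim k] cancel from the final constants. *)
Lemma kdim_alpha (x : R) :
  (kdim k)%:R * x - (alpha k)%:R = (kdim k)%:R * (x - (alpha k)%:R).
Proof. by case: (k) => /=; rewrite ?subr0 ?mul1r. Qed.

End KfieldBasics.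

Section RealInner.
Context {R : realType} {k : field_kind}.
Local Notation K := (Kfield R k).

(** The Euclidean inner product of matrices seen as real vectors: translations and derivatives are
    taken along real directions. *)
Definition rdot m n (A B : 'M[K]_(m, n)) : R :=
  \sum_i \sum_j Kre (Kconj (A i j) * B i j).

Lemma Kre0 : Kre (0 : K) = 0. Proof. by case: k. Qed.

Lemma KreN (x : K) : Kre (- x) = - Kre x.
Proof. by case: k x => [x|[a b]]. Qed.

Lemma KreB (x y : K) : Kre (x - y) = Kre x - Kre y.
Proof. by rewrite KreD KreN. Qed.

Lemma KimB (x y : K) : Kim (x - y) = Kim x - Kim y.
Proof. by case: k x y => [x y|[a b] [c e]] //=; rewrite subr0. Qed.

Lemma KconjM (x y : K) : Kconj (x * y) = Kconj x * Kconj y.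
Proof. exact: rmorphM. Qed.

Definition toK (a : R) : K :=
  match k return Kfield R k with RealK => a | ComplexK => (a%:C)%C end.

Lemma Kre_toK a : Kre (toK a) = a.
Proof. by rewrite /toK; case: k. Qed.

Lemma Kim_toK a : Kim (toK a) = 0.
Proof. by rewrite /toK; case: k. Qed.

Lemma Kconj_toK a : Kconj (toK a) = toK a.
Proof. by rewrite /toK; case: k => //=; rewrite oppr0. Qed.

Lemma Kre_toKM a (x : K) : Kre (toK a * x) = a * Kre x.
Proof. by rewrite KreM Kre_toK Kim_toK mul0r subr0. Qed.

Lemma rdotZl m n a (A B : 'M[K]_(m, n)) : rdot (toK a *: A) B = a * rdot A B.
Proof.
rewrite /rdot mulr_sumr; apply: eq_bigr => i _; rewrite mulr_sumr.
by apply: eq_bigr => j _; rewrite mxE KconjM Kconj_toK -mulrA Kre_toKM.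
Qed.

Lemma rdotZr m n a (A B : 'M[K]_(m, n)) : rdot A (toK a *: B) = a * rdot A B.
Proof.
rewrite /rdot mulr_sumr; apply: eq_bigr => i _; rewrite mulr_sumr.
by apply: eq_bigr => j _; rewrite mxE mulrCA Kre_toKM.
Qed.

Lemma measurable_rdot m n (D : 'M[K]_(m, n)) : measurable_fun setT (rdot D).
Proof.
rewrite /rdot; apply: measurable_sum => i; apply: measurable_sum => j.
under eq_fun do rewrite KreM.
apply: measurable_funB; apply: measurable_funM => //.
  exact: measurableT_comp measurable_Kre (measurable_entry _ _).
exact: measurableT_comp measurable_Kim (measurable_entry _ _).
Qed.

End RealInner.

Section Norm.
Context {R : realType} {k : field_kind}.
Local Notation K := (Kfield R k).

Lemma Kabs_ge0 (x : K) : 0 <= Kabs x.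
Proof.
rewrite /Kabs; case: k x => [x|[a b]] /=; first exact: normr_ge0.
exact: sqrtr_ge0.
Qed.

Lemma Kim_norm (x : K) : Kim `|x| = 0.
Proof. by case: k x => [x|[a b]]. Qed.

Lemma KabsM (x y : K) : Kabs (x * y) = Kabs x * Kabs y.
Proof. by rewrite /Kabs normrM KreM !Kim_norm mul0r subr0. Qed.

Lemma Kre_le (x y : K) : x <= y -> Kre x <= Kre y.
Proof. by case: k x y => [x y|[a b] [c e]] //=; rewrite lecE => /andP[]. Qed.

Lemma KabsD (x y : K) : Kabs (x + y) <= Kabs x + Kabs y.
Proof. by rewrite /Kabs -KreD; apply: Kre_le; exact: ler_normD. Qed.

Lemma KabsN (x : K) : Kabs (- x) = Kabs x.
Proof. by rewrite /Kabs normrN. Qed.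

Lemma Kabs0 : Kabs (0 : K) = 0.
Proof. by rewrite /Kabs normr0 Kre0. Qed.

Lemma Kabs_conj (x : K) : Kabs (Kconj x) = Kabs x.
Proof.
apply/eqP; rewrite -(eqrXn2 (n := 2)) ?Kabs_ge0//.
by rewrite !Kabs_sqrE Kre_conj Kim_conj sqrrN.
Qed.

Lemma Kabs_toK a : Kabs (toK a : K) = `|a|.
Proof.
apply/eqP; rewrite -(eqrXn2 (n := 2)) ?Kabs_ge0//.
by rewrite Kabs_sqrE Kre_toK Kim_toK expr0n addr0 real_normK ?num_real.
Qed.

Lemma Kre_abs_le (x : K) : `|Kre x| <= Kabs x.
Proof.
rewrite -ler_sqr ?nnegrE ?Kabs_ge0// Kabs_sqrE real_normK ?num_real//.
by rewrite lerDl sqr_ge0.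
Qed.

Lemma Kim_abs_le (x : K) : `|Kim x| <= Kabs x.
Proof.
rewrite -ler_sqr ?nnegrE ?Kabs_ge0// Kabs_sqrE real_normK ?num_real//.
by rewrite lerDr sqr_ge0.
Qed.

Lemma Kre_le_abs (x : K) : Kre x <= Kabs x.
Proof. exact: le_trans (ler_norm _) (Kre_abs_le x). Qed.

Lemma K_eq (x y : K) : Kre x = Kre y -> Kim x = Kim y -> x = y.
Proof. by case: k x y => [x y|[a b] [c e]] //= -> ->. Qed.

Lemma Kim0 : Kim (0 : K) = 0. Proof. by case: k. Qed.

Lemma Kabs_eq0 (x : K) : Kabs x = 0 -> x = 0.
Proof.
move=> x0; have := Kabs_sqrE x; rewrite x0 expr0n /= => /esym/eqP.
rewrite paddr_eq0 ?sqr_ge0// !sqrf_eq0 => /andP[/eqP xr /eqP xi].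
by apply: K_eq; rewrite ?Kre0 ?Kim0.
Qed.

Lemma toK0 : toK 0 = 0 :> K.
Proof. by apply: K_eq; rewrite ?Kre_toK ?Kim_toK ?Kre0//; case: k. Qed.

Lemma toK1 : toK 1 = 1 :> K.
Proof. by rewrite /toK; case: k. Qed.

Lemma toKM a b : toK (a * b) = toK a * toK b :> K.
Proof.
by apply: K_eq; rewrite ?KimM ?KreM !Kre_toK !Kim_toK ?mulr0 ?mul0r ?subr0 ?addr0.
Qed.

Lemma toKN a : toK (- a) = - toK a :> K.
Proof. by rewrite /toK; case: k => //=; rewrite -rmorphN. Qed.

Lemma toKD a b : toK (a + b) = toK a + toK b :> K.
Proof. by rewrite /toK; case: k => //=; rewrite -rmorphD. Qed.

Lemma toKV a : toK a^-1 = (toK a)^-1 :> K.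
Proof. by rewrite /toK; case: k => //=; rewrite -fmorphV. Qed.

Lemma Kre_natr (p : nat) : Kre (p%:R : K) = p%:R.
Proof.
elim: p => [|p IH]; first by rewrite Kre0.
by rewrite -natr1 KreD IH -natr1 -toK1 Kre_toK.
Qed.

Lemma KconjM_toK (x : K) : Kconj x * x = toK (Kabs x ^+ 2).
Proof.
apply: K_eq; rewrite ?Kre_toK ?Kim_toK; first by rewrite Kabs_sqr.
by rewrite KimM Kre_conj Kim_conj mulNr mulrC subrr.
Qed.

Lemma Kabs1 : Kabs (1 : K) = 1.
Proof. by rewrite -toK1 Kabs_toK normr1. Qed.

Lemma Kabs_sum (I : Type) (s : seq I) (F : I -> K) :
  Kabs (\sum_(i <- s) F i) <= \sum_(i <- s) Kabs (F i).
Proof.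
elim: s => [|i s IHs]; first by rewrite !big_nil Kabs0.
by rewrite !big_cons (le_trans (KabsD _ _))// lerD2l.
Qed.

(* Submultiplicative, and equivalent to the Frobenius norm by [nm_sqr_le] and
   [rdotxx_le_nm]. *)
Definition nm m n (A : 'M[K]_(m, n)) : R := \sum_i \sum_j Kabs (A i j).

Section nm.
Variables m n : nat.
Implicit Types A B : 'M[K]_(m, n).

Lemma nm_ge0 A : 0 <= nm A.
Proof. by apply: sumr_ge0 => i _; apply: sumr_ge0 => j _; exact: Kabs_ge0. Qed.

Lemma Kabs_le_nm A i j : Kabs (A i j) <= nm A.
Proof.
rewrite /nm (bigD1 i)//= (bigD1 j)//= -addrA lerDl addr_ge0//.
  by apply: sumr_ge0 => ? _; exact: Kabs_ge0.
by do 2!apply: sumr_ge0 => ? _; exact: Kabs_ge0.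
Qed.

Lemma nmD A B : nm (A + B) <= nm A + nm B.
Proof.
rewrite -big_split; apply: ler_sum => i _; rewrite -big_split /=.
by apply: ler_sum => j _; rewrite mxE KabsD.
Qed.

Lemma nmN A : nm (- A) = nm A.
Proof. by apply: eq_bigr => i _; apply: eq_bigr => j _; rewrite mxE KabsN. Qed.

Lemma nmB A B : nm (A - B) <= nm A + nm B.
Proof. by rewrite -(nmN B) nmD. Qed.

Lemma nmZ c A : nm (c *: A) = Kabs c * nm A.
Proof.
rewrite /nm mulr_sumr; apply: eq_bigr => i _; rewrite mulr_sumr.
by apply: eq_bigr => j _; rewrite mxE KabsM.
Qed.

Lemma nm_le_entry A c : 0 <= c -> (forall i j, Kabs (A i j) <= c) ->
  nm A <= (m * n)%:R * c.
Proof.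
move=> c0 Ac; rewrite (@le_trans _ _ (\sum_(i < m) \sum_(j < n) c))//.
  by apply: ler_sum => i _; exact: ler_sum.
under eq_bigr do rewrite sumr_const card_ord.
rewrite sumr_const card_ord -mulrnA mulr_natl mulnC; exact: lexx.
Qed.

Lemma nm_adj A : nm (adjmx A) = nm A.
Proof.
rewrite /nm exchange_big /=; apply: eq_bigr => i _; apply: eq_bigr => j _.
by rewrite !mxE Kabs_conj.
Qed.

Lemma rdot_nm A B : `|rdot A B| <= nm A * nm B.
Proof.
rewrite (le_trans (ler_norm_sum _ _ _))// /nm mulr_suml ler_sum// => i _.
rewrite (le_trans (ler_norm_sum _ _ _))// mulr_suml ler_sum// => j _.
rewrite (le_trans (Kre_abs_le _))// KabsM Kabs_conj.
by rewrite ler_wpM2l ?Kabs_ge0//; exact: Kabs_le_nm.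
Qed.

Lemma rdotxx A : rdot A A = \sum_i \sum_j Kabs (A i j) ^+ 2.
Proof. by apply: eq_bigr => i _; apply: eq_bigr => j _; rewrite Kabs_sqr. Qed.

Lemma rdotxx_ge0 A : 0 <= rdot A A.
Proof. by rewrite rdotxx; do 2!apply: sumr_ge0 => ? _; exact: sqr_ge0. Qed.

Lemma frobenius_rdot A : frobenius_norm A ^+ 2 = rdot A A.
Proof. by rewrite rdotxx sqr_sqrtr// -rdotxx rdotxx_ge0. Qed.

Lemma Kabs_le_rdot A i j : Kabs (A i j) ^+ 2 <= rdot A A.
Proof.
rewrite rdotxx (bigD1 i)//= (bigD1 j)//= -addrA lerDl addr_ge0//.
  by apply: sumr_ge0 => ? _; exact: sqr_ge0.
by do 2!apply: sumr_ge0 => ? _; exact: sqr_ge0.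
Qed.

Lemma rdot_trace A B : rdot A B = Kre (\tr (adjmx A *m B)).
Proof.
rewrite /mxtrace Kre_sum /rdot exchange_big /=; apply: eq_bigr => j _.
by rewrite mxE Kre_sum; apply: eq_bigr => i _; rewrite !mxE.
Qed.

Lemma rdotDr A B C : rdot A (B + C) = rdot A B + rdot A C.
Proof.
rewrite -big_split; apply: eq_bigr => i _; rewrite -big_split.
by apply: eq_bigr => j _; rewrite mxE mulrDr KreD.
Qed.

Lemma rdotxx_eq0 A : rdot A A = 0 -> A = 0.
Proof.
move=> A0; apply/matrixP => i j; rewrite mxE; apply: Kabs_eq0; apply/eqP.
by rewrite -sqrf_eq0 eq_le sqr_ge0 andbT -A0 Kabs_le_rdot.
Qed.

Lemma nm_sqr_le A : nm A ^+ 2 <= ((m * n) ^ 2)%:R * rdot A A.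
Proof.
have r0 := rdotxx_ge0 A.
have h : nm A <= (m * n)%:R * Num.sqrt (rdot A A).
  apply: nm_le_entry; first exact: sqrtr_ge0.
  move=> i j; rewrite -ler_sqr ?nnegrE ?Kabs_ge0 ?sqrtr_ge0//.
  by rewrite sqr_sqrtr// Kabs_le_rdot.
rewrite natrX -[X in _ * X](sqr_sqrtr r0) -exprMn.
apply: lerXn2r => //; rewrite nnegrE ?nm_ge0//.
Qed.

Lemma rdotxx_le_nm A : rdot A A <= nm A ^+ 2.
Proof. by rewrite (le_trans (ler_norm _))// (le_trans (rdot_nm _ _))// expr2. Qed.

End nm.

Lemma nmM m n p (A : 'M[K]_(m, n)) (B : 'M[K]_(n, p)) :
  nm (A *m B) <= nm A * nm B.
Proof.
rewrite /nm mulr_suml; apply: ler_sum => i _.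
apply: (@le_trans _ _ (\sum_k0 \sum_j Kabs (A i j) * Kabs (B j k0))).
  apply: ler_sum => k0 _; rewrite mxE (le_trans (Kabs_sum _ _))//.
  by apply: ler_sum => j _; rewrite KabsM.
rewrite exchange_big mulr_suml /=; apply: ler_sum => j _.
rewrite -mulr_sumr ler_wpM2l ?Kabs_ge0// (bigD1 j)//= lerDl.
by do 2!apply: sumr_ge0 => ? _; exact: Kabs_ge0.
Qed.

Lemma nm_tr n (A : 'M[K]_n) : `|Kre (\tr A)| <= nm A.
Proof.
rewrite (le_trans (Kre_abs_le _))// (le_trans (Kabs_sum _ _))//.
by apply: ler_sum => i _; rewrite (bigD1 i)//= lerDl sumr_ge0// => *; exact: Kabs_ge0.
Qed.

Lemma adjmxZ m n c (A : 'M[K]_(m, n)) : adjmx (c *: A) = Kconj c *: adjmx A.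
Proof. by apply/matrixP => i j; rewrite !mxE KconjM. Qed.

Lemma adjmx1 n : adjmx (1%:M : 'M[K]_n) = 1%:M.
Proof.
apply/matrixP => i j; rewrite !mxE eq_sym; exact: rmorph_nat.
Qed.

Lemma nm_delta m p (i : 'I_m) (j : 'I_p) : nm (delta_mx i j : 'M[K]_(m, p)) = 1.
Proof.
rewrite /nm (bigD1 i)//= (bigD1 j)//= mxE !eqxx Kabs1 !big1 ?addr0//.
  move=> i' /negbTE i'i; rewrite big1// => j' _.
  by rewrite mxE i'i Kabs0.
by move=> j' /negbTE j'j; rewrite mxE j'j andbF Kabs0.
Qed.

End Norm.

(** * Resolvents of Gram matrices *)

Section Resolvent.
Context {R : realType} {k : field_kind}.
Local Notation K := (Kfield R k).
Variables l r : nat.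
Implicit Types (M : 'M[K]_(l, r)) (t : R).

Lemma rdotC m n (A B : 'M[K]_(m, n)) : rdot A B = rdot B A.
Proof.
apply: eq_bigr => i _; apply: eq_bigr => j _.
by rewrite !KreM !Kre_conj !Kim_conj; ring.
Qed.

Lemma rdot_adj m n (A B : 'M[K]_(m, n)) : rdot (adjmx A) (adjmx B) = rdot A B.
Proof.
rewrite /rdot exchange_big; apply: eq_bigr => i _; apply: eq_bigr => j _.
by rewrite !mxE !KreM !Kre_conj !Kim_conj; ring.
Qed.

Lemma rdotMl m n p (A : 'M[K]_(m, n)) (B : 'M[K]_(n, p)) (C : 'M[K]_(m, p)) :
  rdot (A *m B) C = rdot B (adjmx A *m C).
Proof. by rewrite !rdot_trace adjmxM mulmxA. Qed.

Definition gram M : 'M[K]_r := adjmx M *m M.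

Lemma gram_adj M : adjmx (gram M) = gram M.
Proof. by rewrite /gram adjmxM adjmxK. Qed.

Definition shifted M t : 'M[K]_r := gram M + (toK t)%:M.

(* Regularized inverse of the Gram matrix: [res M t *m adjmx M] tends to
   [mpinv M] as [t] tends to 0, even if [M] is rank deficient. *)
Definition res M t : 'M[K]_r := invmx (shifted M t).

Lemma adj_scalar n t : adjmx ((toK t)%:M : 'M[K]_n) = (toK t)%:M.
Proof. by rewrite -scalemx1 adjmxZ adjmx1 Kconj_toK. Qed.

Lemma shifted_adj M t : adjmx (shifted M t) = shifted M t.
Proof. by rewrite /shifted adjmxD gram_adj adj_scalar. Qed.

(** A kernel vector [X] would satisfy [|M X|^2 + t |X|^2 = 0]. *)
Lemma shifted_unit M t : 0 < t -> shifted M t \in unitmx.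
Proof.
move=> t0; rewrite -row_free_unit -kermx_eq0; apply/eqP.
set N := kermx _; have NG : N *m shifted M t = 0 by exact: mulmx_ker.
pose X := adjmx N; suff X0 : X = 0 by rewrite -[N]adjmxK -/X X0 adjmx0.
have GX : shifted M t *m X = 0.
  by rewrite -[shifted M t]shifted_adj -adjmxM NG adjmx0.
have : rdot X (shifted M t *m X) = 0.
  by rewrite GX rdot_trace mulmx0 mxtrace0 Kre0.
rewrite /shifted mulmxDl rdotDr /gram -mulmxA -rdotMl mul_scalar_mx rdotZr.
have h1 := rdotxx_ge0 (M *m X); have h2 := rdotxx_ge0 X.
by move=> h; apply: rdotxx_eq0; nra.
Qed.

Lemma resVr M t : 0 < t -> shifted M t *m res M t = 1%:M.
Proof. by move=> t0; rewrite mulmxV ?shifted_unit. Qed.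

Lemma resVl M t : 0 < t -> res M t *m shifted M t = 1%:M.
Proof. by move=> t0; rewrite mulVmx ?shifted_unit. Qed.

Lemma res_adj M t : adjmx (res M t) = res M t.
Proof. by rewrite /res adjmx_invmx shifted_adj. Qed.

Lemma res_gram M t : 0 < t -> res M t *m gram M = 1%:M - toK t *: res M t.
Proof.
move=> t0; apply/eqP; rewrite -subr_eq0 opprB addrA subr_eq0 -mul_mx_scalar.
by rewrite -mulmxDr resVl.
Qed.

Lemma gram_res M t : 0 < t -> gram M *m res M t = 1%:M - toK t *: res M t.
Proof.
move=> t0; rewrite -[LHS]adjmxK adjmxM gram_adj res_adj res_gram// adjmxB.
by rewrite adjmx1 adjmxZ Kconj_toK res_adj.
Qed.

(** This is [S = S (M^* M + t) S] for the self-adjoint [S]; it is the source of the positivity of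
    [S]. *)
Lemma res_split M t : 0 < t ->
  res M t = adjmx (M *m res M t) *m (M *m res M t) + toK t *: (res M t *m res M t).
Proof.
move=> t0; rewrite adjmxM res_adj -!mulmxA (mulmxA (adjmx M)) -/(gram M).
by rewrite gram_res// mulmxBr mulmx1 -scalemxAr subrK.
Qed.

(** The hypothesis compares the diagonals of [A^* A] and [A]. It gives
    [|A j j|^2 <= Kre (A j j) <= |A j j|], hence [|A j j| <= 1], and then bounds column [j] by its
    diagonal entry. Applied to [t S] and [M S M^*], it yields bounds free of [M]. *)
Lemma contraction_entry n (A : 'M[K]_n) :
  (forall i, \sum_j Kabs (A j i) ^+ 2 <= Kre (A i i)) ->
  forall i j, Kabs (A i j) <= 1.
Proof.
move=> h; have d j : Kabs (A j j) <= 1.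
  have hj := h j; have : Kabs (A j j) ^+ 2 <= \sum_i Kabs (A i j) ^+ 2.
    by rewrite (bigD1 j)//= lerDl sumr_ge0// => *; exact: sqr_ge0.
  have := Kre_le_abs (A j j); have := Kabs_ge0 (A j j); rewrite expr2; nra.
move=> i j; have hj := h j.
have : Kabs (A i j) ^+ 2 <= \sum_i0 Kabs (A i0 j) ^+ 2.
  by rewrite (bigD1 i)//= lerDl sumr_ge0// => *; exact: sqr_ge0.
have := Kre_le_abs (A j j); have := Kabs_ge0 (A i j); have := d j.
rewrite expr2; nra.
Qed.

Lemma gram_diag m n (A : 'M[K]_(m, n)) i :
  Kre ((adjmx A *m A) i i) = \sum_j Kabs (A j i) ^+ 2.
Proof. by rewrite mxE Kre_sum; apply: eq_bigr => j _; rewrite !mxE Kabs_sqr. Qed.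

Lemma res_diag M t i : 0 < t ->
  Kre (res M t i i) = \sum_j Kabs ((M *m res M t) j i) ^+ 2 +
                      t * \sum_j Kabs (res M t j i) ^+ 2.
Proof.
move=> t0; rewrite {1}res_split// mxE KreD gram_diag mxE Kre_toKM.
by congr (_ + _ * _); rewrite -{1}(res_adj M t) gram_diag.
Qed.

Lemma scaled_res_entry M t i j : 0 < t -> Kabs (toK t * res M t i j) <= 1.
Proof.
move=> t0; have := @contraction_entry _ (toK t *: res M t) _ i j.
rewrite mxE; apply => {}i; rewrite mxE Kre_toKM res_diag// mulrDr.
rewrite (le_trans _ (_ : t * (t * \sum_j0 Kabs (res M t j0 i) ^+ 2) <= _))//.
  rewrite !mulr_sumr ler_sum// => j0 _.
  by rewrite mxE KabsM Kabs_toK gtr0_norm// exprMn expr2 mulrA.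
by rewrite lerDr mulr_ge0 ?(ltW t0)// sumr_ge0// => *; exact: sqr_ge0.
Qed.

Lemma nm_scaled_res M t : 0 < t -> nm (toK t *: res M t) <= (r * r)%:R.
Proof.
move=> t0; rewrite -[leRHS]mulr1; apply: nm_le_entry => // i j.
by rewrite mxE scaled_res_entry.
Qed.

Lemma nm_res M t : 0 < t -> nm (res M t) <= (r * r)%:R / t.
Proof.
by move=> t0; rewrite ler_pdivlMr// mulrC -[X in X * _]gtr0_norm// -(Kabs_toK (k := k))
  -nmZ nm_scaled_res.
Qed.

(** The diagonal of [S] dominates the squared columns of [M S] and is at most [1 / t]; then
    [x^2 <= 1 / t] gives [x <= 1 + 1 / t]. No norm of [M] enters, although [M] is unbounded under
    the Gaussian law. *)
Lemma nm_Mres M t : 0 < t -> nm (M *m res M t) <= (l * r)%:R * (1 + t^-1).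
Proof.
move=> t0; have ti : 0 < t^-1 by rewrite invr_gt0.
apply: nm_le_entry; first by rewrite addr_ge0// ltW.
move=> i j; have h := res_diag M j t0.
have h1 : Kabs ((M *m res M t) i j) ^+ 2 <= Kre (res M t j j).
  rewrite h (bigD1 i)//= -addrA lerDl addr_ge0//.
    by apply: sumr_ge0 => *; exact: sqr_ge0.
  by rewrite mulr_ge0 ?(ltW t0)// sumr_ge0// => *; exact: sqr_ge0.
have h2 : Kre (res M t j j) <= t^-1.
  rewrite (le_trans (Kre_le_abs _))// -[t^-1]mul1r ler_pdivlMr// mulrC.
  by rewrite -{1}[t]gtr0_norm// -(Kabs_toK (k := k)) -KabsM scaled_res_entry.
have := Kabs_ge0 ((M *m res M t) i j); move: h1; rewrite expr2; nra.
Qed.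

Lemma res_sandwich M t : 0 < t ->
  res M t = res M t *m gram M *m res M t + toK t *: (res M t *m res M t).
Proof. by move=> t0; rewrite res_gram// mulmxBl mul1mx -scalemxAl subrK. Qed.

(** The matrix [A = M S M^*] satisfies [A = A^* A + t B^* B] with [B = S M^*], so
    [contraction_entry] applies. *)
Lemma nm_MresM M t : 0 < t -> nm (M *m res M t *m adjmx M) <= (l * l)%:R.
Proof.
move=> t0; rewrite -[leRHS]mulr1; apply: nm_le_entry => //.
set S := res M t; pose B := adjmx (M *m S); set A := M *m S *m adjmx M.
have AE : A = adjmx A *m A + toK t *: (adjmx B *m B).
  transitivity (M *m (S *m gram M *m S + toK t *: (S *m S)) *m adjmx M).
    by rewrite -res_sandwich.
  rewrite mulmxDr mulmxDl -scalemxAr -scalemxAl /A /B !adjmxM !adjmxK res_adj.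
  by rewrite /gram !mulmxA.
have diag i : Kre (A i i) = \sum_j Kabs (A j i) ^+ 2 + t * \sum_j Kabs (B j i) ^+ 2.
  by rewrite {1}AE mxE KreD gram_diag mxE Kre_toKM gram_diag.
apply: contraction_entry => i; rewrite diag lerDl mulr_ge0 ?(ltW t0)//.
by rewrite sumr_ge0// => *; exact: sqr_ge0.
Qed.

Definition tau M t : R := Kre (\tr (res M t)).
Definition rho M t : R := rdot (M *m res M t) (M *m res M t).
Definition tau2 M t : R := rdot (res M t) (res M t).

(** As [t] tends to 0, [rho] converges to [|M^+|_F^2] for every [M], whereas [t * tau2] vanishes
    only where the Gram matrix is invertible. The integrated identities concern [tau]; the limit is
    read off [rho]. *)
Lemma tau_split M t : 0 < t -> tau M t = rho M t + t * tau2 M t.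
Proof.
move=> t0; rewrite /tau {1}res_split// mxtraceD mxtraceZ KreD Kre_toKM.
by rewrite /rho /tau2 !rdot_trace res_adj.
Qed.

Lemma rho_ge0 M t : 0 <= rho M t. Proof. exact: rdotxx_ge0. Qed.
Lemma tau2_ge0 M t : 0 <= tau2 M t. Proof. exact: rdotxx_ge0. Qed.
Lemma tau_ge0 M t : 0 < t -> 0 <= tau M t.
Proof. by move=> t0; rewrite tau_split// addr_ge0 ?rho_ge0// mulr_ge0 ?tau2_ge0// ltW. Qed.

Lemma scaled_tau_le M t : 0 < t -> t * tau M t <= (r * r)%:R.
Proof.
move=> t0; rewrite /tau -Kre_toKM -mxtraceZ (le_trans (ler_norm _))//.
by rewrite (le_trans (nm_tr _))// nm_scaled_res.
Qed.

Lemma trace_MresM M t : 0 < t ->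
  Kre (\tr (M *m res M t *m adjmx M)) = r%:R - t * tau M t.
Proof.
move=> t0; rewrite mxtrace_mulC mulmxA -/(gram M) gram_res// linearB /= mxtrace1.
by rewrite linearZ /= KreB Kre_toKM Kre_natr.
Qed.

Lemma adj_gram_mpinv M : adjmx M = gram M *m mpinv M.
Proof.
have [MYM _ MYh _] := mpinvP M.
by rewrite -[in LHS]MYM adjmxM MYh /gram mulmxA.
Qed.

Lemma res_adjM M t : 0 < t ->
  res M t *m adjmx M = mpinv M - toK t *: (res M t *m mpinv M).
Proof.
move=> t0; rewrite {1}adj_gram_mpinv mulmxA res_gram// mulmxBl mul1mx.
by rewrite scalemxAl.
Qed.

(** Exhibits [M^+] in the range of the Gram matrix, where [t S] is O(t) because
    [t S M^* M = t (1 - t S)]. This covers rank-deficient [M] too. *)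
Lemma mpinv_gram M : mpinv M = gram M *m (mpinv M *m adjmx (mpinv M) *m mpinv M).
Proof.
have [MYM YMY MYh YMh] := mpinvP M.
rewrite !mulmxA -adj_gram_mpinv -adjmxM YMh.
by rewrite YMY.
Qed.

(** The rate depends on [M]; only pointwise convergence is drawn from it. *)
Definition res_bound M : R :=
  (r%:R + (r * r)%:R) * nm (mpinv M *m adjmx (mpinv M) *m mpinv M).

Lemma nm_1mx n : nm (1%:M : 'M[K]_n) = n%:R.
Proof.
rewrite /nm (eq_bigr (fun=> 1)) ?sumr_const ?card_ord// => i _.
rewrite (bigD1 i)//= mxE eqxx Kabs1 big1 ?addr0// => j ji.
by rewrite mxE eq_sym (negbTE ji) Kabs0.
Qed.

Lemma nm_1Bres M t : 0 < t -> nm (1%:M - toK t *: res M t) <= r%:R + (r * r)%:R.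
Proof. by move=> t0; rewrite (le_trans (nmB _ _))// nm_1mx lerD2l nm_scaled_res. Qed.

Lemma nm_mpinv_res M t : 0 < t ->
  nm (mpinv M - res M t *m adjmx M) <= t * res_bound M.
Proof.
move=> t0; rewrite res_adjM// opprB addrCA subrr addr0 {1}mpinv_gram mulmxA.
rewrite res_gram// nmZ Kabs_toK gtr0_norm// ler_wpM2l ?(ltW t0)//.
by rewrite (le_trans (nmM _ _))// ler_wpM2r ?nm_ge0 ?nm_1Bres.
Qed.

Lemma gram_inv_mpinv M : gram M \in unitmx ->
  mpinv M = invmx (gram M) *m adjmx M /\
  invmx (gram M) = mpinv M *m adjmx (mpinv M).
Proof.
move=> Wu; have e : mpinv M = invmx (gram M) *m adjmx M.
  by rewrite [in RHS]adj_gram_mpinv mulKmx.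
split => //; rewrite {2}e adjmxM adjmxK adjmx_invmx gram_adj e.
by rewrite mulmxA -(mulmxA (invmx _)) -/(gram M) mulVmx// mul1mx.
Qed.

(** The bound is free of [t]: once [|M^+|_F^2] is integrable, it serves to dominate the traces of
    [S]. *)
Lemma nm_res_unit M t : 0 < t -> gram M \in unitmx ->
  nm (res M t) <= (1 + (r * r)%:R) * nm (mpinv M) ^+ 2.
Proof.
move=> t0 Wu; have [_ WE] := gram_inv_mpinv Wu.
have -> : res M t = invmx (gram M) - toK t *: res M t *m invmx (gram M).
  have := congr1 (mulmx^~ (invmx (gram M))) (res_gram M t0).
  by rewrite mulmxK// mulmxBl mul1mx.
have h : nm (invmx (gram M)) <= nm (mpinv M) ^+ 2.
  by rewrite WE (le_trans (nmM _ _))// nm_adj expr2.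
rewrite (le_trans (nmB _ _))// mulrDl mul1r lerD//.
by rewrite (le_trans (nmM _ _))// ler_pM ?nm_ge0 ?nm_scaled_res.
Qed.

(* The kernel of the Gram matrix is fixed by [t * res M t]. *)
Lemma singular_scaled_tau M t : 0 < t -> gram M \notin unitmx ->
  1 <= (r ^ 4)%:R * (t * tau M t).
Proof.
move=> t0; rewrite -row_free_unit -kermx_eq0 => N0.
set N := kermx _ in N0; have NG : N *m gram M = 0 by exact: mulmx_ker.
have NS : N = toK t *: (N *m res M t).
  have := congr1 (mulmx N) (gram_res M t0).
  rewrite mulmxA NG mul0mx mulmxBr mulmx1 -scalemxAr => /esym/eqP.
  by rewrite subr_eq0 => /eqP.
have n0 : 0 < nm N.
  rewrite lt_def nm_ge0 andbT; apply: contraNneq N0 => h.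
  apply/eqP/matrixP => i j; rewrite [RHS]mxE; apply: Kabs_eq0; apply/eqP.
  by rewrite eq_le Kabs_ge0 andbT -h Kabs_le_nm.
have h1 : 1 <= nm (toK t *: res M t).
  rewrite -(ler_pM2l n0) mulr1 {1}NS scalemxAr; exact: nmM.
have h2 := nm_sqr_le (toK t *: res M t).
have h3 : rdot (toK t *: res M t) (toK t *: res M t) <= t * tau M t.
  rewrite rdotZl rdotZr tau_split// mulrDr lerDr mulr_ge0 ?rho_ge0// ltW//.
have -> : (r ^ 4)%:R = ((r * r) ^ 2)%:R :> R by rewrite mulnn -expnM.
have h4 : 1 <= nm (toK t *: res M t) ^+ 2 by rewrite expr_ge1 ?nm_ge0.
rewrite (le_trans h4)// (le_trans h2)// ler_wpM2l//.
Qed.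

End Resolvent.

(** * Derivative and divergence of the regularized field *)

Section Directions.
Context {R : realType} {k : field_kind}.
Local Notation K := (Kfield R k).

(* An orthonormal basis of K over the reals. *)
Definition dirs : seq K :=
  match k return seq (Kfield R k) with
  | RealK => [:: 1]
  | ComplexK => [:: (1 : R[i]); ('i)%C]
  end.

Lemma sum_dirs_mul (z w : K) :
  \sum_(u <- dirs) Kre (u * z) * Kre (u * w) = Kre (Kconj z * w).
Proof.
rewrite /dirs; case: k z w => [z w|[a b] [c e]] /=.
  by rewrite big_seq1 !mul1r.
rewrite big_cons big_seq1 /=; ring.
Qed.

Lemma sum_dirs_conj (z : K) :
  \sum_(u <- dirs) Kre (u * (Kconj u * z)) = (kdim k)%:R * Kre z.
Proof.
rewrite /dirs; case: k z => [z|[a b]] /=; first by rewrite big_seq1 !mul1r.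
rewrite big_cons big_seq1 /=; ring.
Qed.

(** Over C the squares of the two directions cancel, since [1 + i^2 = 0]. *)
Lemma sum_dirs_sqr (z : K) :
  \sum_(u <- dirs) Kre (u * (u * z)) = (alpha k)%:R * Kre z.
Proof.
rewrite /dirs; case: k z => [z|[a b]] /=; first by rewrite big_seq1 !mul1r.
rewrite big_cons big_seq1 /=; ring.
Qed.

Lemma alpha_sqr (z : K) : (alpha k)%:R * Kre (z * z) = (alpha k)%:R * Kabs z ^+ 2.
Proof.
rewrite Kabs_sqrE; case: k z => [z|[a b]] /=; last by rewrite !mul0r.
by rewrite expr0n addr0 expr2.
Qed.

Lemma dirs_abs : {in dirs, forall u : K, Kabs u = 1}.
Proof.
move=> u; rewrite /dirs => ud; apply/eqP.
rewrite -(eqrXn2 (n := 2)) ?Kabs_ge0// Kabs_sqrE; apply/eqP.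
case: k u ud => u; rewrite !inE.
  by move=> /eqP ->; rewrite /= expr0n addr0.
by move=> /orP[] /eqP -> /=; rewrite !expr1n expr0n ?addr0 ?add0r.
Qed.

Lemma Kconj_dirs : {in dirs, forall u : K, Kconj u * u = 1}.
Proof. by move=> u ud; rewrite KconjM_toK dirs_abs// expr1n toK1. Qed.

End Directions.

Section Perturbation.
Context {R : realType} {k : field_kind}.
Local Notation K := (Kfield R k).
Variables l r : nat.
Implicit Types (M D : 'M[K]_(l, r)) (t s : R).

(** Resolvent identity, with the difference of the Gram matrices written as
    [(M' - M)^* M' + M^* (M' - M)]. *)
Lemma res_sub M M' t : 0 < t ->
  res M' t - res M t =
  - (res M t *m adjmx (M' - M) *m (M' *m res M' t)
     + adjmx (M *m res M t) *m (M' - M) *m res M' t).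
Proof.
move=> t0; have e : shifted M' t - shifted M t = adjmx (M' - M) *m M' + adjmx M *m (M' - M).
  rewrite /shifted opprD addrACA subrr addr0 /gram adjmxB mulmxBl mulmxBr.
  by rewrite addrA subrK.
have -> : res M' t - res M t =
    - (res M t *m (shifted M' t - shifted M t) *m res M' t).
  rewrite mulmxBr resVl// mulmxBl mul1mx opprB -mulmxA.
  by rewrite resVr// mulmx1.
by rewrite e mulmxDr mulmxDl adjmxM res_adj !mulmxA.
Qed.

(** Arranged so that [M' - M] is multiplied only by resolvents, [M S] and [M S M^*], whose norms are
    bounded independently of [M]. *)
Lemma Mres_sub M M' t : 0 < t ->
  M' *m res M' t - M *m res M t =
  (M' - M) *m res M' t
  - M *m res M t *m (adjmx (M' - M) *m (M' *m res M' t))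
  - M *m res M t *m adjmx M *m ((M' - M) *m res M' t).
Proof.
move=> t0; have -> : M' *m res M' t - M *m res M t =
    (M' - M) *m res M' t + M *m (res M' t - res M t).
  by rewrite mulmxBl mulmxBr addrA subrK.
rewrite res_sub// mulmxN mulmxDr opprD adjmxM res_adj !mulmxA addrA.
by [].
Qed.

(* Derivative of [fun M => M *m res M t] in the direction [D]. *)
Definition dMres M t D : 'M[K]_(l, r) :=
  D *m res M t - M *m res M t *m (adjmx D *m (M *m res M t))
  - M *m res M t *m adjmx M *m (D *m res M t).

Lemma nmM_le m n p (A : 'M[K]_(m, n)) (B : 'M[K]_(n, p)) a b :
  nm A <= a -> nm B <= b -> nm (A *m B) <= a * b.
Proof. by move=> Aa Bb; rewrite (le_trans (nmM _ _))// ler_pM// nm_ge0. Qed.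

Lemma nmD_le m n (A B : 'M[K]_(m, n)) a b :
  nm A <= a -> nm B <= b -> nm (A + B) <= a + b.
Proof. by move=> Aa Bb; rewrite (le_trans (nmD _ _))// lerD. Qed.

Lemma nmB_le m n (A B : 'M[K]_(m, n)) a b :
  nm A <= a -> nm B <= b -> nm (A - B) <= a + b.
Proof. by move=> Aa Bb; rewrite (le_trans (nmB _ _))// lerD. Qed.

Lemma nm_toK m n (A : 'M[K]_(m, n)) s : 0 <= s -> nm (toK s *: A) = s * nm A.
Proof. by move=> s0; rewrite nmZ Kabs_toK ger0_norm. Qed.

(** The bound depends on [t] and [c] only, so the expansion can be integrated whatever the law of
    [M]. The second-order term [D2] is there for rotations, whose orbits are curved; for
    translations it is 0. *)
Lemma Mres_expand t c : 0 < t -> 0 <= c -> exists2 C, 0 <= C &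
  forall M D D2 s, 0 < s -> s <= 1 -> nm D <= c -> nm D2 <= c ->
  let M' := M + toK s *: D + toK (s ^+ 2) *: D2 in
  [/\ nm (M *m res M t) <= C, nm (dMres M t D) <= C &
      nm (M' *m res M' t - M *m res M t - toK s *: dMres M t D) <= s ^+ 2 * C].
Proof.
move=> t0 c0; pose a : R := (r * r)%:R / t; pose b : R := (l * r)%:R * (1 + t^-1).
pose e : R := (l * l)%:R.
have a0 : 0 <= a by rewrite divr_ge0 ?(ltW t0).
have b0 : 0 <= b by rewrite mulr_ge0// addr_ge0// invr_ge0 ltW.
have e0 : 0 <= e by [].
(* [a], [b], [e] bound [S], [M S] and [M S M^*]. Along the path [|M' - M| <= 2 c s], so [L1] and
   [L2] are Lipschitz constants of [S] and [M S]. [L3] and [L4] bound the second-order errors of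
   [(M' - M) S'] and [(M' - M)^* M' S'], [C1] the derivative, and [C2] the final remainder. *)
pose L1 := 2 * c * (a * b + b * a).
pose L2 := 2 * c * (a + b * b + e * a).
pose L3 := c * L1 + c * a.
pose L4 := c * L2 + c * b.
pose C1 := c * a + b * (c * b) + e * (c * a).
pose C2 := L3 + b * L4 + e * L3.
have L10 : 0 <= L1 by rewrite /L1; do ?[by [] | apply: mulr_ge0 | apply: addr_ge0].
have L20 : 0 <= L2 by rewrite /L2; do ?[by [] | apply: mulr_ge0 | apply: addr_ge0].
have C10 : 0 <= C1 by rewrite /C1; do ?[by [] | apply: mulr_ge0 | apply: addr_ge0].
have C20 : 0 <= C2 by rewrite /C2 /L3 /L4; do ?[by [] | apply: mulr_ge0 | apply: addr_ge0].
exists (b + C1 + C2); first by do ?[by [] | apply: addr_ge0].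
move=> M D D2 s s0 s1 Dc D2c M'.
have sa (N : 'M[K]_(l, r)) : nm (res N t) <= a by exact: nm_res.
have sb (N : 'M[K]_(l, r)) : nm (N *m res N t) <= b by exact: nm_Mres.
have se (N : 'M[K]_(l, r)) : nm (N *m res N t *m adjmx N) <= e by exact: nm_MresM.
have sba (N : 'M[K]_(l, r)) : nm (adjmx (N *m res N t)) <= b.
  by rewrite nm_adj; exact: sb.
have [sa1 sa2] := (sa M, sa M'); have [sb1 sb2] := (sb M, sb M').
have [se1 sba1] := (se M, sba M).
have s00 : 0 <= s by exact: ltW.
pose De := M' - M.
have DeE : De = toK s *: D + toK (s ^+ 2) *: D2.
  by apply/matrixP => i j; rewrite !mxE; ring.
have Des : nm De <= s * (2 * c).
  have -> : s * (2 * c) = s * c + s * c by ring.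
  rewrite DeE; apply: nmD_le; first by rewrite nm_toK// ler_wpM2l.
  by rewrite nm_toK ?sqr_ge0// ler_pM ?nm_ge0 ?sqr_ge0// expr2 ler_piMl.
have dS : nm (res M' t - res M t) <= s * L1.
  rewrite res_sub// nmN -/De.
  have -> : s * L1 = a * (s * (2 * c)) * b + b * (s * (2 * c)) * a by rewrite /L1; ring.
  apply: nmD_le; apply: nmM_le => //; apply: nmM_le => //.
  by rewrite nm_adj.
have dF : nm (M' *m res M' t - M *m res M t) <= s * L2.
  rewrite Mres_sub// -/De.
  have -> : s * L2 = s * (2 * c) * a + b * (s * (2 * c) * b) + e * (s * (2 * c) * a).
    by rewrite /L2; ring.
  apply: nmB_le; last by apply: nmM_le => //; exact: nmM_le.
  apply: nmB_le; first exact: nmM_le.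
  by apply: nmM_le => //; apply: nmM_le => //; rewrite nm_adj.
have h3 : nm (De *m res M' t - toK s *: (D *m res M t)) <= s ^+ 2 * L3.
  have -> : De *m res M' t - toK s *: (D *m res M t) =
      toK s *: (D *m (res M' t - res M t)) + toK (s ^+ 2) *: (D2 *m res M' t).
    rewrite DeE mulmxDl -!scalemxAl mulmxBr scalerBr.
    by rewrite addrAC.
  have -> : s ^+ 2 * L3 = s * (c * (s * L1)) + s ^+ 2 * (c * a) by rewrite /L3; ring.
  apply: nmD_le; rewrite nm_toK ?sqr_ge0// ler_wpM2l ?sqr_ge0//; exact: nmM_le.
have h4 : nm (adjmx De *m (M' *m res M' t) - toK s *: (adjmx D *m (M *m res M t)))
    <= s ^+ 2 * L4.
  have -> : adjmx De *m (M' *m res M' t) - toK s *: (adjmx D *m (M *m res M t)) =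
      toK s *: (adjmx D *m (M' *m res M' t - M *m res M t)) +
      toK (s ^+ 2) *: (adjmx D2 *m (M' *m res M' t)).
    rewrite DeE adjmxD !adjmxZ !Kconj_toK mulmxDl -!scalemxAl mulmxBr scalerBr.
    by rewrite addrAC.
  have -> : s ^+ 2 * L4 = s * (c * (s * L2)) + s ^+ 2 * (c * b) by rewrite /L4; ring.
  by apply: nmD_le; rewrite nm_toK ?sqr_ge0// ler_wpM2l ?sqr_ge0//;
    apply: nmM_le; rewrite ?nm_adj.
split.
- by rewrite (le_trans (sb M))// -addrA lerDl addr_ge0.
- apply: (@le_trans _ _ C1); last by rewrite addrAC lerDr addr_ge0.
  apply: nmB_le; last by apply: nmM_le => //; exact: nmM_le.
  apply: nmB_le; first exact: nmM_le.
  by apply: nmM_le => //; apply: nmM_le => //; rewrite nm_adj.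
- apply: (@le_trans _ _ (s ^+ 2 * C2)); last first.
    by rewrite ler_wpM2l ?sqr_ge0// lerDr addr_ge0.
  rewrite Mres_sub// -/De /dMres.
  set X1 := De *m _; set X2 := adjmx De *m _.
  set Y1 := D *m res M t; set Y2 := adjmx D *m _.
  set F := M *m res M t; set G := F *m adjmx M.
  have -> : X1 - F *m X2 - G *m X1 - toK s *: (Y1 - F *m Y2 - G *m Y1) =
     (X1 - toK s *: Y1) - F *m (X2 - toK s *: Y2) - G *m (X1 - toK s *: Y1).
    rewrite !mulmxBr -!scalemxAr !scalerBr !opprB.
    apply/matrixP => i j; rewrite !mxE; ring.
  have -> : s ^+ 2 * C2 = s ^+ 2 * L3 + b * (s ^+ 2 * L4) + e * (s ^+ 2 * L3).
    by rewrite /C2; ring.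
  by apply: nmB_le; [apply: nmB_le => //|]; apply: nmM_le.
Qed.

Lemma Kim_sum (I : Type) (q : seq I) (F : I -> K) :
  Kim (\sum_(i <- q) F i) = \sum_(i <- q) Kim (F i).
Proof.
by elim: q => [|i q IH]; rewrite ?big_nil ?Kim0// !big_cons KimD IH.
Qed.

Lemma mul_delta_entry m n p q (A : 'M[K]_(m, n)) (B : 'M[K]_(p, q)) i j x y :
  (A *m delta_mx i j *m B) x y = A x i * B j y.
Proof.
rewrite -(mul_delta_mx (0 : 'I_1)) mulmxA -colE -mulmxA -rowE.
by rewrite mxE big_ord1 !mxE.
Qed.

Lemma adjmx_delta m n (i : 'I_m) (j : 'I_n) :
  adjmx (delta_mx i j : 'M[K]_(m, n)) = delta_mx j i.
Proof.
by rewrite /adjmx trmx_delta; apply/matrixP => x y; rewrite !mxE; exact: rmorph_nat.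
Qed.

Lemma tr_mul_delta m p (A : 'M[K]_(m, p)) i j : \tr (A *m delta_mx i j) = A j i.
Proof.
rewrite /mxtrace (bigD1 j)//= big1 ?addr0 => [|x xj]; rewrite mxE.
  rewrite (bigD1 i)//= mxE !eqxx mulr1 big1 ?addr0// => y yi.
  by rewrite mxE (negbTE yi) mulr0.
by apply: big1 => y _; rewrite mxE (negbTE xj) andbF mulr0.
Qed.

(** Turns the linear factor of an integration by parts into one real coordinate of a sketch. *)
Lemma rdot_dir (u : K) n q m (Y : 'M[K]_(n, m)) (X : 'M[K]_(n, q)) j a :
  rdot (u *: (Y *m delta_mx a j)) X = Kre (u * (adjmx X *m Y) j a).
Proof.
rewrite rdot_trace adjmxZ adjmxM adjmx_delta -scalemxAl mxtraceZ.
rewrite -mulmxA mxtrace_mulC tr_mul_delta.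
rewrite -Kre_conj KconjM KconjK; congr (Kre (_ * _)).
have -> : adjmx X *m Y = adjmx (adjmx Y *m X) by rewrite adjmxM adjmxK.
by rewrite [RHS]mxE [_^T _ _]mxE.
Qed.

Lemma Kim_herm_tr n (A : 'M[K]_n) : adjmx A = A -> Kim (\tr A) = 0.
Proof.
move=> hA; have : Kim (\tr (adjmx A)) = - Kim (\tr A).
  rewrite /mxtrace !Kim_sum -sumrN; apply: eq_bigr => i _.
  by rewrite !mxE Kim_conj.
by rewrite hA; lra.
Qed.

(* Divergence of [fun M => M *m res M t]. *)
Lemma div_Mres M t : 0 < t ->
  \sum_(u <- dirs) \sum_j \sum_a
     Kre (u * dMres M t (Kconj u *: delta_mx j a) j a) =
  (kdim k)%:R * l%:R * tau M t - (alpha k)%:R * rho M t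
  - (kdim k)%:R * (r%:R - t * tau M t) * tau M t.
Proof.
move=> t0; set S := res M t; set F := M *m S; set G := F *m adjmx M.
(* The middle term contains the adjoint of the direction, hence [u] and not its conjugate:
   multiplied by [u] and summed over [dirs], it yields the [alpha k] term. *)
have entry (u : K) j a : dMres M t (Kconj u *: delta_mx j a) j a =
    Kconj u * S a a - u * (F j a * F j a) - Kconj u * (G j j * S a a).
  rewrite /dMres -/S -/F -/G adjmxZ KconjK adjmx_delta.
  rewrite -!scalemxAl -!scalemxAr [F *m _]mulmxA [G *m _]mulmxA.
  have -> : delta_mx j a *m S = 1%:M *m delta_mx j a *m S by rewrite mul1mx.
  have subE (A B : 'M[K]_(l, r)) : (A - B) j a = A j a - B j a by rewrite !mxE.
  have scaleE v (A : 'M[K]_(l, r)) : (v *: A) j a = v * A j a by rewrite mxE.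
  rewrite !subE !scaleE.
  by rewrite !mul_delta_entry mxE eqxx mul1r.
transitivity (\sum_j \sum_a \sum_(u <- dirs)
    (Kre (u * (Kconj u * S a a)) - Kre (u * (u * (F j a * F j a)))
     - Kre (u * (Kconj u * (G j j * S a a))))).
  rewrite exchange_big; apply: eq_bigr => j _; rewrite exchange_big.
  apply: eq_bigr => a _; apply: eq_bigr => u _.
  by rewrite entry !mulrBr !KreB.
have trS : \sum_a Kre (S a a) = tau M t by rewrite /tau /mxtrace Kre_sum.
under eq_bigr => j _.
  under eq_bigr => a _.
    rewrite !sumrB sum_dirs_conj sum_dirs_sqr sum_dirs_conj alpha_sqr; over.
  rewrite !sumrB -mulr_sumr trS -!mulr_sumr; over.
rewrite !sumrB sumr_const card_ord -!mulr_sumr; congr (_ - _ - _).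
- by rewrite -[LHS]mulr_natr mulrAC.
- by rewrite /rho rdotxx.
- rewrite -mulrA; congr (_ * _).
  transitivity (Kre (\tr G * \tr S)).
    rewrite /mxtrace mulr_suml Kre_sum; apply: eq_bigr => j _.
    by rewrite mulr_sumr Kre_sum.
  rewrite KreM [Kim (\tr S)]Kim_herm_tr ?res_adj// mulr0 subr0.
  by rewrite trace_MresM.
Qed.

End Perturbation.

(** * Orthonormal bases and reflections *)

Section OrthonormalBases.
Context {R : realType} {k : field_kind}.
Local Notation K := (Kfield R k).

Lemma rdot_vec n (x y : 'M[K]_(n, 1)) : Kre ((adjmx x *m y) 0 0) = rdot x y.
Proof. by rewrite rdot_trace /mxtrace big_ord1. Qed.

Lemma sqnorm_vec n (x : 'M[K]_(n, 1)) : adjmx x *m x = (toK (rdot x x))%:M.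
Proof.
apply/matrixP => i j; rewrite !ord1 [RHS]mxE eqxx mulr1n.
apply: K_eq; rewrite ?Kre_toK ?Kim_toK ?rdot_vec//.
have := @Kim_herm_tr R k 1 (adjmx x *m x); rewrite /mxtrace big_ord1; apply.
by rewrite adjmxM adjmxK.
Qed.

Lemma rdotBr m n (A B C : 'M[K]_(m, n)) : rdot A (B - C) = rdot A B - rdot A C.
Proof.
have -> : B - C = B + toK (-1) *: C by rewrite toKN toK1 scaleN1r.
by rewrite rdotDr rdotZr mulN1r.
Qed.

Lemma rdotxxZ m n c (A : 'M[K]_(m, n)) : rdot (c *: A) (c *: A) = Kabs c ^+ 2 * rdot A A.
Proof.
rewrite !rdotxx mulr_sumr; apply: eq_bigr => i _; rewrite mulr_sumr.
by apply: eq_bigr => j _; rewrite mxE KabsM exprMn.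
Qed.

Lemma adjmx_row_mx m n p (A : 'M[K]_(m, n)) (B : 'M[K]_(m, p)) :
  adjmx (row_mx A B) = col_mx (adjmx A) (adjmx B).
Proof. by rewrite /adjmx tr_row_mx map_col_mx. Qed.

(** The coefficients [S] are returned rather than the basis, so that the range is visibly preserved.
    The hypothesis is phrased as injectivity because this passes to the last columns in the
    induction. *)
Lemma gram_schmidt n r (C : 'M[K]_(n, r)) :
  (forall m (x : 'M[K]_(r, m)), C *m x = 0 -> x = 0) ->
  exists S : 'M[K]_r, adjmx (C *m S) *m (C *m S) = 1%:M.
Proof.
elim: r C => [|r IH] C injC.
  by exists 1%:M; apply/matrixP => -[].
change 'M[K]_(n, 1 + r) in C.
pose c := lsubmx C; pose C' := rsubmx C.
have CE : C = row_mx c C' by rewrite hsubmxK.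
have injC' m (x : 'M[K]_(r, m)) : C' *m x = 0 -> x = 0.
  move=> C'x; have /injC : C *m col_mx (0 : 'M[K]_(1, m)) x = 0.
    by rewrite CE mul_row_col mulmx0 add0r.
  by move=> h; have := congr1 (@dsubmx K 1 r m) h; rewrite col_mxKd linear0.
have [S' QQ'] := IH C' injC'; set Q' := C' *m S' in QQ'.
(* Coefficients of the first column minus its projection on the others; the top entry 1 ensures that
   the combination is nonzero. *)
pose y : 'M[K]_(1 + r, 1) := col_mx 1%:M (- (S' *m (adjmx Q' *m c))).
pose c' := C *m y.
have c'E : c' = c - Q' *m (adjmx Q' *m c).
  by rewrite /c' CE mul_row_col mulmx1 mulmxN /Q' !mulmxA.
have c'0 : rdot c' c' != 0.
  apply/eqP => /rdotxx_eq0 /injC h; have := congr1 (@usubmx K 1 r 1) h.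
  rewrite col_mxKu linear0 => /matrixP/(_ 0 0); rewrite !mxE eqxx => /eqP.
  by rewrite oner_eq0.
have c'_gt0 : 0 < rdot c' c' by rewrite lt_def c'0 rdotxx_ge0.
pose nu : R := Num.sqrt (rdot c' c').
have nu0 : nu != 0 by rewrite sqrtr_eq0 -ltNge.
have Q'c' : adjmx Q' *m c' = 0.
  by rewrite c'E mulmxBr (mulmxA (adjmx Q') Q') QQ' mul1mx subrr.
pose q := toK nu^-1 *: c'.
have qq : adjmx q *m q = 1%:M.
  rewrite /q adjmxZ Kconj_toK -scalemxAl -scalemxAr sqnorm_vec scalerA -toKM.
  rewrite -mul_scalar_mx -scalar_mxM -toKM.
  have -> : nu^-1 * nu^-1 * rdot c' c' = 1.
    rewrite -[rdot c' c'](sqr_sqrtr (ltW c'_gt0)) -/nu expr2; field.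
    exact: nu0.
  by rewrite toK1.
have Q'q : adjmx Q' *m q = 0 by rewrite /q -scalemxAr Q'c' scaler0.
pose S : 'M[K]_(1 + r) := row_mx (toK nu^-1 *: y) (col_mx 0 S').
have CS : C *m S = row_mx q Q'.
  rewrite /S mul_mx_row -scalemxAr; congr row_mx.
  by rewrite CE mul_row_col mulmx0 add0r.
have e : adjmx (row_mx q Q') *m row_mx q Q' = 1%:M.
  rewrite adjmx_row_mx mul_col_row qq QQ' Q'q.
  have -> : adjmx q *m Q' = 0 by rewrite -[Q']adjmxK -adjmxM Q'q adjmx0.
  by rewrite -scalar_mx_block.
by exists S; rewrite CS.
Qed.

Lemma rank_adjmx m n (A : 'M[K]_(m, n)) : \rank (adjmx A) = \rank A.
Proof. by rewrite /adjmx mxrank_map mxrank_tr. Qed.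

Lemma full_rank_inj n r (C : 'M[K]_(n, r)) : \rank C = r ->
  forall m (x : 'M[K]_(r, m)), C *m x = 0 -> x = 0.
Proof.
move=> rC m x Cx; have Cu := gram_unitmx rC.
by rewrite -(mulKmx Cu x) -mulmxA Cx !mulmx0.
Qed.

(** [A = Q F] with [F = Q^* A] of full row rank: from this factorization the pseudoinverses of [A]
    and of its sketch are computed. *)
Lemma orthonormal_range n d (A : 'M[K]_(n, d)) :
  exists Q : 'M[K]_(n, \rank A),
    [/\ adjmx Q *m Q = 1%:M, Q *m (adjmx Q *m A) = A,
        (adjmx Q *m A) *m adjmx (adjmx Q *m A) \in unitmx &
        forall p (E : 'M[K]_(n, p)), adjmx A *m E = 0 -> adjmx Q *m E = 0].
Proof.
set r := \rank A; pose C : 'M[K]_(n, r) := col_base A.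
have rC : \rank C = r by exact/eqP/col_base_full.
have [S QQ] := gram_schmidt (full_rank_inj rC); set Q := C *m S in QQ.
have Su : S \in unitmx.
  by move: QQ; rewrite /Q mulmxA => h; have [] := mulmx1_unit h.
have CE : C = Q *m invmx S by rewrite mulmxK.
have AE : A = Q *m (invmx S *m row_base A) by rewrite mulmxA -CE mulmx_base.
have FE : adjmx Q *m A = invmx S *m row_base A by rewrite {1}AE mulmxA QQ mul1mx.
have Fu : (adjmx Q *m A) *m adjmx (adjmx Q *m A) \in unitmx.
  rewrite -{1}[adjmx Q *m A]adjmxK; apply: gram_unitmx; rewrite rank_adjmx FE.
  rewrite mxrankMfree ?row_base_free// mxrank_unit ?unitmx_inv//.
have QF : Q *m (adjmx Q *m A) = A by rewrite FE -AE.
exists Q; split => // p E AE0; set F := adjmx Q *m A in QF Fu.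
have FE0 : F *m adjmx F *m (adjmx Q *m E) = 0.
  by rewrite -mulmxA (mulmxA (adjmx F)) -adjmxM QF AE0 mulmx0.
by rewrite -(mulKmx Fu (adjmx Q *m E)) FE0 mulmx0.
Qed.

Lemma rank_orthonormal n r (Q : 'M[K]_(n, r)) :
  adjmx Q *m Q = 1%:M -> \rank Q = r.
Proof.
move=> QQ; apply/eqP; rewrite eqn_leq rank_leq_col /=.
by rewrite -{1}(mxrank1 K r) -QQ mxrankM_maxr.
Qed.

Lemma orthonormal_complement n r (Q : 'M[K]_(n, r)) : adjmx Q *m Q = 1%:M ->
  exists m, exists V : 'M[K]_(n, m),
    [/\ m = (n - r)%N, adjmx V *m V = 1%:M, adjmx Q *m V = 0 &
        Q *m adjmx Q + V *m adjmx V = 1%:M].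
Proof.
move=> QQ; have rQ := rank_orthonormal QQ.
pose X := row_base (kermx Q); exists (\rank (kermx Q)).
have XQ : X *m Q = 0 by apply/sub_kermxP; rewrite eq_row_base.
have rX : \rank (adjmx X) = \rank (kermx Q).
  by rewrite rank_adjmx; apply/eqP/row_base_free.
have [S VV] := gram_schmidt (full_rank_inj rX); set V := adjmx X *m S in VV.
have mE : \rank (kermx Q) = (n - r)%N by rewrite mxrank_ker rQ.
have rn : (r <= n)%N by rewrite -rQ rank_leq_row.
have QV : adjmx Q *m V = 0 by rewrite /V mulmxA -adjmxM XQ adjmx0 mul0mx.
have VQ : adjmx V *m Q = 0.
  by have := congr1 (@adjmx R k _ _) QV; rewrite adjmxM adjmxK adjmx0.
exists V; split => //.
(* [B] is an isometry of rank [n], so it can be cancelled on the right, and [Q Q^* + V V^* - 1]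
   annihilates it. *)
pose B := row_mx Q V; have BB : adjmx B *m B = 1%:M.
  by rewrite adjmx_row_mx mul_col_row QQ VV QV VQ -scalar_mx_block.
have rB : row_free B by rewrite /row_free (rank_orthonormal BB) mE subnKC.
apply/eqP; rewrite -subr_eq0 -(mulmx_free_eq0 _ rB) mulmxBl mul1mx mulmxDl.
rewrite /B !mul_mx_row -!mulmxA QQ VV QV VQ !mulmx0 !mulmx1.
by rewrite add_row_mx addr0 add0r subrr.
Qed.

(** Reflection in the hyperplane orthogonal to [b - g b']. A reflection can map one unit vector to
    another only if their inner product is real, hence the phase [g], which squared norms do not
    see. *)
Lemma householder n r (Q : 'M[K]_(n, r)) (b b' : 'M[K]_(n, 1)) :
  adjmx Q *m b = 0 -> adjmx Q *m b' = 0 -> rdot b b = 1 -> rdot b' b' = 1 ->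
  exists U : 'M[K]_n, exists g : K,
    [/\ unitary U, U *m Q = Q, Kabs g = 1 & U *m b = g *: b'].
Proof.
move=> Qb Qb' bb b'b'.
pose c : K := (adjmx b' *m b) 0 0.
(* [g] is the phase of [c], or 1 if [c] vanishes. *)
have [g [g1 gc]] : exists g : K, Kabs g = 1 /\ Kconj g * c = toK (Kabs c).
  have [c0|c0] := eqVneq (Kabs c) 0.
    by exists 1; rewrite Kabs1 c0 (Kabs_eq0 c0) mulr0 toK0.
  exists (toK (Kabs c)^-1 * c); split.
    by rewrite KabsM Kabs_toK ger0_norm ?invr_ge0 ?Kabs_ge0// mulVf.
  rewrite KconjM Kconj_toK -mulrA KconjM_toK -toKM; congr toK.
  by rewrite expr2 mulrA mulVf// mul1r.
pose w := b - g *: b'.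
have Qw : adjmx w *m Q = 0.
  rewrite -[Q]adjmxK -adjmxM /w mulmxBr Qb -scalemxAr Qb' scaler0 subrr.
  exact: adjmx0.
have wb : adjmx w *m b = (toK (1 - Kabs c))%:M.
  rewrite /w adjmxB adjmxZ mulmxBl -scalemxAl sqnorm_vec bb.
  have -> : adjmx b' *m b = c%:M by apply/matrixP => i j; rewrite !ord1 [RHS]mxE mulr1n.
  rewrite -mul_scalar_mx -scalar_mxM gc toKD toKN.
  by rewrite raddfB.
have [w0|w0] := eqVneq w 0.
  exists 1%:M, g; split => //; first by rewrite /unitary adjmx1 mulmx1.
    by rewrite mul1mx.
  by rewrite mul1mx; apply/eqP; rewrite -subr_eq0 -/w w0.
have bgb : rdot (g *: b') b = Kabs c.
  rewrite rdot_trace adjmxZ -scalemxAl /mxtrace big_ord1 mxE -/c gc.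
  exact: Kre_toK.
have ww : rdot w w = 2 * (1 - Kabs c).
  rewrite /w rdotBr !(rdotC (_ - _)) !rdotBr (rdotC b (g *: b')) bgb bb.
  by rewrite rdotxxZ g1 expr1n mul1r b'b'; ring.
have ww0 : rdot w w != 0 by apply: contraNneq w0 => /rdotxx_eq0 ->.
pose kp := 2 / rdot w w; pose U : 'M[K]_n := 1%:M - toK kp *: (w *m adjmx w).
have adjU : adjmx U = U.
  by rewrite /U adjmxB adjmx1 adjmxZ Kconj_toK adjmxM adjmxK.
exists U, g; split => //.
- have JJ : w *m adjmx w *m (w *m adjmx w) = toK (rdot w w) *: (w *m adjmx w).
    by rewrite -mulmxA (mulmxA (adjmx w)) sqnorm_vec mul_scalar_mx -scalemxAr.
  have kk : toK kp * (toK kp * toK (rdot w w)) = toK kp + toK kp :> K.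
    rewrite -!toKM -toKD; congr toK.
    by rewrite /kp; field.
  rewrite /unitary adjU /U; move: JJ; set J := w *m adjmx w => JJ.
  rewrite mulmxBl mul1mx mulmxBr mulmx1 -scalemxAl -scalemxAr JJ !scalerA.
  rewrite -mulrA kk scalerDl; set X := toK kp *: J.
  by apply/matrixP => i j; move: X => X; rewrite !mxE; ring.
- by rewrite /U mulmxBl mul1mx -scalemxAl -mulmxA Qw mulmx0 scaler0 subr0.
- rewrite /U mulmxBl mul1mx -scalemxAl -mulmxA wb mul_mx_scalar scalerA -toKM.
  have -> : kp * (1 - Kabs c) = 1.
    have h : 1 - Kabs c = rdot w w / 2 by rewrite ww; field.
    by rewrite /kp h; field.
  by rewrite toK1 scale1r /w opprB addrC subrK.
Qed.

End OrthonormalBases.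

Section SquaredColumns.
Context {R : realType} {k : field_kind}.
Local Notation K := (Kfield R k).

Lemma rdot_cols m n (A : 'M[K]_(m, n)) :
  rdot A A = \sum_j rdot (col j A) (col j A).
Proof.
rewrite rdotxx exchange_big; apply: eq_bigr => j _.
by rewrite rdotxx; apply: eq_bigr => i _; rewrite big_ord1 mxE.
Qed.

Lemma rdotM_le m n p (A : 'M[K]_(m, n)) (B : 'M[K]_(n, p)) :
  rdot (A *m B) (A *m B) <= nm B ^+ 2 * ((m * n) ^ 2)%:R * rdot A A.
Proof.
rewrite (le_trans (rdotxx_le_nm _))// -mulrA.
apply: (@le_trans _ _ (nm B ^+ 2 * nm A ^+ 2)).
  by rewrite mulrC -exprMn lerXn2r// ?nnegrE ?mulr_ge0 ?nm_ge0// nmM.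
by rewrite ler_wpM2l ?sqr_ge0// nm_sqr_le.
Qed.

Lemma Kre_le_rdot m n (A : 'M[K]_(m, n)) (c : K) a q :
  `|Kre (c * A a q)| <= Kabs c * (1 + rdot A A).
Proof.
rewrite (le_trans (Kre_abs_le _))// KabsM ler_wpM2l ?Kabs_ge0//.
have h := Kabs_le_rdot A a q; have := sqr_ge0 (Kabs (A a q) - 1).
by have := Kabs_ge0 (A a q); rewrite sqrrB1; lra.
Qed.

Lemma unitary_adj n (U : 'M[K]_n) : unitary U -> unitary (adjmx U).
Proof. by rewrite /unitary adjmxK => /mulmx1C. Qed.

End SquaredColumns.

(** * Measurability and the limit of vanishing regularization *)

Section MxMeasurable.
Context {R : realType} {k : field_kind} {d : measure_display}
  {X : measurableType d}.
Local Notation K := (Kfield R k).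
Implicit Types f g : X -> K.

Definition Kmeas f := measurable_fun setT (fun x => Kre (f x)) /\
                      measurable_fun setT (fun x => Kim (f x)).

Lemma Kmeas_cst c : Kmeas (fun=> c).
Proof. by split; exact: measurable_cst. Qed.

Lemma KmeasD f g : Kmeas f -> Kmeas g -> Kmeas (fun x => f x + g x).
Proof.
move=> [fr fi] [gr gi]; split.
  by under eq_fun do rewrite KreD; exact: measurable_funD.
by under eq_fun do rewrite KimD; exact: measurable_funD.
Qed.

Lemma KmeasM f g : Kmeas f -> Kmeas g -> Kmeas (fun x => f x * g x).
Proof.
move=> [fr fi] [gr gi]; split.
  by under eq_fun do rewrite KreM; apply: measurable_funB; exact: measurable_funM.
by under eq_fun do rewrite KimM; apply: measurable_funD; exact: measurable_funM.
Qed.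

Lemma Kmeas_re f c : Kmeas f -> measurable_fun setT (fun x => Kre (c * f x)).
Proof. by move=> mf; have [] := KmeasM (Kmeas_cst c) mf. Qed.

Lemma Kmeas_conj f : Kmeas f -> Kmeas (fun x => Kconj (f x)).
Proof.
move=> [fr fi]; split; first by under eq_fun do rewrite Kre_conj.
under eq_fun do rewrite Kim_conj.
exact: (measurableT_comp (@oppr_measurable R setT) fi).
Qed.

Lemma Kmeas_toK (h : X -> R) : measurable_fun setT h -> Kmeas (fun x => toK (h x)).
Proof.
move=> mh; split; first by under eq_fun do rewrite Kre_toK.
by under eq_fun do rewrite Kim_toK; exact: measurable_cst.
Qed.

Lemma measurable_Kabs2 f : Kmeas f -> measurable_fun setT (fun x => Kabs (f x) ^+ 2).
Proof.
move=> [fr fi]; under eq_fun do rewrite Kabs_sqrE.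
by apply: measurable_funD; exact: measurable_funX.
Qed.

(* The inverse as a real power, because powers are known to be measurable. *)
Lemma KV (x : K) : x^-1 = Kconj x * toK ((Kabs x ^+ 2) `^ (-1)).
Proof.
rewrite powR_inv1 ?sqr_ge0// toKV -KconjM_toK.
have [->|x0] := eqVneq x 0; first by rewrite mulr0 invr0 mulr0.
rewrite invfM mulrA mulfV ?mul1r//; apply: contra x0 => /eqP h.
by apply/eqP/Kabs_eq0; rewrite -Kabs_conj h Kabs0.
Qed.

Lemma KmeasV f : Kmeas f -> Kmeas (fun x => (f x)^-1).
Proof.
move=> mf; under eq_fun do rewrite KV; apply: KmeasM; first exact: Kmeas_conj.
apply: Kmeas_toK.
exact: (measurableT_comp (measurable_powR (-1)) (measurable_Kabs2 mf)).
Qed.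

Lemma Kmeas_sum (I : Type) (s : seq I) (F : I -> X -> K) :
  (forall i, Kmeas (F i)) -> Kmeas (fun x => \sum_(i <- s) F i x).
Proof.
move=> mF; elim: s => [|i s IH].
  by under eq_fun do rewrite big_nil; exact: Kmeas_cst.
by under eq_fun do rewrite big_cons; exact: KmeasD.
Qed.

Lemma Kmeas_prod (I : Type) (s : seq I) (F : I -> X -> K) :
  (forall i, Kmeas (F i)) -> Kmeas (fun x => \prod_(i <- s) F i x).
Proof.
move=> mF; elim: s => [|i s IH].
  by under eq_fun do rewrite big_nil; exact: Kmeas_cst.
by under eq_fun do rewrite big_cons; exact: KmeasM.
Qed.

Definition mxmeas m n (F : X -> 'M[K]_(m, n)) := forall i j, Kmeas (fun x => F x i j).

Lemma mxmeas_of_measurable m n (F : X -> 'M[K]_(m, n)) :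
  measurable_fun setT F -> mxmeas F.
Proof.
move=> mF i j; split.
  exact: measurableT_comp measurable_Kre (measurableT_comp (measurable_entry _ _) mF).
exact: measurableT_comp measurable_Kim (measurableT_comp (measurable_entry _ _) mF).
Qed.

Lemma measurable_of_mxmeas m n (F : X -> 'M[K]_(m, n)) :
  mxmeas F -> measurable_fun setT F.
Proof.
by move=> mF; apply: measurable_matrix => i j; have [] := mF i j; exact: measurable_toK.
Qed.

Lemma mxmeas_cst m n (A : 'M[K]_(m, n)) : mxmeas (fun=> A).
Proof. by move=> i j; exact: Kmeas_cst. Qed.

Lemma mxmeasD m n (F G : X -> 'M[K]_(m, n)) :
  mxmeas F -> mxmeas G -> mxmeas (fun x => F x + G x).
Proof. by move=> mF mG i j; under eq_fun do rewrite mxE; exact: KmeasD. Qed.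

Lemma mxmeasM m n p (F : X -> 'M[K]_(m, n)) (G : X -> 'M[K]_(n, p)) :
  mxmeas F -> mxmeas G -> mxmeas (fun x => F x *m G x).
Proof.
by move=> mF mG i j; under eq_fun do rewrite mxE; apply: Kmeas_sum => k0; exact: KmeasM.
Qed.

Lemma mxmeasZ m n (a : X -> K) (F : X -> 'M[K]_(m, n)) :
  Kmeas a -> mxmeas F -> mxmeas (fun x => a x *: F x).
Proof. by move=> ma mF i j; under eq_fun do rewrite mxE; exact: KmeasM. Qed.

Lemma mxmeasB m n (F G : X -> 'M[K]_(m, n)) :
  mxmeas F -> mxmeas G -> mxmeas (fun x => F x - G x).
Proof.
move=> mF mG; apply: mxmeasD => // i j.
have := KmeasM (Kmeas_cst (-1)) (mG i j).
by congr Kmeas; apply/funext => x; rewrite mxE mulN1r.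
Qed.

Lemma mxmeas_adj m n (F : X -> 'M[K]_(m, n)) :
  mxmeas F -> mxmeas (fun x => adjmx (F x)).
Proof. by move=> mF i j; under eq_fun do rewrite !mxE; exact: Kmeas_conj. Qed.

Lemma mxmeas_sketch n l r (F : X -> 'M[K]_(n, l)) (Q : 'M[K]_(n, r)) :
  mxmeas F -> mxmeas (fun x => adjmx (F x) *m Q).
Proof. by move=> mF; apply: mxmeasM; [exact: mxmeas_adj|exact: mxmeas_cst]. Qed.

Lemma Kmeas_tr n (F : X -> 'M[K]_n) : mxmeas F -> Kmeas (fun x => \tr (F x)).
Proof. by move=> mF; apply: Kmeas_sum => i; exact: mF. Qed.

Lemma Kmeas_det n (F : X -> 'M[K]_n) : mxmeas F -> Kmeas (fun x => \det (F x)).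
Proof.
move=> mF; apply: Kmeas_sum => s; apply: KmeasM; first exact: Kmeas_cst.
by apply: Kmeas_prod => i; exact: mF.
Qed.

(** Cramer's rule: entries of the inverse are cofactors divided by the determinant. *)
Lemma mxmeas_inv n (F : X -> 'M[K]_n) : (forall x, F x \in unitmx) ->
  mxmeas F -> mxmeas (fun x => invmx (F x)).
Proof.
move=> Fu mF i j; under eq_fun do rewrite /invmx Fu !mxE.
apply: KmeasM; first by apply: KmeasV; exact: Kmeas_det.
apply: KmeasM; first exact: Kmeas_cst.
by apply: Kmeas_det => a b; under eq_fun do rewrite !mxE; exact: mF.
Qed.

Lemma measurable_fun_rdot m n (F G : X -> 'M[K]_(m, n)) :
  mxmeas F -> mxmeas G -> measurable_fun setT (fun x => rdot (F x) (G x)).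
Proof.
move=> mF mG; apply: measurable_sum => i; apply: measurable_sum => j.
by have [] := KmeasM (Kmeas_conj (mF i j)) (mG i j).
Qed.

Lemma measurable_nm m n (F : X -> 'M[K]_(m, n)) :
  mxmeas F -> measurable_fun setT (fun x => nm (F x)).
Proof.
move=> mF; apply: measurable_sum => i; apply: measurable_sum => j.
rewrite (_ : (fun x => _) = fun x => (Kabs (F x i j) ^+ 2) `^ 2^-1); last first.
  apply/funext => x; rewrite powR12_sqrt ?sqr_ge0// sqrtr_sqr ger0_norm//.
  exact: Kabs_ge0.
exact: (measurableT_comp (measurable_powR 2^-1) (measurable_Kabs2 (mF i j))).
Qed.

Lemma mxmeas_res l r (M : X -> 'M[K]_(l, r)) t : 0 < t -> mxmeas M ->
  mxmeas (fun x => res (M x) t).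
Proof.
move=> t0 mM; apply: mxmeas_inv => [x|]; first exact: shifted_unit.
apply: mxmeasD; last exact: mxmeas_cst.
by apply: mxmeasM => //; exact: mxmeas_adj.
Qed.

Lemma mxmeas_dMres l r (F D : X -> 'M[K]_(l, r)) t :
  0 < t -> mxmeas F -> mxmeas D -> mxmeas (fun x => dMres (F x) t (D x)).
Proof.
move=> t0 mF mD; have mS := mxmeas_res t0 mF; have mFS := mxmeasM mF mS.
apply: mxmeasB; first apply: mxmeasB.
- exact: mxmeasM.
- by apply: mxmeasM => //; apply: mxmeasM => //; exact: mxmeas_adj.
- by apply: mxmeasM; apply: mxmeasM => //; exact: mxmeas_adj.
Qed.

(** Regularizations in (0, 1] that tend to 0, along a sequence because Fatou's lemma and dominated
    convergence concern sequences. *)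
Definition tseq (m : nat) : R := m.+1%:R^-1.

Lemma tseq_gt0 m : 0 < tseq m. Proof. by rewrite invr_gt0. Qed.
Lemma tseq_le1 m : tseq m <= 1. Proof. by rewrite invf_le1// ler1n. Qed.

Lemma cvg_tseq : tseq m @[m --> \oo] --> (0 : R).
Proof. exact: cvg_harmonic. Qed.

Lemma cvg_tseq_bound (u : nat -> R) (a C : R) :
  (forall m, `|a - u m| <= tseq m * C) -> u m @[m --> \oo] --> a.
Proof.
move=> h; apply/cvgrPdist_le => /= e e0.
have hC : tseq m * C @[m --> \oo] --> (0 : R).
  by rewrite -[X in _ --> X](mul0r C); apply: cvgMr_tmp; exact: cvg_tseq.
have /cvgrPdist_le/(_ e e0) := hC; apply: filterS => m /=.
rewrite sub0r normrN => hm; rewrite (le_trans (h m))// (le_trans _ hm)//.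
exact: ler_norm.
Qed.

Lemma cvg_tseq_bound_K (u : nat -> K) (a : K) (C : R) :
  (forall m, Kabs (a - u m) <= tseq m * C) ->
  (Kre (u m) @[m --> \oo] --> Kre a) /\ (Kim (u m) @[m --> \oo] --> Kim a).
Proof.
move=> h; split; apply: (@cvg_tseq_bound _ _ C) => m; rewrite (le_trans _ (h m))//.
  by rewrite -KreB Kre_abs_le.
by rewrite -KimB Kim_abs_le.
Qed.

Lemma cvg_mpinv_entry l r (M : 'M[K]_(l, r)) i j :
  (Kre ((res M (tseq m) *m adjmx M) i j) @[m --> \oo] --> Kre (mpinv M i j)) /\
  (Kim ((res M (tseq m) *m adjmx M) i j) @[m --> \oo] --> Kim (mpinv M i j)).
Proof.
apply: (@cvg_tseq_bound_K _ _ (res_bound M)) => m.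
rewrite (le_trans _ (nm_mpinv_res M (tseq_gt0 m)))//.
by have := Kabs_le_nm (mpinv M - res M (tseq m) *m adjmx M) i j; rewrite !mxE.
Qed.

(** The pseudoinverse is discontinuous where the rank drops, but it is a pointwise limit of the
    measurable [res M t *m adjmx M]. *)
Lemma mxmeas_mpinv l r (M : X -> 'M[K]_(l, r)) :
  mxmeas M -> mxmeas (fun x => mpinv (M x)).
Proof.
move=> mM i j; have mF m : mxmeas (fun x => res (M x) (tseq m) *m adjmx (M x)).
  by apply: mxmeasM; [apply: mxmeas_res => //; exact: tseq_gt0|exact: mxmeas_adj].
split.
  apply: (measurable_fun_cvg (fun m => (mF m i j).1)) => x _.
  exact: (cvg_mpinv_entry (M x) i j).1.
apply: (measurable_fun_cvg (fun m => (mF m i j).2)) => x _.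
exact: (cvg_mpinv_entry (M x) i j).2.
Qed.

End MxMeasurable.

Lemma mxmeas_id {R : realType} {k : field_kind} {n l : nat} :
  mxmeas (fun X : 'M[Kfield R k]_(n, l) => X).
Proof. by apply: mxmeas_of_measurable; exact: measurable_id. Qed.

(** * Exponential estimates and the comparison of first-order terms *)

Section ExpBounds.
Context {R : realType}.
Implicit Types x y q s a : R.

Lemma expR_sub1x_le y : `|expR y - 1 - y| <= y ^+ 2 * expR `|y|.
Proof.
have h0 : 0 <= expR y - 1 - y by rewrite -addrA -opprD subr_ge0 expR_ge1Dx.
rewrite ger0_norm//.
have h1 : 1 - y <= expR (- y) by have := expR_ge1Dx (- y).
have e0 := expR_gt0 y.
have h2 : expR y - 1 <= y * expR y.
  have : expR y * (1 - y) <= expR y * expR (- y) by rewrite ler_wpM2l// ltW.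
  by rewrite -expRD subrr expR0; lra.
have h3 : y <= expR y - 1 by have := expR_ge1Dx y; lra.
have [y0|y0] := leP 0 y.
  rewrite ger0_norm//; have : y * (expR y - 1) <= y * (y * expR y) by rewrite ler_wpM2l.
  have : expR y - 1 <= y * expR y by [].
  rewrite expr2; nra.
have e1 : 1 <= expR `|y| by rewrite -[leLHS]expR0 ler_expR.
have : expR y - 1 - y <= y ^+ 2 by rewrite expr2; nra.
by move=> /le_trans; apply; rewrite ler_peMr// sqr_ge0.
Qed.

Lemma sqr_le_expR a : 0 <= a -> a ^+ 2 <= 4 * expR a.
Proof.
move=> a0; have h : a / 2 <= expR (a / 2).
  by have := expR_ge1Dx (a / 2); lra.
have -> : expR a = expR (a / 2) ^+ 2 by rewrite -expRM_natl; congr expR; field.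
have : (a / 2) ^+ 2 <= expR (a / 2) ^+ 2 by rewrite lerXn2r// nnegrE ?expR_ge0// divr_ge0.
by rewrite !expr2; lra.
Qed.

(** Second-order expansion of a Gaussian translation density, [x] being the linear statistic and [q]
    half its variance. With [a = |x| + q] the exponent is at most [s a], and
    [a^2 exp a <= 4 exp (2 a)] absorbs the polynomial factor. *)
Lemma shift_weight_bound x q s : 0 <= q -> 0 < s -> s <= 1 ->
  `|expR (s * x - s ^+ 2 * q) - 1 - s * x| <=
  s ^+ 2 * ((4 * expR (2 * q) + q) * expR (2 * `|x|)).
Proof.
move=> q0 s0 s1; set y := s * x - s ^+ 2 * q; pose a := `|x| + q.
have a0 : 0 <= a by rewrite addr_ge0.
have ya : `|y| <= s * a.
  rewrite (le_trans (ler_normB _ _))// normrM (gtr0_norm s0) mulrDr lerD2l.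
  rewrite normrM (ger0_norm q0) ger0_norm ?sqr_ge0// expr2 -mulrA.
  by rewrite ler_wpM2l ?(ltW s0)// ler_piMl.
have ya1 : `|y| <= a by rewrite (le_trans ya)// ler_piMl.
have h1 : y ^+ 2 <= s ^+ 2 * a ^+ 2.
  by rewrite -exprMn -real_normK ?num_real// lerXn2r// nnegrE ?mulr_ge0// ltW.
have h2 : y ^+ 2 * expR `|y| <= s ^+ 2 * (4 * expR (2 * q) * expR (2 * `|x|)).
  apply: (@le_trans _ _ ((s ^+ 2 * a ^+ 2) * expR a)).
    by rewrite ler_pM ?sqr_ge0 ?expR_ge0 ?ler_expR.
  rewrite -mulrA ler_wpM2l ?sqr_ge0//.
  apply: (@le_trans _ _ ((4 * expR a) * expR a)).
    by rewrite ler_wpM2r ?expR_ge0 ?sqr_le_expR.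
  rewrite -!mulrA -!expRD le_eqVlt; apply/orP; left; apply/eqP.
  by congr (_ * expR _); rewrite /a; ring.
have e1 : 1 <= expR (2 * `|x|) by rewrite -[leLHS]expR0 ler_expR mulr_ge0.
have -> : expR y - 1 - s * x = (expR y - 1 - y) - s ^+ 2 * q by rewrite /y; ring.
rewrite (le_trans (ler_normB _ _))// mulrDl mulrDr lerD//.
  by rewrite (le_trans (expR_sub1x_le _)).
rewrite ger0_norm; last by rewrite mulr_ge0 ?sqr_ge0.
rewrite ler_wpM2l ?sqr_ge0//.
by rewrite ler_peMr.
Qed.

Lemma expR_abs_le x : expR `|x| <= expR x + expR (- x).
Proof.
have [x0|x0] := leP 0 x; first by rewrite ger0_norm// lerDl expR_ge0.
by rewrite ltr0_norm// lerDr expR_ge0.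
Qed.

(** Divide by [s] and let [s] tend to 0. Every integration by parts extracts its first-order term in
    this way, and so does the proof that the singular set is null. *)
Lemma le_sqr_eq0 (a C : R) :
  (forall s, 0 < s -> s <= 1 -> `|s * a| <= s ^+ 2 * C) -> a = 0.
Proof.
move=> h; apply/eqP; rewrite -normr_eq0; apply/negPn/negP => a0.
have {}a0 : 0 < `|a| by rewrite lt_def a0 normr_ge0.
have C0 : 0 < C.
  have := h 1 ltr01 (lexx _); rewrite mul1r expr1n mul1r.
  exact: lt_le_trans.
(* Small enough for [s * C <= |a| / 2]. *)
pose s := Num.min 1 (`|a| / (2 * C)).
have s0 : 0 < s by rewrite lt_min ltr01 divr_gt0// mulr_gt0.
have s1 : s <= 1 by rewrite ge_min lexx.
have := h s s0 s1; rewrite normrM (gtr0_norm s0) expr2 -mulrA ler_pM2l//.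
have : s * C <= `|a| / 2.
  have : s <= `|a| / (2 * C) by rewrite ge_min lexx orbT.
  rewrite -(ler_pM2r C0) => /le_trans; apply.
  by rewrite le_eqVlt; apply/orP; left; apply/eqP; field; rewrite gt_eqF.
lra.
Qed.

End ExpBounds.

(** * Expectations and limit theorems *)

Section Integrable.
Context d (T : measurableType d) {R : realType} (P : probability T R).
Implicit Types f g : T -> R.

Definition Pint f := P.-integrable setT (EFin \o f).

Lemma PintP f : Pint f -> measurable_fun setT f.
Proof. by move=> /measurable_int /measurable_EFinP. Qed.

Lemma Pint_le f g : measurable_fun setT f -> Pint g ->
  (forall w, `|f w| <= g w) -> Pint f.
Proof.
move=> mf ig fg; apply: le_integrable ig => //; first exact/measurable_EFinP.
by move=> w _ /=; rewrite lee_fin (le_trans (fg w))// ler_norm.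
Qed.

Lemma Pint_cst a : Pint (fun=> a).
Proof. exact: finite_measure_integrable_cst. Qed.

Lemma PintD f g : Pint f -> Pint g -> Pint (fun w => f w + g w).
Proof.
move=> fi gi; have := integrableD measurableT fi gi.
by apply: eq_integrable => // w _; rewrite /= EFinD.
Qed.

Lemma PintB f g : Pint f -> Pint g -> Pint (fun w => f w - g w).
Proof.
move=> fi gi; have := integrableB measurableT fi gi.
by apply: eq_integrable => // w _; rewrite /= EFinB.
Qed.

Lemma PintZ a f : Pint f -> Pint (fun w => a * f w).
Proof.
move=> fi; have := integrableZl measurableT a fi.
by apply: eq_integrable => // w _; rewrite /= EFinM.
Qed.

Lemma Pint_sum (I : Type) (s : seq I) (f : I -> T -> R) :
  (forall i, Pint (f i)) -> Pint (fun w => \sum_(i <- s) f i w).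
Proof.
move=> fi; elim: s => [|i s IH].
  by under eq_fun do rewrite big_nil; exact: Pint_cst.
by under eq_fun do rewrite big_cons; exact: PintD.
Qed.

Lemma Pexp_sum (I : Type) (s : seq I) (f : I -> T -> R) :
  (forall i, Pint (f i)) ->
  \int[P]_w (\sum_(i <- s) f i w) = \sum_(i <- s) \int[P]_w f i w.
Proof.
move=> fi; elim: s => [|i s IH].
  under eq_Rintegral do rewrite big_nil.
  by rewrite big_nil Rintegral_cst//= mul0r.
under eq_Rintegral do rewrite big_cons.
rewrite big_cons RintegralD//; first by rewrite IH.
  exact: fi.
exact: (Pint_sum s fi).
Qed.

(** Integrability travels with the equality, so that the lemma can be iterated over nested sums. *)
Lemma Pexp_scaled_sum (I : Type) (s : seq I) (f g : I -> T -> R) a :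
  (forall i, [/\ Pint (f i), Pint (g i) & a * \int[P]_w f i w = \int[P]_w g i w]) ->
  [/\ Pint (fun w => \sum_(i <- s) f i w), Pint (fun w => \sum_(i <- s) g i w) &
      a * \int[P]_w (\sum_(i <- s) f i w) = \int[P]_w (\sum_(i <- s) g i w)].
Proof.
move=> fg; have fi i : Pint (f i) by have [] := fg i.
have gi i : Pint (g i) by have [] := fg i.
split; [exact: Pint_sum|exact: Pint_sum|].
by rewrite !Pexp_sum// mulr_sumr; apply: eq_bigr => i _; have [] := fg i.
Qed.

Lemma Pexp_cst a : \int[P]_w a = a :> R.
Proof.
have -> : \int[P]_w a = a * fine (P setT) by exact: Rintegral_cst.
by rewrite probability_setT mulr1. Qed.

Lemma Pexp_norm_le f g : Pint f -> Pint g -> (forall w, `|f w| <= g w) ->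
  `|\int[P]_w f w| <= \int[P]_w g w.
Proof.
move=> fi gi fg; rewrite (le_trans (le_normr_Rintegral measurableT fi))//.
by apply: le_Rintegral => //; exact: integrable_norm.
Qed.

Lemma PexpE f : Pint f -> (\int[P]_w (f w)%:E)%E = (\int[P]_w f w)%:E.
Proof. by move=> fi; rewrite /Rintegral fineK// integrable_fin_num. Qed.

End Integrable.

Lemma cvg_bigsum {R : realType} (I : Type) (s : seq I) (F : I -> nat -> R)
    (a : I -> R) : (forall i, F i m @[m --> \oo] --> a i) ->
  \sum_(i <- s) F i m @[m --> \oo] --> \sum_(i <- s) a i.
Proof.
move=> Fa; elim: s => [|i s IH].
  by under eq_fun do rewrite big_nil; rewrite big_nil; exact: cvg_cst.
by under eq_fun do rewrite big_cons; rewrite big_cons; exact: cvgD.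
Qed.

Lemma cvg_rdot {R : realType} {k : field_kind} m n
    (F : nat -> 'M[Kfield R k]_(m, n)) (A : 'M[Kfield R k]_(m, n)) :
  (forall i j, (Kre (F q i j) @[q --> \oo] --> Kre (A i j)) /\
               (Kim (F q i j) @[q --> \oo] --> Kim (A i j))) ->
  rdot (F q) (F q) @[q --> \oo] --> rdot A A.
Proof.
move=> FA; apply: cvg_bigsum => i; apply: cvg_bigsum => j; have [cr ci] := FA i j.
under eq_fun do rewrite KreM Kre_conj Kim_conj mulNr opprK.
rewrite KreM Kre_conj Kim_conj mulNr opprK.
by apply: cvgD; apply: cvgM.
Qed.

Section Limits.
Context d (T : measurableType d) {R : realType} (P : probability T R).
Implicit Types (f g : T -> R) (F : nat -> T -> R).

Lemma Pdominated F f g : (forall m, measurable_fun setT (F m)) ->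
  measurable_fun setT f -> Pint P g ->
  {ae P, forall w, F m w @[m --> \oo] --> f w} ->
  {ae P, forall w, forall m, `|F m w| <= g w} ->
  Pint P f /\ (\int[P]_w F m w @[m --> \oo] --> \int[P]_w f w).
Proof.
move=> mF mf ig cf fg.
have [|||||i1 _ c1] := @dominated_convergence _ _ _ P setT measurableT
  (fun m w => (F m w)%:E) (EFin \o f) (EFin \o g).
- by move=> m; exact/measurable_EFinP.
- exact/measurable_EFinP.
- apply: filterS cf => w h _; apply: cvg_EFin; first exact: nearW.
  exact: h.
- exact: ig.
- by apply: filterS fg => w h m _; rewrite lee_fin.
split=> //; have ff := integrable_fin_num measurableT i1.
by apply: fine_cvg; rewrite /Rintegral fineK.
Qed.

Lemma Pfatou F f B : (forall m, measurable_fun setT (F m)) ->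
  measurable_fun setT f -> (forall m w, 0 <= F m w) ->
  (forall m, Pint P (F m)) -> (forall m, \int[P]_w F m w <= B) ->
  (forall w, F m w @[m --> \oo] --> f w) -> Pint P f.
Proof.
move=> mF mf F0 iF FB cf.
have f0 w : 0 <= f w.
  rewrite -(cvg_lim (@Rhausdorff R) (cf w)); apply: limr_ge.
    by apply/cvg_ex; exists (f w); exact: cf.
  exact: nearW.
apply/integrableP; split; first exact/measurable_EFinP.
have := @fatou _ _ _ P setT measurableT (fun m w => (F m w)%:E).
move=> /(_ (fun m => (measurable_EFinP _ _).2 (mF m))) /(_ _)/wrap[].
  by move=> m w _; rewrite lee_fin.
have -> : (\int[P]_w limn_einf (fun m => (F m w)%:E) =
           \int[P]_w `|(f w)%:E|)%E.
  apply: eq_integral => w _; rewrite gee0_abs ?lee_fin//.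
  apply: (cvg_limn_einf_sup _).1; apply: cvg_EFin; first exact: nearW.
  exact: cf.
move=> /le_lt_trans; apply.
apply: (@le_lt_trans _ _ B%:E); last exact: ltry.
rewrite limn_einf_lim; apply: lime_le.
  by apply/cvg_ex; eexists; exact: cvg_einfs_sup.
apply: nearW => m; apply: (@le_trans _ _ (\int[P]_w (F m w)%:E)%E).
  by apply: ereal_inf_lbound; exists m => //=.
by rewrite PexpE// lee_fin.
Qed.

Lemma Pexp_ae_eq f g : measurable_fun setT f -> measurable_fun setT g ->
  {ae P, forall w, f w = g w} -> \int[P]_w f w = \int[P]_w g w.
Proof.
move=> mf mg fg; congr fine; apply: ae_eq_integral => //.
- exact/measurable_EFinP.
- exact/measurable_EFinP.
- by apply: filterS fg => w h _ /=; rewrite h.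
Qed.

Lemma Pexp_le f g : Pint P f -> Pint P g -> (forall w, f w <= g w) ->
  \int[P]_w f w <= \int[P]_w g w.
Proof. by move=> fi gi fg; exact: le_Rintegral. Qed.

End Limits.

(** * Vanishing regularization in the integrated divergence *)

Section RegularizedLimit.
Context d (T : measurableType d) {R : realType} (P : probability T R).
Context {k : field_kind} {l r : nat}.
Local Notation K := (Kfield R k).
Variable M : T -> 'M[K]_(l, r).
Hypothesis mM : mxmeas M.

Lemma measurable_tau t : 0 < t -> measurable_fun setT (fun w => tau (M w) t).
Proof. by move=> t0; have [] := Kmeas_tr (mxmeas_res t0 mM). Qed.

Lemma measurable_rho t : 0 < t -> measurable_fun setT (fun w => rho (M w) t).
Proof.
by move=> t0; apply: measurable_fun_rdot; apply: mxmeasM => //; exact: mxmeas_res.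
Qed.

Lemma measurable_tau2 t : 0 < t -> measurable_fun setT (fun w => tau2 (M w) t).
Proof. by move=> t0; apply: measurable_fun_rdot; exact: mxmeas_res. Qed.

Lemma Pint_tau t : 0 < t -> Pint P (fun w => tau (M w) t).
Proof.
move=> t0; apply: (Pint_le (measurable_tau t0) (Pint_cst P ((r * r)%:R / t))) => w.
by rewrite ger0_norm ?tau_ge0// ler_pdivlMr// mulrC scaled_tau_le.
Qed.

Lemma Pint_rho t : 0 < t -> Pint P (fun w => rho (M w) t).
Proof.
move=> t0; apply: (Pint_le (measurable_rho t0) (Pint_tau t0)) => w.
rewrite ger0_norm ?rho_ge0// tau_split// lerDl mulr_ge0 ?tau2_ge0//.
exact: ltW.
Qed.

Definition rho0 (A : 'M[K]_(l, r)) : R := rdot (mpinv A) (mpinv A).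

Lemma measurable_rho0 : measurable_fun setT (fun w => rho0 (M w)).
Proof. by apply: measurable_fun_rdot; exact: mxmeas_mpinv. Qed.

Lemma rhoE (A : 'M[K]_(l, r)) t :
  rho A t = rdot (res A t *m adjmx A) (res A t *m adjmx A).
Proof. by rewrite /rho -rdot_adj adjmxM res_adj. Qed.

Lemma cvg_rho (A : 'M[K]_(l, r)) : rho A (tseq m) @[m --> \oo] --> rho0 A.
Proof.
under eq_fun do rewrite rhoE.
by apply: cvg_rdot => i j; exact: cvg_mpinv_entry.
Qed.

(** [err_le] makes the error vanish with [t] wherever the Gram matrix is invertible; [err_ge] bounds
    the mean of [tau] before any integrability of the limit is known. *)
Variables (c kap C0 C1 : R) (err : R -> T -> R).
Hypotheses (c0 : 0 < c) (C00 : 0 <= C0).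
Hypothesis merr : forall t, 0 < t -> measurable_fun setT (err t).
Hypothesis err_le : forall t w, 0 < t -> t <= 1 ->
  `|err t w| <= C0 * t * (tau (M w) t + tau (M w) t ^+ 2 + tau2 (M w) t).
Hypothesis err_ge : forall t w, 0 < t -> t <= 1 -> - C1 <= err t w.
(* Integrated divergence of the field [M *m res M t]. *)
Hypothesis identity : forall t, 0 < t -> t <= 1 ->
  \int[P]_w (c * tau (M w) t + err t w) = kap.

Let tau2_le (A : 'M[K]_(l, r)) t : 0 < t -> t * tau2 A t <= tau A t.
Proof. by move=> t0; rewrite [leRHS]tau_split// lerDr rho_ge0. Qed.

(** As [t * tau <= r^2] and [t * tau2 <= tau], the error is at most of the order of [tau]. *)
Let err_tau t w : 0 < t -> t <= 1 ->
  `|err t w| <= C0 * (2 + (r * r)%:R) * tau (M w) t.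
Proof.
move=> t0 t1; rewrite (le_trans (err_le w t0 t1))// -!mulrA ler_wpM2l//.
have h1 := scaled_tau_le (M w) t0; have h2 := tau2_le (M w) t0.
have h3 := tau_ge0 (M w) t0; rewrite expr2; nra.
Qed.

Let Pint_err t : 0 < t -> t <= 1 -> Pint P (err t).
Proof.
move=> t0 t1; apply: (Pint_le (merr t0) (PintZ (C0 * (2 + (r * r)%:R)) (Pint_tau t0))) => w.
exact: err_tau.
Qed.

Lemma Exp_tau_le t : 0 < t -> t <= 1 -> \int[P]_w tau (M w) t <= (kap + C1) / c.
Proof.
move=> t0 t1; rewrite ler_pdivlMr// -(identity t0 t1).
rewrite RintegralD//; last 2 first.
- exact: PintZ (Pint_tau t0).
- exact: Pint_err.
rewrite RintegralZl//; last exact: Pint_tau.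
rewrite mulrC -addrA lerDl.
have : \int[P]_w (- C1) <= \int[P]_w err t w.
  by apply: Pexp_le => //; [exact: Pint_cst|exact: Pint_err|move=> w; exact: err_ge].
by rewrite Pexp_cst; lra.
Qed.

(* [t * tau] is bounded below on the singular set, while its mean is O(t). *)
Lemma ae_gram_unit : {ae P, forall w, gram (M w) \in unitmx}.
Proof.
pose N := [set w | Kabs (\det (gram (M w))) ^+ 2 == 0].
have mdet : measurable_fun setT (fun w => Kabs (\det (gram (M w))) ^+ 2).
  apply: measurable_Kabs2; apply: Kmeas_det; apply: mxmeasM => //.
  exact: mxmeas_adj.
have mN : measurable N.
  rewrite (_ : N = (fun w => Kabs (\det (gram (M w))) ^+ 2) @^-1` [set 0]).
    by rewrite -[X in measurable X]setTI; exact: mdet.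
  by apply/seteqP; split=> w /= /eqP.
have NP w : N w <-> gram (M w) \notin unitmx.
  rewrite unitmxE unitfE negbK /N /= sqrf_eq0; split=> /eqP.
    by move=> /Kabs_eq0 ->.
  by move=> ->; rewrite Kabs0.
exists N; split => //; last first.
  by move=> w /= h; apply/NP/negP.
have iN : Pint P \1_N by apply: integrable_indic.
have EN : (P N = (\int[P]_w \1_N w)%:E)%E.
  by rewrite -PexpE// integral_indic// setIT.
rewrite EN; congr (_%:E).
apply: (@le_sqr_eq0 _ _ ((r ^ 4)%:R * ((kap + C1) / c))) => s s0 s1.
have N0 : 0 <= \int[P]_w (\1_N w : R) by apply: Rintegral_ge0 => w _.
rewrite ger0_norm ?mulr_ge0 ?(ltW s0)// expr2 -mulrA ler_pM2l//.
apply: (@le_trans _ _ (\int[P]_w ((r ^ 4)%:R * s * tau (M w) s))).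
  apply: Pexp_le => //; first exact: PintZ (Pint_tau s0).
  move=> w; rewrite indicE; case: (boolP (w \in N)) => [|_].
    by rewrite inE => /NP h; rewrite -mulrA; exact: singular_scaled_tau.
  by rewrite mulr_ge0 ?tau_ge0// mulr_ge0// ltW.
rewrite RintegralZl//; last exact: Pint_tau.
by rewrite -mulrA mulrCA ler_wpM2l ?(ltW s0)// ler_wpM2l// Exp_tau_le.
Qed.

(** Fatou's lemma for [rho], which converges everywhere and is at most [tau], whose means are
    bounded uniformly in [t]. *)
Lemma Pint_rho0 : Pint P (fun w => rho0 (M w)).
Proof.
apply: (@Pfatou _ _ _ _ (fun m w => rho (M w) (tseq m)) _ ((kap + C1) / c)).
- by move=> m; exact: measurable_rho (tseq_gt0 _).
- exact: measurable_rho0.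
- by move=> m w; exact: rho_ge0.
- by move=> m; exact: Pint_rho (tseq_gt0 _).
- move=> m; have t0 := tseq_gt0 (R := R) m.
  rewrite (le_trans _ (Exp_tau_le t0 (tseq_le1 _)))//; apply: Pexp_le.
  + exact: Pint_rho.
  + exact: Pint_tau.
  + move=> w; rewrite [leRHS]tau_split// lerDl mulr_ge0 ?tau2_ge0//.
    exact: ltW.
- by move=> w; exact: cvg_rho.
Qed.

(** The majorant of [nm_res_unit], valid where the Gram matrix is invertible. *)
Let B (A : 'M[K]_(l, r)) : R := (1 + (r * r)%:R) * nm (mpinv A) ^+ 2.

Let B_ge0 A : 0 <= B A. Proof. by rewrite mulr_ge0 ?sqr_ge0// addr_ge0. Qed.

Let tau_le_B A t : 0 < t -> gram A \in unitmx -> tau A t <= B A.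
Proof.
move=> t0 Au; rewrite (le_trans (ler_norm _))// (le_trans (nm_tr _))//.
exact: nm_res_unit.
Qed.

Let tau2_le_B A t : 0 < t -> gram A \in unitmx -> tau2 A t <= B A ^+ 2.
Proof.
move=> t0 Au; rewrite (le_trans (rdotxx_le_nm _))// lerXn2r ?nnegrE ?nm_ge0//.
exact: nm_res_unit.
Qed.

(** Dominated convergence in [identity], with a multiple of [rho0] as majorant. Domination and
    convergence are established off the singular set, which is null by [ae_gram_unit]. *)
Lemma Exp_rho0 : \int[P]_w rho0 (M w) = kap / c.
Proof.
have iB : Pint P (fun w => (1 + (r * r)%:R) * (((r * l) ^ 2)%:R * rho0 (M w))).
  by do 2!apply: PintZ; exact: Pint_rho0.
pose C2 := c + C0 * (2 + (r * r)%:R).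
have C20 : 0 <= C2 by rewrite addr_ge0 ?(ltW c0)// mulr_ge0// addr_ge0.
have [|||||_ h] := @Pdominated _ _ _ P
  (fun m w => c * tau (M w) (tseq m) + err (tseq m) w)
  (fun w => c * rho0 (M w))
  (fun w => C2 * ((1 + (r * r)%:R) * (((r * l) ^ 2)%:R * rho0 (M w)))).
- move=> m; apply: measurable_funD; last exact: merr (tseq_gt0 _).
  by apply: measurable_funM => //; exact: measurable_tau (tseq_gt0 _).
- by apply: measurable_funM => //; exact: measurable_rho0.
- exact: PintZ.
- apply: filterS ae_gram_unit => w Wu.
  rewrite -[X in _ --> X]addr0; apply: cvgD.
    apply: cvgMl_tmp.
    rewrite (_ : (fun m => _) = fun m => rho (M w) (tseq m) +
        tseq m * tau2 (M w) (tseq m)); last first.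
      by apply/funext => m; rewrite tau_split// tseq_gt0.
    rewrite -[rho0 (M w)]addr0; apply: cvgD; first exact: cvg_rho.
    apply: (@cvg_tseq_bound _ _ _ (B (M w) ^+ 2)) => m.
    rewrite sub0r normrN ger0_norm ?mulr_ge0 ?tau2_ge0 ?(ltW (tseq_gt0 _))//.
    by rewrite ler_pM2l ?tseq_gt0// tau2_le_B ?tseq_gt0.
  apply: (@cvg_tseq_bound _ _ _ (C0 * (B (M w) + B (M w) ^+ 2 + B (M w) ^+ 2))) => m.
  have t0 := tseq_gt0 (R := R) m.
  rewrite sub0r normrN (le_trans (err_le w t0 (tseq_le1 _)))//.
  rewrite [leRHS]mulrA [_ * C0]mulrC ler_wpM2l ?mulr_ge0 ?(ltW t0)//.
  have h := tau_le_B t0 Wu; have h' := tau2_le_B t0 Wu.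
  rewrite !lerD// lerXn2r ?nnegrE ?tau_ge0//.
- apply: filterS ae_gram_unit => w Wu m; have t0 := tseq_gt0 (R := R) m.
  rewrite (le_trans (ler_normD _ _))//.
  have h1 := err_tau w t0 (tseq_le1 _).
  have h2 : `|c * tau (M w) (tseq m)| = c * tau (M w) (tseq m).
    by rewrite ger0_norm// mulr_ge0 ?(ltW c0) ?tau_ge0.
  apply: (@le_trans _ _ (C2 * tau (M w) (tseq m))).
    by rewrite h2 /C2 mulrDl lerD2l.
  rewrite ler_wpM2l// (le_trans (tau_le_B t0 Wu))// ler_wpM2l ?addr_ge0//.
  exact: nm_sqr_le.
have hk : (fun m => \int[P]_w (c * tau (M w) (tseq m) + err (tseq m) w)) = cst kap.
  by apply/funext => m; rewrite identity ?tseq_gt0 ?tseq_le1.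
rewrite hk in h; have := cvg_unique (@Rhausdorff R) h (cvg_cst _).
rewrite RintegralZl//; last exact: Pint_rho0.
by move=> <-; rewrite mulrAC mulfV ?mul1r// gt_eqF.
Qed.

End RegularizedLimit.

Section PinvLimits.
Context d (T : measurableType d) {R : realType} (P : probability T R).
Context {k : field_kind} {l r p : nat}.
Local Notation K := (Kfield R k).
Variables (M : T -> 'M[K]_(l, r)) (N : T -> 'M[K]_(l, p)).
Hypotheses (mM : mxmeas M) (mN : mxmeas N).

Let Zt t w : 'M[K]_(r, p) := res (M w) t *m adjmx (M w) *m N w.
Let Z w : 'M[K]_(r, p) := mpinv (M w) *m N w.

Let mZt t : 0 < t -> mxmeas (Zt t).
Proof.
move=> t0; apply: mxmeasM => //; apply: mxmeasM; first exact: mxmeas_res.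
exact: mxmeas_adj.
Qed.

Let mZ : mxmeas Z. Proof. by apply: mxmeasM => //; exact: mxmeas_mpinv. Qed.

Let kappa : R := r%:R + (r * r)%:R.
Let kappa_ge0 : 0 <= kappa. Proof. by rewrite addr_ge0. Qed.

(** [Zt] is [Z] multiplied by [1 - t S], which is bounded uniformly in [M] and [t]: the limit
    dominates its own approximations. *)
Let nm_Zt t w : 0 < t -> nm (Zt t w) <= kappa * nm (Z w).
Proof.
move=> t0; have -> : Zt t w = (1%:M - toK t *: res (M w) t) *m Z w.
  rewrite /Zt res_adjM// /Z mulmxBl [RHS]mulmxBl mul1mx.
  by rewrite -!scalemxAl !mulmxA.
by rewrite (le_trans (nmM _ _))// ler_wpM2r ?nm_ge0// nm_1Bres.
Qed.

Let cvg_Zt w i j :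
  (Kre (Zt (tseq m) w i j) @[m --> \oo] --> Kre (Z w i j)) /\
  (Kim (Zt (tseq m) w i j) @[m --> \oo] --> Kim (Z w i j)).
Proof.
apply: (@cvg_tseq_bound_K _ _ _ _ (res_bound (M w) * nm (N w))) => m.
have -> : Z w i j - Zt (tseq m) w i j =
    ((mpinv (M w) - res (M w) (tseq m) *m adjmx (M w)) *m N w) i j.
  have subE (A B : 'M[K]_(r, p)) : (A - B) i j = A i j - B i j by rewrite !mxE.
  by rewrite mulmxBl subE.
rewrite (le_trans (Kabs_le_nm _ _ _))// mulrA (le_trans (nmM _ _))//.
by rewrite ler_wpM2r ?nm_ge0// nm_mpinv_res// tseq_gt0.
Qed.

Let cvg_rdot_Zt w : rdot (Zt (tseq m) w) (Zt (tseq m) w) @[m --> \oo] -->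
  rdot (Z w) (Z w).
Proof. by apply: cvg_rdot => i j; exact: cvg_Zt. Qed.

Lemma mpinv_second_moment B :
  (forall t, 0 < t -> t <= 1 -> Pint P (fun w => rdot (Zt t w) (Zt t w))) ->
  (forall t, 0 < t -> t <= 1 -> \int[P]_w rdot (Zt t w) (Zt t w) <= B) ->
  Pint P (fun w => rdot (Z w) (Z w)).
Proof.
move=> iZt ZtB.
apply: (@Pfatou _ _ _ _ (fun m w => rdot (Zt (tseq m) w) (Zt (tseq m) w)) _ B).
- by move=> m; apply: measurable_fun_rdot; apply: mZt; exact: tseq_gt0.
- exact: measurable_fun_rdot.
- by move=> m w; exact: rdotxx_ge0.
- by move=> m; apply: iZt; [exact: tseq_gt0|exact: tseq_le1].
- by move=> m; apply: ZtB; [exact: tseq_gt0|exact: tseq_le1].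
- by move=> w; exact: cvg_rdot_Zt.
Qed.

Hypothesis iZ : Pint P (fun w => rdot (Z w) (Z w)).

Lemma cvg_mpinv_second_moment :
  \int[P]_w rdot (Zt (tseq m) w) (Zt (tseq m) w) @[m --> \oo] -->
  \int[P]_w rdot (Z w) (Z w).
Proof.
pose c := kappa ^+ 2 * ((r * p) ^ 2)%:R.
have [|||||_ h] := @Pdominated _ _ _ P
  (fun m w => rdot (Zt (tseq m) w) (Zt (tseq m) w))
  (fun w => rdot (Z w) (Z w)) (fun w => c * rdot (Z w) (Z w)).
- by move=> m; apply: measurable_fun_rdot; apply: mZt; exact: tseq_gt0.
- exact: measurable_fun_rdot.
- exact: PintZ.
- by apply: aeW => w; exact: cvg_rdot_Zt.
- apply: aeW => w m; rewrite ger0_norm ?rdotxx_ge0//.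
  rewrite (le_trans (rdotxx_le_nm _))//.
  apply: (@le_trans _ _ ((kappa * nm (Z w)) ^+ 2)).
    by rewrite lerXn2r ?nnegrE ?nm_ge0 ?mulr_ge0 ?nm_ge0// nm_Zt// tseq_gt0.
  by rewrite exprMn /c -mulrA ler_wpM2l ?sqr_ge0// nm_sqr_le.
exact: h.
Qed.

Lemma cvg_mpinv_mean c i j :
  Pint P (fun w => Kre (c * Z w i j)) /\
  (\int[P]_w Kre (c * Zt (tseq m) w i j) @[m --> \oo] -->
   \int[P]_w Kre (c * Z w i j)).
Proof.
pose C := Kabs c * kappa.
apply: (@Pdominated _ _ _ P _ _
  (fun w => C * (1 + ((r * p) ^ 2)%:R * rdot (Z w) (Z w)))).
- by move=> m; have [] := KmeasM (Kmeas_cst c) (mZt (tseq_gt0 m) i j).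
- by have [] := KmeasM (Kmeas_cst c) (mZ i j).
- by apply: PintZ; apply: PintD; [exact: Pint_cst|exact: PintZ].
- apply: aeW => w; have [cr ci] := cvg_Zt w i j.
  under eq_fun do rewrite KreM.
  by rewrite KreM; apply: cvgB; apply: cvgM => //; exact: cvg_cst.
- apply: aeW => w m; rewrite (le_trans (Kre_abs_le _))// KabsM /C -mulrA.
  rewrite ler_wpM2l ?Kabs_ge0// (le_trans (Kabs_le_nm _ _ _))//.
  rewrite (le_trans (nm_Zt _ (tseq_gt0 m)))// ler_wpM2l//.
  have h := nm_sqr_le (Z w); have h0 := nm_ge0 (Z w).
  by rewrite (le_trans _ (lerD (lexx 1) h))// expr2; nra.
Qed.

End PinvLimits.

Section Leak.
Context d (T : measurableType d) {R : realType} (P : probability T R).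
Context {k : field_kind} {n l : nat}.
Local Notation K := (Kfield R k).
Variable Omega : T -> 'M[K]_(n, l).

(* [mpinv (Q^* Omega)^* (Omega^* E)] is the part of the sketched solution that
   comes from the residual [E]. *)
Definition leak r p (Q : 'M[K]_(n, r)) (E : 'M[K]_(n, p)) w : 'M[K]_(r, p) :=
  mpinv (adjmx (Omega w) *m Q) *m (adjmx (Omega w) *m E).

(** All that the final computation needs from the law of the embedding; [v] is the relative excess
    error. The mean is tested through [Kre (c * _)] for every scalar [c], which covers imaginary
    parts and linear combinations. *)
Definition leak_moments r (Q : 'M[K]_(n, r)) (v : R) : Prop :=
  {ae P, forall w, gram (adjmx (Omega w) *m Q) \in unitmx} /\
  forall p (E : 'M[K]_(n, p)), adjmx Q *m E = 0 ->
    [/\ Pint P (fun w => rdot (leak Q E w) (leak Q E w)),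
        \int[P]_w rdot (leak Q E w) (leak Q E w) = v * rdot E E &
        forall c a q, Pint P (fun w => Kre (c * leak Q E w a q)) /\
                      \int[P]_w Kre (c * leak Q E w a q) = 0].

End Leak.

(** * Gaussian embeddings *)

Section NormalShift.
Context {R : realType}.
Local Notation mu := (@lebesgue_measure R).
Local Notation N01 := (@normal_prob R 0 1).

Lemma lebesgue_measureD (c : R) (A : set R) : measurable A ->
  mu ((fun x => x + c) @^-1` A) = mu A.
Proof.
have mD : measurable_fun setT (fun x : measurableTypeR R => (x + c : measurableTypeR R)).
  by apply: measurable_funD.
pose p := [the measure _ _ of pushforward mu
   (fun x : measurableTypeR R => (x + c : measurableTypeR R))].
move=> mA; apply/esym; apply: (@lebesgue_measure_unique R (p mD)) => //= _ [[a b]] _ <-.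
rewrite /pushforward.
rewrite (_ : _ @^-1` _ = `](a - c), (b - c)]%classic).
  rewrite !lebesgue_measure_itv/= !lte_fin ltrD2r.
  by case: ifP => // _; rewrite -!EFinB; congr EFin; ring.
by apply/seteqP; split => x /=; rewrite !in_itv/= ltrBlDr lerBrDr.
Qed.

(** Cameron-Martin density of [g + c] with respect to [g], for [g] real standard normal. *)
Definition normal_weight (c x : R) : R := expR (c * x - c ^+ 2 / 2).

Lemma measurable_normal_weight c : measurable_fun setT (normal_weight c).
Proof. by apply: measurableT_comp => //; apply: measurable_funB => //; exact: measurable_funM. Qed.

Lemma normal_pdfD (c x : R) :
  normal_pdf 0 1 (x - c) = normal_weight c x * normal_pdf 0 1 x.
Proof.
rewrite !normal_pdfE ?oner_neq0// mulrCA; congr (_ * _).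
rewrite /normal_fun /normal_weight -expRD; congr expR.
rewrite !subr0 expr1n.
have -> : (x - c)^+2 = x ^+ 2 - x * c *+ 2 + c ^+ 2 by rewrite sqrrB.
by field.
Qed.

Lemma integral_normal (f : R -> \bar R) : measurable_fun setT f ->
  (forall x, 0 <= f x)%E ->
  (\int[N01]_x f x = \int[mu]_x (f x * (normal_pdf 0 1 x)%:E))%E.
Proof.
move=> mf f0; apply: ge0_integral_density => //.
- exact: measurable_normal_pdf.
- by move=> x; exact: normal_pdf_ge0.
Qed.

Lemma normal_shift (c : R) (f : R -> \bar R) : measurable_fun setT f ->
  (forall x, 0 <= f x)%E ->
  (\int[N01]_x f (x + c)%R = \int[N01]_x (f x * (normal_weight c x)%:E))%E.
Proof.
move=> mf f0.
have mw := measurable_normal_weight c.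
have mp := @measurable_normal_pdf R 0 1.
have mD (a : R) : measurable_fun setT (fun x : R => x + a) by exact: measurable_funD.
rewrite integral_normal//; last first.
  exact: measurableT_comp mf (mD c).
rewrite integral_normal//; last 2 first.
- by apply: emeasurable_funM => //; exact/measurable_EFinP.
- by move=> x; rewrite mule_ge0// lee_fin expR_ge0.
pose g (y : R) := (f y * (normal_pdf 0 1 (y - c)%R)%:E)%E.
transitivity (\int[mu]_x g (x + c)%R)%E.
  by apply: eq_integral => x _; rewrite /g /= addrK.
transitivity (\int[mu]_x g x)%E; last first.
  by apply: eq_integral => x _; rewrite /g normal_pdfD EFinM muleA.
apply: (@eq_law_integral _ _ _ _ _ _ _ mu mu (fun x => (x + c)%R) id) => //.
- exact: mD.
- by move=> S mS; exact: lebesgue_measureD.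
- apply: emeasurable_funM => //; apply/measurable_EFinP.
  by apply: (measurableT_comp mp); exact: mD.
- by move=> x; rewrite /g mule_ge0// lee_fin normal_pdf_ge0.
Qed.

End NormalShift.

Section GaussianEntry.
Local Open Scope ereal_scope.
Context d (T : measurableType d) {R : realType} (P : probability T R).

Let gauss_entry_shift_real (X : T -> Kfield R RealK) (c : Kfield R RealK)
    (f : Kfield R RealK -> \bar R) :
  measurable_fun setT X -> has_law P X (@std_normal R RealK) ->
  measurable_fun setT f -> (forall z, 0 <= f z) ->
  \int[P]_w f (X w + c)%R = \int[P]_w (f (X w) * (cm_weight c (X w))%:E).
Proof.
move=> mX lX mf f0.
pose Y (x : R) : Kfield R RealK := x.
have mY : measurable_fun setT Y.
  by apply: measurable_toK; [exact: measurable_id|exact: measurable_cst].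
have XY S : measurable S -> P (X @^-1` S) = normal_prob 0 1 (Y @^-1` S).
  by move=> mS; rewrite lX.
have mfc := measurableT_comp mf (measurable_KDr c).
rewrite (@eq_law_integral _ _ _ _ _ _ _ P (normal_prob (0 : R) 1) _ _ mX mY XY _ mfc); last by move=> z; exact: f0.
have mw := @measurable_cm_weight R RealK c.
have mfw : measurable_fun setT (fun z => f z * (cm_weight c z)%:E).
  by apply: emeasurable_funM => //; exact/measurable_EFinP.
rewrite (@eq_law_integral _ _ _ _ _ _ _ P (normal_prob (0 : R) 1) _ _ mX mY XY _ mfw); last first.
  by move=> z; rewrite mule_ge0// lee_fin expR_ge0.
have mfY : measurable_fun setT (fun x : R => f (Y x)) := measurableT_comp mf mY.
apply: (etrans (@normal_shift R c (fun x : R => f (Y x)) mfY (fun x => f0 (Y x)))).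
apply: eq_integral => x _; congr (_ * _%:E).
rewrite /normal_weight /cm_weight /= !mul1r /Y /Kabs /=; congr expR.
by rewrite -normrX ger0_norm ?sqr_ge0.
Qed.

Let gauss_entry_shift_complex (X : T -> Kfield R ComplexK)
    (c : Kfield R ComplexK) (f : Kfield R ComplexK -> \bar R) :
  measurable_fun setT X -> has_law P X (@std_normal R ComplexK) ->
  measurable_fun setT f -> (forall z, 0 <= f z) ->
  \int[P]_w f (X w + c)%R = \int[P]_w (f (X w) * (cm_weight c (X w))%:E).
Proof.
move=> mX lX mf f0.
pose q : R := Num.sqrt 2.
have q0 : (q != 0)%R by rewrite sqrtr_eq0 -ltNge.
have qq : (q * q = 2)%R by rewrite -expr2 sqr_sqrtr.
pose Y (g : R * R) : Kfield R ComplexK  := ((g.1 +i* g.2)%C / (q%:C)%C)%R.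
have YE g : Y g = ((g.1 / q)%R +i* (g.2 / q)%R)%C.
  rewrite /Y; apply/eqP; rewrite eq_complex /=; apply/andP; split; apply/eqP.
    by field.
  by field.
have mY : measurable_fun setT Y.
  apply: measurable_toK.
    under eq_fun do rewrite YE /=.
    by apply: measurable_funM.
  under eq_fun do rewrite YE /=.
  by apply: measurable_funM.
pose N := normal_prob (0 : R) 1.
have XY S : measurable S -> P (X @^-1` S) = (N \x N) (Y @^-1` S).
  by move=> mS; rewrite lX.
have mfc := measurableT_comp mf (measurable_KDr c).
rewrite (@eq_law_integral _ _ _ _ _ _ _ P (N \x N) _ _ mX mY XY _ mfc); last by move=> z; exact: f0.
have mw := @measurable_cm_weight R ComplexK c.
have mfw : measurable_fun setT (fun z => f z * (cm_weight c z)%:E).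
  by apply: emeasurable_funM => //; exact/measurable_EFinP.
have fw0 z : 0 <= f z * (cm_weight c z)%:E.
  by rewrite mule_ge0// lee_fin expR_ge0.
rewrite (@eq_law_integral _ _ _ _ _ _ _ P (N \x N) _ _ mX mY XY _ mfw); last by [].
(* The complex normal is [(g1 + i g2) / sqrt 2], so adding [c] to it adds [sqrt 2] times the parts
   of [c] to [g1] and [g2]. The two real translation formulas combine by Tonelli. *)
pose a : R := (q * complex.Re c)%R; pose b : R := (q * complex.Im c)%R.
pose F (g : R * R) := f (Y g).
have mF : measurable_fun setT F := measurableT_comp mf mY.
have F0 g : 0 <= F g by exact: f0.
have Yc x y : (Y (x, y) + c)%R = Y ((x + a)%R, (y + b)%R).
  rewrite !YE /a /b; case: c {mfc mw mfw fw0 a b} => c1 c2 /=.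
  by apply/eqP; rewrite eq_complex /=; apply/andP; split; apply/eqP; field.
have wE x y : cm_weight c (Y (x, y)) = (normal_weight a x * normal_weight b y)%R.
  rewrite /cm_weight Kabs_sqrE KreM Kre_conj Kim_conj YE /normal_weight -expRD.
  congr expR; rewrite /a /b /= !exprMn [(q ^+ 2)%R]expr2 qq.
  rewrite -[in LHS]qq; field.
  exact: q0.
have mD (e : R) : measurable_fun setT (fun x : R => x + e)%R by exact: measurable_funD.
have mS1 x : measurable_fun setT (fun y => F (x, y)).
  by apply: measurableT_comp mF _; exact: measurable_fun_pair.
have mab : measurable_fun setT (fun g : R * R => F ((g.1 + a)%R, (g.2 + b)%R)).
  apply: measurableT_comp mF _; apply: measurable_fun_pair.
    exact: measurableT_comp (mD a) measurable_fst.
  exact: measurableT_comp (mD b) measurable_snd.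
transitivity (\int[(N \x N)]_g F ((g.1 + a)%R, (g.2 + b)%R)).
  by apply: eq_integral => -[x y] _; rewrite /= Yc.
rewrite fubini_tonelli1//; rewrite /fubini_F.
transitivity (\int[N]_x \int[N]_y (F ((x + a)%R, y) * (normal_weight b y)%:E)).
  by apply: eq_integral => x _; rewrite /= (normal_shift b (mS1 _)).
have mwb := @measurable_normal_weight R b.
have mwa := @measurable_normal_weight R a.
have mFw : measurable_fun setT (fun g : R * R => F g * (normal_weight b g.2)%:E).
  apply: emeasurable_funM => //; apply/measurable_EFinP.
  exact: measurableT_comp mwb measurable_snd.
have Fw0 g : 0 <= F g * (normal_weight b g.2)%:E.
  by rewrite mule_ge0// lee_fin expR_ge0.
pose G x := \int[N]_y (F (x, y) * (normal_weight b y)%:E).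
have mG : measurable_fun setT G.
  exact: (@measurable_fun_fubini_tonelli_F _ _ _ _ _ N _ mFw Fw0).
have G0 x : 0 <= G x by apply: integral_ge0 => y _; exact: (Fw0 (x, y)).
transitivity (\int[N]_x G (x + a)%R) => //.
rewrite (normal_shift a mG)//.
transitivity (\int[N]_x \int[N]_y (F (x, y) * (normal_weight b y)%:E *
    (normal_weight a x)%:E)).
  apply: eq_integral => x _; rewrite ge0_integralZr//.
  - apply: emeasurable_funM; first exact: mS1.
    by apply/measurable_EFinP.
  - by rewrite lee_fin expR_ge0.
pose H (g : R * R) := f (Y g) * (cm_weight c (Y g))%:E.
have mH : measurable_fun setT H := measurableT_comp mfw mY.
have H0 g : 0 <= H g by exact: fw0.
apply: (@etrans _ _ (\int[N]_x \int[N]_y H (x, y))); last first.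
  exact/esym/(@fubini_tonelli1 _ _ _ _ _ N N H mH H0).
apply: eq_integral => x _; apply: eq_integral => y _.
by rewrite /H wE EFinM muleA muleAC.
Qed.

Lemma gauss_entry_shift k (X : T -> Kfield R k) (c : Kfield R k)
    (f : Kfield R k -> \bar R) :
  measurable_fun setT X -> has_law P X (@std_normal R k) ->
  measurable_fun setT f -> (forall z, 0 <= f z) ->
  \int[P]_w f (X w + c)%R = \int[P]_w (f (X w) * (cm_weight c (X w))%:E).
Proof.
case: k X c f => X c f.
- exact: gauss_entry_shift_real.
- exact: gauss_entry_shift_complex.
Qed.

End GaussianEntry.

Section MeasureDensity.
Context d (T : measurableType d) (R : realType).
Variables (mu : {measure set T -> \bar R}) (w : T -> R).
Hypotheses (mw : measurable_fun setT w) (w0 : forall x, 0 <= w x).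

(** The hypotheses on [w] are arguments, so that the measure structure can be attached to the term
    itself. *)
Definition mdensity of measurable_fun setT w & (forall x, 0 <= w x) :=
  fun A => (\int[mu]_(x in A) (w x)%:E)%E.

Let mdensity0 : mdensity mw w0 set0 = 0%E.
Proof. exact: integral_set0. Qed.

Let mdensity_ge0 A : (0 <= mdensity mw w0 A)%E.
Proof. by apply: integral_ge0 => x _; rewrite lee_fin. Qed.

Let mdensity_semi_sigma_additive : semi_sigma_additive (mdensity mw w0).
Proof.
move=> F mF tF mUF; rewrite /mdensity ge0_integral_bigcup//.
- by apply: is_cvg_ereal_nneg_natsum_cond => n _ _; exact: mdensity_ge0.
- by apply/measurable_funTS/measurable_EFinP.
- by move=> x _; rewrite lee_fin.
Qed.

HB.instance Definition _ := isMeasure.Build _ _ _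
  (mdensity mw w0) mdensity0 mdensity_ge0 mdensity_semi_sigma_additive.

End MeasureDensity.

Section IndependentEvent.
Local Open Scope ereal_scope.
Context d (T : measurableType d) {R : realType} (P : probability T R).

(** Under the restriction of [P] to [A], the law of [X] is [P A] times its original law. *)
Lemma indep_event_integral d' (T' : measurableType d') (X : T -> T')
    (A : set T) (f : T' -> \bar R) :
  measurable_fun setT X -> measurable A ->
  (forall S, measurable S -> P (X @^-1` S `&` A) = P (X @^-1` S) * P A) ->
  measurable_fun setT f -> (forall z, 0 <= f z) ->
  \int[P]_(w in A) f (X w) = P A * \int[P]_w f (X w).
Proof.
move=> mX mA XA mf f0.
have PA0 : (0 <= fine (P A))%R by rewrite fine_ge0.
have PAE : (fine (P A))%:E = P A by rewrite fineK// fin_num_measure.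
pose m1 := [the measure _ _ of mrestr P mA].
pose m2 := [the measure _ _ of mscale (NngNum PA0) P].
have mfX := measurableT_comp mf mX.
transitivity (\int[m1]_w f (X w)).
  rewrite (@ge0_integral_density _ _ _ P m1 \1_A)//.
  - rewrite [LHS]integral_mkcond; apply: eq_integral => w _.
    by rewrite patchE indicE; case: ifP; rewrite ?mule1 ?mule0.
  - move=> B mB; rewrite /m1 /= /mrestr integral_indic//.
    by rewrite setIC.
transitivity (\int[m2]_w f (X w)).
  apply: eq_law_integral => // S mS.
  by rewrite /m1 /m2 /= /mrestr /mscale /= XA// PAE muleC.
by rewrite ge0_integral_mscale//= PAE.
Qed.

End IndependentEvent.

(** * Translations of a Gaussian matrix *)

Section Gaussian.
Context d (T : measurableType d) {R : realType} (P : probability T R).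
Context {k : field_kind} {n l : nat}.
Local Notation K := (Kfield R k).
Local Notation Mx := 'M[K]_(n, l).
Variable Omega : T -> Mx.
Hypothesis mOmega : measurable_fun setT Omega.
Hypothesis law_Omega : forall i j, has_law P (fun w => Omega w i j) (@std_normal R k).
Hypothesis ind_Omega : mutually_independent P
    (fun (ij : 'I_n * 'I_l) w => Omega w ij.1 ij.2).

Lemma measurable_mxDr d' (X : measurableType d') (f : X -> Mx) (D : Mx) :
  measurable_fun setT f -> measurable_fun setT (fun w => f w + D).
Proof.
move=> mf; apply: measurable_matrix => i j.
under eq_fun do rewrite mxE.
apply: (measurableT_comp (measurable_KDr _)).
exact: measurableT_comp (measurable_entry i j) mf.
Qed.

(** Two finite measures are compared on boxes. There the entry [ij] obeys the one-variable formula
    and is independent of the event [A] cut out by the other entries. *)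
Lemma gauss_coord_shift (ij : 'I_n * 'I_l) (c : K) (f : Mx -> \bar R) :
  measurable_fun setT f -> (forall M, 0 <= f M)%E ->
  (\int[P]_w f (Omega w + c *: delta_mx ij.1 ij.2)%R =
   \int[P]_w (f (Omega w) * (cm_weight c (Omega w ij.1 ij.2))%:E))%E.
Proof.
move=> mf f0; pose D : Mx := c *: delta_mx ij.1 ij.2.
have mOD : measurable_fun setT (fun w => Omega w + D) by exact: measurable_mxDr.
pose w (M : Mx) := cm_weight c (M ij.1 ij.2).
have mw : measurable_fun setT w.
  exact: measurableT_comp (measurable_cm_weight c) (measurable_entry _ _).
have w0 M : 0 <= w M by exact: expR_ge0.
have mX ab : measurable_fun setT (fun w => Omega w ab.1 ab.2).
  exact: measurableT_comp (measurable_entry _ _) mOmega.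
have mXS ab S : measurable S -> measurable ((fun w => Omega w ab.1 ab.2) @^-1` S).
  by move=> mS; rewrite -[X in measurable X]setTI; exact: mX.
apply: (density_law_integral mOmega mOD mw w0) => // S mS.
pose m1 := [the measure _ _ of pushforward P (fun w => Omega w + D)].
pose pO := [the measure _ _ of pushforward P Omega].
pose m2 := [the measure _ _ of mdensity (pO mOmega) mw w0].
suff : m1 mOD S = m2 S.
  rewrite /m1 /m2 /= /mdensity ge0_integral_pushforward//.
    by apply/measurable_funTS/measurable_EFinP.
  by move=> M _; rewrite lee_fin.
apply: matrix_measure_unique => //.
  by rewrite /m1 /= /pushforward preimage_setT probability_setT ltry.
move=> {S mS} S mS'.
pose B (J : {set 'I_n * 'I_l}) := \bigcap_(ab in [set` J])
  ((fun w => Omega w ab.1 ab.2) @^-1` S ab).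
have mB J : measurable (B J).
  by apply: fin_bigcap_measurable => // ab _; exact: mXS.
pose A := B [set~ ij]%SET.
pose X w := Omega w ij.1 ij.2.
(* Independence is used twice, for all the entries and for all but [ij]. *)
have split S' : measurable S' -> P (X @^-1` S' `&` A) = (P (X @^-1` S') * P A)%E.
  move=> mS1; pose S2 ab := if ab == ij then S' else S ab.
  have mS2 ab : measurable (S2 ab) by rewrite /S2; case: ifP.
  have -> : X @^-1` S' `&` A = \bigcap_(ab in [set` [set: 'I_n * 'I_l]%SET])
      ((fun w => Omega w ab.1 ab.2) @^-1` S2 ab).
    apply/seteqP; split=> [z [zS zA] ab _|z zS2].
      rewrite /S2 /=; case: (eqVneq ab ij) => [->//|abij].
      by apply: zA; rewrite /= !inE.
    split; first by have := zS2 ij; rewrite /= /S2 eqxx; apply; rewrite inE.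
    move=> ab; rewrite /= !inE => abij; have := zS2 ab.
    by rewrite /= /S2 (negbTE abij); apply; rewrite inE.
  rewrite ind_Omega// (bigD1 ij) ?inE//= /S2 eqxx; congr (_ * _)%E.
  rewrite /A /B ind_Omega//; apply: eq_big => [ab|ab]; first by rewrite !inE.
  by move=> /andP[_ /negbTE ->].
have ijE ab : (ab.1 == ij.1) && (ab.2 == ij.2) = (ab == ij).
  by rewrite -xpair_eqE -!surjective_pairing.
have ODE z ab : (Omega z + D) ab.1 ab.2 =
    if ab == ij then X z + c else Omega z ab.1 ab.2.
  rewrite !mxE ijE; case: eqP => [->|_]; first by rewrite mulr1.
  by rewrite mulr0 addr0.
have mSc : measurable ((fun z : K => z + c) @^-1` S ij).
  by rewrite -[X in measurable X]setTI; exact: measurable_KDr.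
transitivity (P (X @^-1` ((fun z => z + c) @^-1` S ij) `&` A)).
  rewrite /m1 /= /pushforward; congr (P _); apply/seteqP; split=> z.
    move=> zS; split; first by have := zS ij; rewrite ODE eqxx.
    move=> ab; rewrite /= !inE => abij; have := zS ab.
    by rewrite ODE (negbTE abij).
  move=> [zS zA] ab; rewrite ODE; case: eqP => [->//|/eqP abij].
  by apply: zA; rewrite /= !inE.
rewrite split// muleC.
have mind : measurable_fun setT (EFin \o \1_(S ij) : K -> \bar R).
  exact/measurable_EFinP/measurable_indic.
have mcw : measurable_fun setT (fun z : K => (cm_weight c z)%:E).
  exact/measurable_EFinP/measurable_cm_weight.
pose g (z : K) := ((\1_(S ij) z)%:E * (cm_weight c z)%:E)%E.
have mg : measurable_fun setT g by exact: emeasurable_funM.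
have g0 z : (0 <= g z)%E by rewrite mule_ge0// lee_fin// expR_ge0.
have -> : P (X @^-1` ((fun z => z + c) @^-1` S ij)) = (\int[P]_z g (X z))%E.
  rewrite -(@gauss_entry_shift _ _ _ P _ X c _ (mX ij) (law_Omega _ _) mind).
    have mXc : measurable (X @^-1` ((fun z => z + c) @^-1` S ij)).
      by rewrite -[Y in measurable Y]setTI; exact: (mX ij).
    rewrite -[Y in P Y = _]setIT -integral_indic//.
  by move=> z; rewrite lee_fin.
rewrite -(indep_event_integral (mX ij) (mB _) split mg g0).
rewrite /m2 /= /mdensity ge0_integral_pushforward//; last 3 first.
- exact: measurable_box.
- by apply/measurable_funTS/measurable_EFinP.
- by move=> M _; rewrite lee_fin.
have -> : Omega @^-1` box S = A `&` X @^-1` S ij.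
  apply/seteqP; split=> z.
    by move=> zS; split; [move=> ab _; exact: zS|exact: zS].
  move=> [zA zS] ab; have [->//|abij] := eqVneq ab ij.
  by apply: zA; rewrite /= !inE.
rewrite integral_mkcondr; apply: eq_integral => z _.
have zS : (z \in X @^-1` S ij) = (X z \in S ij) by apply/idP/idP; rewrite !inE.
rewrite patchE /g indicE zS.
by case: ifP => _; rewrite ?mul1e ?mul0e.
Qed.

Definition mx_weight (D X : Mx) : R :=
  expR ((kdim k)%:R * rdot D X - (kdim k)%:R * rdot D D / 2).

Lemma measurable_mx_weight D : measurable_fun setT (mx_weight D).
Proof.
apply: measurableT_comp => //; apply: measurable_funB => //.
by apply: measurable_funM => //; exact: measurable_rdot.
Qed.

Lemma gauss_shift_ge0 (D : Mx) (f : Mx -> \bar R) :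
  measurable_fun setT f -> (forall M, 0 <= f M)%E ->
  (\int[P]_w f (Omega w + D)%R =
   \int[P]_w (f (Omega w) * (mx_weight D (Omega w))%:E))%E.
Proof.
move=> mf f0.
pose Ds s : Mx := \sum_(p <- s) D p.1 p.2 *: delta_mx p.1 p.2.
pose ws s (X : Mx) := \prod_(p <- s) cm_weight (D p.1 p.2) (X p.1 p.2).
have ws0 s X : 0 <= ws s X.
  by apply: prodr_ge0 => p _; exact: expR_ge0.
have mws s : measurable_fun setT (ws s).
  rewrite /ws; apply: measurable_prod => p _.
  exact: measurableT_comp (measurable_cm_weight _) (measurable_entry _ _).
(* The entries are shifted one at a time. As the list has no duplicates, shifting one entry leaves
   the weights of the others unchanged ([wsE]). *)
suff H s : uniq s -> forall g : Mx -> \bar R,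
    measurable_fun setT g -> (forall M, 0 <= g M)%E ->
    (\int[P]_w g (Omega w + Ds s)%R =
     \int[P]_w (g (Omega w) * (ws s (Omega w))%:E))%E.
  have := H (index_enum _) (index_enum_uniq _) f mf f0.
  have -> : Ds (index_enum _) = D.
    by rewrite [RHS]matrix_sum_delta pair_bigA.
  move=> ->; apply: eq_integral => w _; congr (_ * _%:E)%E.
  rewrite /ws /mx_weight /rdot /cm_weight !pair_bigA /=.
  rewrite -expR_sum; congr expR.
  rewrite -mulrA mulr_suml !mulr_sumr -sumrB; apply: eq_bigr => p _.
  by rewrite -Kabs_sqr mulrA.
elim: s => [_ g mg g0|p s IHs /= /andP[ps us] g mg g0].
  by rewrite /Ds /ws !big_nil; apply: eq_integral => w _; rewrite big_nil addr0 mule1.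
pose c := D p.1 p.2; pose E : Mx := c *: delta_mx p.1 p.2.
pose g1 X := g (X + E).
have mE : measurable_fun setT (fun X : Mx => X + E).
  by apply: measurable_mxDr; exact: measurable_id.
have mg1 : measurable_fun setT g1 := measurableT_comp mg mE.
transitivity (\int[P]_w g1 (Omega w + Ds s)%R)%E.
  apply: eq_integral => w _; rewrite /g1 /Ds big_cons -/E.
  by rewrite -addrA [in RHS](addrC _ E).
rewrite IHs//; last by move=> M; exact: g0.
have wsE X : ws s (X + E) = ws s X.
  rewrite /ws; apply: eq_big_seq => q qs; rewrite !mxE.
  have qp : q != p by apply: contraNneq ps => <-.
  suff -> : (q.1 == p.1) && (q.2 == p.2) = false by rewrite mulr0 addr0.
  by rewrite -xpair_eqE -!surjective_pairing (negbTE qp).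
pose h X := (g X * (ws s X)%:E)%E.
have mh : measurable_fun setT h.
  by apply: emeasurable_funM => //; exact/measurable_EFinP.
transitivity (\int[P]_w h (Omega w + E)%R)%E.
  by apply: eq_integral => w _; rewrite /h wsE.
rewrite (gauss_coord_shift)//; last first.
  by move=> M; rewrite mule_ge0// lee_fin.
apply: eq_integral => w _.
by rewrite /h -muleA -EFinM /ws big_cons mulrC.
Qed.

Lemma gauss_shift (D : Mx) (f : Mx -> R) : measurable_fun setT f ->
  (\int[P]_w (f (Omega w + D)%R)%:E =
   \int[P]_w (f (Omega w) * (mx_weight D (Omega w)))%:E)%E.
Proof.
move=> mf.
have mF : measurable_fun setT (EFin \o f) by exact/measurable_EFinP.
rewrite integralE [RHS]integralE; congr (_ - _)%E.
  transitivity (\int[P]_w (EFin \o f)^\+ (Omega w + D)%R)%E.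
  by apply: eq_integral => w _; rewrite !funeposE.
  rewrite gauss_shift_ge0//; last exact: measurable_funepos.
  apply: eq_integral => w _; rewrite !funeposE /= EFinM.
  by rewrite maxe_pMl ?mul0e// lee_fin expR_ge0.
transitivity (\int[P]_w (EFin \o f)^\- (Omega w + D)%R)%E.
  by apply: eq_integral => w _; rewrite !funenegE.
rewrite gauss_shift_ge0//; last exact: measurable_funeneg.
apply: eq_integral => w _; rewrite !funenegE /= -mulNr EFinM.
by rewrite maxe_pMl ?mul0e// lee_fin expR_ge0.
Qed.

Let mcomp (f : Mx -> R) : measurable_fun setT f ->
  measurable_fun setT (fun w => f (Omega w)).
Proof. by move=> mf; exact: measurableT_comp mf mOmega. Qed.

(** The translation formula for the constant 1 shows that the density has total mass 1. *)
Lemma Pint_mx_weight D : Pint P (fun w => mx_weight D (Omega w)).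
Proof.
apply/integrableP; split.
  exact/measurable_EFinP/(mcomp (measurable_mx_weight D)).
have h : (\int[P]_w (cst 1 w) = \int[P]_w (mx_weight D (Omega w))%:E)%E.
  have := gauss_shift_ge0 D
    (@measurable_cst _ _ Mx _ setT 1%E) (fun=> lee01).
  move=> H1; apply: (etrans _ (etrans H1 _)); apply: eq_integral => w _ //.
  by rewrite mul1e.
rewrite integral_cst// in h.
have -> : (\int[P]_w `|(mx_weight D (Omega w))%:E| =
    \int[P]_w (mx_weight D (Omega w))%:E)%E.
  by apply: eq_integral => w _; rewrite gee0_abs// lee_fin expR_ge0.
rewrite -h mul1e.
exact: (le_lt_trans (@probability_le1 _ _ _ P _ measurableT) (ltry _)).
Qed.

Lemma Pint_exp_rdot D : Pint P (fun w => expR ((kdim k)%:R * rdot D (Omega w))).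
Proof.
have := PintZ (expR ((kdim k)%:R * rdot D D / 2)) (Pint_mx_weight D).
apply: eq_integrable => // w _; rewrite /= /mx_weight -expRD; congr (expR _)%:E. by ring.
Qed.

(** * Gaussian integration by parts *)

Section SteinIdentity.
(** The envelope [g] is a square-integrable function and not a constant, because the field of the
    second integration by parts grows linearly. *)
Variables (D : Mx) (f f' g : Mx -> R).
Hypotheses (mf : measurable_fun setT f) (mf' : measurable_fun setT f').
Hypothesis g2 : Pint P (fun w => g (Omega w) ^+ 2).
Hypothesis fg : forall X, `|f X| <= g X.
Hypothesis f'g : forall X, `|f' X| <= g X.
Hypothesis df : forall X s, 0 < s -> s <= 1 ->
  `|f (X + toK s *: D) - f X - s * f' X| <= s ^+ 2 * g X.

(* First order in [s] of the translation formula for [toK s *: D]. *)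
Lemma stein :
  [/\ Pint P (fun w => f' (Omega w)), Pint P (fun w => rdot D (Omega w) * f (Omega w)) &
      (kdim k)%:R * \int[P]_w (rdot D (Omega w) * f (Omega w)) =
      \int[P]_w f' (Omega w)].
Proof.
pose x w := (kdim k)%:R * rdot D (Omega w).
pose q : R := (kdim k)%:R * rdot D D / 2.
have mx : measurable_fun setT x.
  by apply: measurable_funM => //; exact: mcomp (measurable_rdot D).
have q0 : 0 <= q.
  rewrite !mulr_ge0//; apply: sumr_ge0 => i _; apply: sumr_ge0 => j _.
  by rewrite -Kabs_sqr sqr_ge0.
have g0 X : 0 <= g X by rewrite (le_trans _ (fg X)).
have i4 a : Pint P (fun w => expR (a * x w)).
  have := Pint_exp_rdot (toK a *: D).
  by apply: eq_integrable => // w _; rewrite /= rdotZl mulrCA.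
(* Majorizes [g], [g |x|] and [g exp (2 |x|)] at once, by [2 a b <= a^2 + b^2] and
   [exp (4 |x|) <= exp (4 x) + exp (- 4 x)]. *)
pose H w := g (Omega w) ^+ 2 + 4 * (expR (4 * x w) + expR (- 4 * x w)) + 1.
have iH : Pint P H.
  by apply: PintD (Pint_cst _ _); apply: PintD => //; apply: PintZ; exact: PintD.
have e4 w : expR (4 * `|x w|) <= expR (4 * x w) + expR (- 4 * x w).
  by have := expR_abs_le (4 * x w); rewrite normrM ger0_norm// mulNr.
have e0 w : 0 <= expR (4 * x w) + expR (- 4 * x w).
  by rewrite addr_ge0// expR_ge0.
have gH w : g (Omega w) <= H w.
  have := e0 w; have := g0 (Omega w); rewrite /H expr2; nra.
have gxH w : g (Omega w) * `|x w| <= H w.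
  have h : `|x w| ^+ 2 <= 4 * expR (4 * `|x w|).
    rewrite (le_trans (sqr_le_expR _))// ler_pM2l// ler_expR.
    by rewrite ler_peMl// ler1n.
  have := e4 w; have := g0 (Omega w); have := normr_ge0 (x w).
  move: h; rewrite /H !expr2; nra.
have geH w : g (Omega w) * expR (2 * `|x w|) <= H w.
  have h : expR (4 * `|x w|) = expR (2 * `|x w|) ^+ 2.
    by rewrite -expRM_natl; congr expR; ring.
  have := e4 w; have := e0 w; have := g0 (Omega w); rewrite h /H !expr2.
  have := expR_gt0 (2 * `|x w|); nra.
have if' : Pint P (fun w => f' (Omega w)).
  apply: (Pint_le _ iH) => [|w]; first exact: mcomp.
  exact: le_trans (gH w).
have if0 : Pint P (fun w => f (Omega w)).
  apply: (Pint_le _ iH) => [|w]; first exact: mcomp.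
  exact: le_trans (gH w).
have ixf : Pint P (fun w => x w * f (Omega w)).
  apply: (Pint_le _ iH) => [|w]; first by apply: measurable_funM => //; exact: mcomp.
  rewrite normrM mulrC (le_trans _ (gxH w))// ler_wpM2r//.
have irf : Pint P (fun w => rdot D (Omega w) * f (Omega w)).
  have := PintZ (kdim k)%:R^-1 ixf; apply: eq_integrable => // w _ /=.
  by rewrite /x -mulrA mulKf// pnatr_eq0; case: (k).
split => //.
rewrite -RintegralZl//.
under eq_Rintegral do rewrite mulrA -/(x _).
apply/eqP; rewrite -subr_eq0 -opprB oppr_eq0; apply/eqP.
pose C : R := 4 * expR (2 * q) + q.
have C0 : 0 <= C by rewrite addr_ge0// mulr_ge0// expR_ge0.
apply: (@le_sqr_eq0 _ _ (\int[P]_w (H w + C * H w))) => s s0 s1.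
pose W w := expR (s * x w - s ^+ 2 * q).
have WE w : mx_weight (toK s *: D) (Omega w) = W w.
  rewrite /mx_weight /W; congr expR; rewrite !rdotZl rdotZr /x /q; ring.
have mDs : measurable_fun setT (fun w => f (Omega w + toK s *: D)).
  by apply: (measurableT_comp mf); exact: measurable_mxDr.
have iDs : Pint P (fun w => f (Omega w + toK s *: D)).
  apply: (Pint_le _ (PintZ 3 iH)) => // w.
  have -> : f (Omega w + toK s *: D) = (f (Omega w + toK s *: D) - f (Omega w) -
    s * f' (Omega w)) + (f (Omega w) + s * f' (Omega w)) by ring.
  have h1 : s ^+ 2 * g (Omega w) <= g (Omega w).
    by rewrite ler_piMl// expr_le1// ltW.
  have h2 : `|s * f' (Omega w)| <= g (Omega w).
    rewrite normrM gtr0_norm// (le_trans _ (f'g _))// ler_piMl//.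
  rewrite (le_trans (ler_normD _ _))//.
  have := df (Omega w) s0 s1; have := ler_normD (f (Omega w)) (s * f' (Omega w)).
  have := fg (Omega w); have := gH w; lra.
pose r w := W w - 1 - s * x w.
have rb w : `|f (Omega w) * r w| <= s ^+ 2 * (C * H w).
  rewrite normrM; have := shift_weight_bound (x w) q0 s0 s1.
  rewrite -/C -/(W w) -/(r w) => h.
  apply: (@le_trans _ _ (g (Omega w) * (s ^+ 2 * (C * expR (2 * `|x w|))))).
    by rewrite ler_pM.
  rewrite mulrCA ler_wpM2l ?sqr_ge0// mulrCA ler_wpM2l//.
have mr : measurable_fun setT r.
  apply: measurable_funB; last exact: measurable_funM.
  apply: measurable_funB => //; apply: measurableT_comp => //.
  by apply: measurable_funB => //; apply: measurable_funM.
have ifr : Pint P (fun w => f (Omega w) * r w).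
  apply: (Pint_le _ (PintZ (s ^+ 2) (PintZ C iH))) => // w.
  by apply: measurable_funM => //; exact: mcomp.
have EW : \int[P]_w f (Omega w + toK s *: D) =
    \int[P]_w (f (Omega w) + s * (x w * f (Omega w)) + f (Omega w) * r w).
  rewrite /Rintegral (gauss_shift _ mf).
  congr fine; apply: eq_integral => w _; rewrite WE /r; congr (_%:E); ring.
have isx := PintZ s ixf; have isf' := PintZ s if'.
rewrite RintegralD// in EW; last exact: PintD.
rewrite RintegralD// RintegralZl// in EW.
pose e w := f (Omega w + toK s *: D) - f (Omega w) - s * f' (Omega w).
have ie : Pint P e by apply: PintB => //; exact: PintB.
have Ee : \int[P]_w e w = \int[P]_w f (Omega w + toK s *: D) -
   \int[P]_w f (Omega w) - s * \int[P]_w f' (Omega w).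
  rewrite RintegralB//; last exact: PintB.
  by rewrite RintegralB// RintegralZl.
(* Equating the two expansions of the translated mean leaves two remainders, both of order [s^2]. *)
have -> : s * (\int[P]_w f' (Omega w) - \int[P]_w (x w * f (Omega w))) =
    \int[P]_w (f (Omega w) * r w) - \int[P]_w e w.
  by rewrite Ee EW; ring.
rewrite -RintegralB// -RintegralZl//; last by apply: PintD => //; exact: PintZ.
apply: Pexp_norm_le => //.
- exact: PintB.
- by apply: PintZ; apply: PintD => //; exact: PintZ.
- move=> w; rewrite (le_trans (ler_normB _ _))// [leRHS]mulrDr [leRHS]addrC lerD//.
  by rewrite (le_trans (df _ s0 s1))// ler_wpM2l ?sqr_ge0.
Qed.

End SteinIdentity.

Lemma Pint_rdot2 (D : Mx) : Pint P (fun w => rdot D (Omega w) ^+ 2).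
Proof.
pose x w := (kdim k)%:R * rdot D (Omega w).
have i1 := Pint_exp_rdot D.
have i2 := Pint_exp_rdot (toK (-1) *: D).
apply: (Pint_le _ (PintZ 4 (PintD i1 i2))).
  apply: measurable_funX; exact: measurableT_comp (measurable_rdot D) mOmega.
move=> w; rewrite ger0_norm ?sqr_ge0// rdotZl mulN1r mulrN.
have h := sqr_le_expR (normr_ge0 (x w)).
have h2 := expR_abs_le (x w).
have h3 : rdot D (Omega w) ^+ 2 <= `|x w| ^+ 2.
  rewrite real_normK ?num_real// /x exprMn ler_peMl ?sqr_ge0//.
  by rewrite expr_ge1// ler1n; case: (k).
by rewrite (le_trans h3)// (le_trans h)// ler_pM2l.
Qed.

(** The squared Frobenius norm is a sum of squares of real coordinates, each of the form
    [rdot D Omega]. *)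
Lemma Pint_nm2 : Pint P (fun w => nm (Omega w) ^+ 2).
Proof.
have i0 : Pint P (fun w => \sum_i \sum_j \sum_(u <- @dirs R k)
    rdot (u *: (1%:M *m delta_mx i j)) (Omega w) ^+ 2).
  by do 3!apply: Pint_sum => ?; exact: Pint_rdot2.
apply: (Pint_le _ (PintZ ((n * l) ^ 2)%:R i0)).
  apply: measurable_funX; apply: measurable_nm.
  exact: mxmeas_of_measurable.
move=> w; rewrite ger0_norm ?sqr_ge0// (le_trans (nm_sqr_le _))//.
rewrite ler_wpM2l// le_eqVlt; apply/orP; left; apply/eqP.
rewrite /rdot; apply: eq_bigr => i _; apply: eq_bigr => j _.
rewrite -sum_dirs_mul.
under [RHS]eq_bigr => u _.
  rewrite -/(rdot (u *: (1%:M *m delta_mx i j)) (Omega w)) rdot_dir mulmx1 expr2.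
  rewrite [adjmx _ _ _]mxE [_^T _ _]mxE; over.
rewrite sum_dirs_mul sum_dirs_mul KconjK mulrC.
by [].
Qed.

Section GaussianIdentity.
Variables (r : nat) (Q : 'M[K]_(n, r)).
Hypothesis QQ : adjmx Q *m Q = 1%:M.

Let M (X : Mx) : 'M[K]_(l, r) := adjmx X *m Q.

Let mM : mxmeas M. Proof. exact: mxmeas_sketch mxmeas_id. Qed.

Lemma stein_entry t (u : K) (j : 'I_l) (a : 'I_r) : 0 < t ->
  [/\ Pint P (fun w => Kre (u * M (Omega w) j a) *
                Kre (u * (M (Omega w) *m res (M (Omega w)) t) j a)),
      Pint P (fun w => Kre (u * dMres (M (Omega w)) t (Kconj u *: delta_mx j a) j a)) &
      (kdim k)%:R * \int[P]_w (Kre (u * M (Omega w) j a) *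
                Kre (u * (M (Omega w) *m res (M (Omega w)) t) j a)) =
      \int[P]_w Kre (u * dMres (M (Omega w)) t (Kconj u *: delta_mx j a) j a)].
Proof.
(* As [Q^* Q = 1], moving the embedding along [D] moves its sketch [M] along [Dl]. *)
move=> t0; pose D : Mx := u *: (Q *m delta_mx a j).
pose Dl : 'M[K]_(l, r) := Kconj u *: delta_mx j a.
have c0 : 0 <= Kabs u := Kabs_ge0 u.
have [C C0 HC] := @Mres_expand R k l r t (Kabs u) t0 c0.
have nDl : nm Dl <= Kabs u by rewrite nmZ Kabs_conj nm_delta mulr1.
have n0 : nm (0 : 'M[K]_(l, r)) <= Kabs u.
  by rewrite /nm big1// => i _; rewrite big1// => b _; rewrite mxE Kabs0.
pose f X := Kre (u * (M X *m res (M X) t) j a).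
pose f' X := Kre (u * dMres (M X) t Dl j a).
have KB (A : 'M[K]_(l, r)) c : nm A <= c -> `|Kre (u * A j a)| <= Kabs u * c.
  move=> Ac; rewrite (le_trans (Kre_abs_le _))// KabsM ler_wpM2l//.
  by rewrite (le_trans _ Ac)// Kabs_le_nm.
have [||||||] := @stein D f f'
    (fun=> Kabs u * C).
- by have [] := KmeasM (Kmeas_cst u) (mxmeasM mM (mxmeas_res t0 mM) j a).
- by have [] := KmeasM (Kmeas_cst u) (mxmeas_dMres t0 mM (mxmeas_cst Dl) j a).
- exact: Pint_cst.
- move=> X; apply: KB; have [] := HC (M X) Dl 0 1 ltr01 (lexx _) nDl n0.
  by [].
- move=> X; apply: KB; have [] := HC (M X) Dl 0 1 ltr01 (lexx _) nDl n0.
  by [].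
- move=> X s s0 s1; have [_ _] := HC (M X) Dl 0 s s0 s1 nDl n0.
  have -> : M X + toK s *: Dl + toK (s ^+ 2) *: 0 = M (X + toK s *: D).
    rewrite scaler0 addr0 /M adjmxD mulmxDl; congr (_ + _).
    rewrite adjmxZ Kconj_toK -scalemxAl; congr (_ *: _).
    by rewrite /Dl /D adjmxZ adjmxM adjmx_delta -scalemxAl -mulmxA QQ mulmx1.
  move=> h; rewrite mulrCA; have := KB _ _ h.
  congr (_ <= _); congr `|_|; rewrite /f /f' -Kre_toKM -!KreB; congr Kre.
  by rewrite !mxE; ring.
move=> i1 i2 e.
have rE w : rdot D (Omega w) = Kre (u * M (Omega w) j a) by exact: rdot_dir.
split => //.
- by apply: eq_integrable i2 => // w _; rewrite /= rE.
- by rewrite -e; congr (_ * _); apply: eq_Rintegral => w _; rewrite rE.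
Qed.

(* The terms of the integrated divergence of [M *m res M t] that vanish with [t]. *)
Definition gauss_err t X : R :=
  (alpha k)%:R * (t * tau2 (M X) t) + (kdim k)%:R * (t * tau (M X) t ^+ 2)
  + (kdim k)%:R * (t * tau (M X) t).

(** Summed over coordinates, the integration by parts equates [kdim k] times the mean of
    [<M, M S> = r - t tau] with the mean divergence. Replacing [rho] by [tau - t tau2] collects the
    leading terms in [tau]. *)
Lemma gauss_identity t : 0 < t ->
  \int[P]_w (((kdim k)%:R * (l%:R - r%:R) - (alpha k)%:R) * tau (M (Omega w)) t
     + gauss_err t (Omega w)) = (kdim k)%:R * r%:R.
Proof.
move=> t0; have St u j a := stein_entry u j a t0.
pose A u j a w := Kre (u * M (Omega w) j a) *
                Kre (u * (M (Omega w) *m res (M (Omega w)) t) j a).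
pose B u j a w := Kre (u * dMres (M (Omega w)) t (Kconj u *: delta_mx j a) j a).
pose SA w := \sum_(u <- @dirs R k) \sum_j \sum_a A u j a w.
pose SB w := \sum_(u <- @dirs R k) \sum_j \sum_a B u j a w.
have [iSA iSB e] : [/\ Pint P SA, Pint P SB &
    (kdim k)%:R * \int[P]_w SA w = \int[P]_w SB w].
  by rewrite /SA /SB; do 3!apply: Pexp_scaled_sum => ?; exact: St.
have SAE w : SA w = r%:R - t * tau (M (Omega w)) t.
  rewrite /SA /A exchange_big /=.
  under eq_bigr do rewrite exchange_big /=.
  under eq_bigr do under eq_bigr do rewrite sum_dirs_mul.
  rewrite -/(rdot (M (Omega w)) (M (Omega w) *m res (M (Omega w)) t)).
  by rewrite rdot_trace mxtrace_mulC trace_MresM.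
have SBE w : SB w = (kdim k)%:R * l%:R * tau (M (Omega w)) t
    - (alpha k)%:R * rho (M (Omega w)) t
    - (kdim k)%:R * (r%:R - t * tau (M (Omega w)) t) * tau (M (Omega w)) t.
  exact: div_Mres.
have -> : \int[P]_w (((kdim k)%:R * (l%:R - r%:R) - (alpha k)%:R) * tau (M (Omega w)) t
     + gauss_err t (Omega w)) =
  \int[P]_w (SB w - (kdim k)%:R * SA w + (kdim k)%:R * r%:R).
  apply: eq_Rintegral => w _; rewrite SAE SBE /gauss_err.
  have := tau_split (M (Omega w)) t0; set ta := tau _ _; set rh := rho _ _.
  set ta2 := tau2 _ _; move=> h.
  have -> : rh = ta - t * ta2 by rewrite h addrK.
  ring.
have iz := PintZ (kdim k)%:R iSA.
rewrite RintegralD//; last 2 first.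
- exact: PintB.
- exact: Pint_cst.
by rewrite RintegralB// RintegralZl// e subrr add0r Pexp_cst.
Qed.

End GaussianIdentity.

Section GaussianMoments.
Variables (r p : nat) (Q : 'M[K]_(n, r)) (E : 'M[K]_(n, p)).
Hypotheses (QQ : adjmx Q *m Q = 1%:M) (QE : adjmx Q *m E = 0).

Let M (X : Mx) : 'M[K]_(l, r) := adjmx X *m Q.
Let N (X : Mx) : 'M[K]_(l, p) := adjmx X *m E.
Let mM : mxmeas M. Proof. exact: mxmeas_sketch mxmeas_id. Qed.
Let mN : mxmeas N. Proof. exact: mxmeas_sketch mxmeas_id. Qed.

Let D (u : K) (j : 'I_l) (q : 'I_p) : Mx := u *: (E *m delta_mx q j).

Let adjD u j q s : adjmx (toK s *: D u j q) =
  toK s *: (Kconj u *: (delta_mx j q *m adjmx E)).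
Proof. by rewrite adjmxZ Kconj_toK /D adjmxZ adjmxM adjmx_delta. Qed.

(** The directions [D] are built from [E], which is orthogonal to [Q]: an infinitesimal form of the
    independence of [M] and [N]. *)
Let M_shift u j q s X : M (X + toK s *: D u j q) = M X.
Proof.
have EQ : adjmx E *m Q = 0 by rewrite -[Q]adjmxK -adjmxM QE adjmx0.
rewrite /M adjmxD mulmxDl adjD -!scalemxAl -mulmxA EQ mulmx0 !scaler0.
by rewrite addr0.
Qed.

Let N_shift u j q s X : N (X + toK s *: D u j q) =
  N X + toK s *: (Kconj u *: (delta_mx j q *m (adjmx E *m E))).
Proof. by rewrite /N adjmxD mulmxDl adjD -!scalemxAl -mulmxA. Qed.

(** Since [<N, G N> = |S M^* N|_F^2], integrating the field [G N] by parts along [D] computes the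
    regularized second moment. *)
Let G t X : 'M[K]_l := M X *m res (M X) t *m adjmx (M X *m res (M X) t).

Let mG t : 0 < t -> mxmeas (G t).
Proof.
move=> t0; have mS := mxmeasM mM (mxmeas_res t0 mM).
by apply: mxmeasM => //; exact: mxmeas_adj.
Qed.

Let nm_G t X : 0 < t -> nm (G t X) <= ((l * r)%:R * (1 + t^-1)) ^+ 2.
Proof.
move=> t0; rewrite (le_trans (nmM _ _))// nm_adj expr2.
by rewrite ler_pM ?nm_ge0 ?nm_Mres.
Qed.

Lemma stein_second t (u : K) (j : 'I_l) (q : 'I_p) : 0 < t ->
  [/\ Pint P (fun w => Kre (u * N (Omega w) j q) *
                Kre (u * (G t (Omega w) *m N (Omega w)) j q)),
      Pint P (fun w => Kre (u * (Kconj u * (G t (Omega w) j j * (adjmx E *m E) q q)))) &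
      (kdim k)%:R * \int[P]_w (Kre (u * N (Omega w) j q) *
                Kre (u * (G t (Omega w) *m N (Omega w)) j q)) =
      \int[P]_w Kre (u * (Kconj u * (G t (Omega w) j j * (adjmx E *m E) q q)))].
Proof.
move=> t0; pose b := ((l * r)%:R * (1 + t^-1)) ^+ 2 : R.
have b0 : 0 <= b by exact: sqr_ge0.
pose c := Kabs u * (b * nm E) + Kabs u * (Kabs u * (b * nm (adjmx E *m E))).
have h1 : 0 <= Kabs u * (b * nm E).
  by do ?[by [] | exact: Kabs_ge0 | exact: nm_ge0 | apply: mulr_ge0].
have h2 : 0 <= Kabs u * (Kabs u * (b * nm (adjmx E *m E))).
  by do ?[by [] | exact: Kabs_ge0 | exact: nm_ge0 | apply: mulr_ge0].
have c0 : 0 <= c by rewrite addr_ge0.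
have [||||||] := @stein (D u j q)
   (fun X => Kre (u * (G t X *m N X) j q))
   (fun X => Kre (u * (Kconj u * (G t X j j * (adjmx E *m E) q q))))
   (fun X => c * (1 + nm X)).
- by have [] := KmeasM (Kmeas_cst u) (mxmeasM (mG t0) mN j q).
- have mGE := KmeasM (mG t0 j j) (Kmeas_cst ((adjmx E *m E) q q)).
  by have [] := KmeasM (Kmeas_cst u) (KmeasM (Kmeas_cst (Kconj u)) mGE).
- have i2 := Pint_nm2.
  apply: (Pint_le _ (PintZ (c ^+ 2) (PintD (Pint_cst P 2) (PintZ 2 i2)))).
    apply: measurable_funX; apply: measurable_funM => //.
    apply: measurable_funD => //; apply: measurable_nm.
    exact: mxmeas_of_measurable.
  move=> w; rewrite ger0_norm ?sqr_ge0// exprMn ler_wpM2l ?sqr_ge0//.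
  have := sqr_ge0 (1 - nm (Omega w)); rewrite !expr2; nra.
- move=> X; rewrite (le_trans (Kre_abs_le _))// KabsM.
  apply: (@le_trans _ _ (Kabs u * (b * (nm X * nm E)))).
    rewrite ler_wpM2l ?Kabs_ge0// (le_trans (Kabs_le_nm _ _ _))//.
    rewrite nmM_le ?nm_G// nmM_le ?nm_adj//.
  have := nm_ge0 X; rewrite /c; nra.
- move=> X; rewrite (le_trans (Kre_abs_le _))// !KabsM Kabs_conj.
  apply: (@le_trans _ _ (Kabs u * (Kabs u * (b * nm (adjmx E *m E))))).
    do 2!(rewrite ler_wpM2l ?Kabs_ge0//).
    rewrite ler_pM ?Kabs_ge0 ?Kabs_le_nm// (le_trans (Kabs_le_nm _ _ _))//.
    exact: nm_G.
  have := nm_ge0 X; rewrite /c; nra.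
- move=> X s s0 s1; rewrite /G M_shift N_shift -/(G t X).
  have -> : (G t X *m (N X + toK s *: (Kconj u *: (delta_mx j q *m (adjmx E *m E))))) j q
     = (G t X *m N X) j q + toK s * (Kconj u * (G t X j j * (adjmx E *m E) q q)).
    have scaleE v (A : 'M[K]_(l, p)) : (v *: A) j q = v * A j q by rewrite mxE.
    rewrite mulmxDr -!scalemxAr (mulmxA _ (delta_mx j q)) [LHS]mxE; congr (_ + _).
    by rewrite !scaleE mul_delta_entry.
  rewrite mulrDr KreD [u * (toK s * _)]mulrCA Kre_toKM.
  (* [M], hence [G], is fixed by the translation and [N] is affine in [s], so the remainder is
     exactly 0. *)
  rewrite [X in `|X|](_ : _ = 0); last by ring.
  rewrite normr0; apply: mulr_ge0; first exact: sqr_ge0.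
  by apply: mulr_ge0 => //; apply: addr_ge0 => //; exact: nm_ge0.
move=> i1 i2 e.
have rE w : rdot (D u j q) (Omega w) = Kre (u * N (Omega w) j q) by exact: rdot_dir.
split => //.
- by apply: eq_integrable i2 => // w _; rewrite /= rE.
- by rewrite -e; congr (_ * _); apply: eq_Rintegral => w _; rewrite rE.
Qed.

Let kdim_neq0 : (kdim k)%:R != 0 :> R.
Proof. by rewrite pnatr_eq0; case: (k). Qed.

Let Zt t w := res (M (Omega w)) t *m adjmx (M (Omega w)) *m N (Omega w).

(** The divergence of [G N] is [kdim k] times the product of the traces of [G] and [E^* E], which
    are [rho] and [|E|_F^2]. *)
Lemma gauss_second_moment t : 0 < t ->
  Pint P (fun w => rdot (Zt t w) (Zt t w)) /\
  \int[P]_w rdot (Zt t w) (Zt t w) = \int[P]_w (rdot E E * rho (M (Omega w)) t).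
Proof.
move=> t0; have St u j q := stein_second u j q t0.
pose A u j q w := Kre (u * N (Omega w) j q) *
                Kre (u * (G t (Omega w) *m N (Omega w)) j q).
pose B u j q w := Kre (u * (Kconj u * (G t (Omega w) j j * (adjmx E *m E) q q))).
pose SA w := \sum_(u <- @dirs R k) \sum_j \sum_a A u j a w.
pose SB w := \sum_(u <- @dirs R k) \sum_j \sum_a B u j a w.
have [iSA iSB e] : [/\ Pint P SA, Pint P SB &
    (kdim k)%:R * \int[P]_w SA w = \int[P]_w SB w].
  by rewrite /SA /SB; do 3!apply: Pexp_scaled_sum => ?; exact: St.
have SAE w : SA w = rdot (Zt t w) (Zt t w).
  rewrite /SA /A exchange_big /=.
  under eq_bigr do rewrite exchange_big /=.
  under eq_bigr do under eq_bigr do rewrite sum_dirs_mul.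
  rewrite -/(rdot (N (Omega w)) (G t (Omega w) *m N (Omega w))).
  rewrite rdotC /G -mulmxA rdotMl; congr rdot;
    by rewrite /Zt adjmxM res_adj.
have SBE w : SB w = (kdim k)%:R * (rdot E E * rho (M (Omega w)) t).
  rewrite /SB /B exchange_big /=.
  under eq_bigr do rewrite exchange_big /=.
  under eq_bigr do under eq_bigr do rewrite sum_dirs_conj.
  under eq_bigr do rewrite -mulr_sumr -Kre_sum -mulr_sumr.
  rewrite -mulr_sumr -Kre_sum -mulr_suml; congr (_ * _).
  rewrite -/(\tr (G t (Omega w))) -/(\tr (adjmx E *m E)) KreM.
  rewrite [Kim (\tr (adjmx E *m E))]Kim_herm_tr ?mulr0 ?subr0; last first.
    by rewrite adjmxM adjmxK.
  by rewrite mulrC -rdot_trace /G mxtrace_mulC /rho -rdot_trace.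
split.
  by apply: eq_integrable iSA => // w _; rewrite /= SAE.
have irho : Pint P (fun w => rdot E E * rho (M (Omega w)) t).
  apply: PintZ; apply: Pint_rho => //; apply: mxmeas_of_measurable.
  exact: measurableT_comp (measurable_of_mxmeas mM) mOmega.
apply: (mulfI kdim_neq0); rewrite -[RHS]RintegralZl//.
transitivity ((kdim k)%:R * \int[P]_w SA w).
  by congr (_ * _); apply: eq_Rintegral => w _; rewrite SAE.
by rewrite e; apply: eq_Rintegral => w _; rewrite SBE.
Qed.

(** The factor [H = S M^*] is constant along the directions that move [N], so the integration by
    parts has a zero right-hand side. *)
Lemma gauss_mean t (c : K) (a : 'I_r) (q : 'I_p) : 0 < t ->
  \int[P]_w Kre (c * Zt t w a q) = 0.
Proof.
move=> t0; pose H X : 'M[K]_(r, l) := res (M X) t *m adjmx (M X).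
have mH : mxmeas H by apply: mxmeasM; [exact: mxmeas_res|exact: mxmeas_adj].
have nmH X : nm (H X) <= (l * r)%:R * (1 + t^-1).
  by rewrite /H -[X in nm X]adjmxK nm_adj adjmxM adjmxK res_adj nm_Mres.
have St (u : K) (j : 'I_l) :
   Pint P (fun w => Kre (u * N (Omega w) j q) * Kre (u * Kconj (c * H (Omega w) a j))) /\
   \int[P]_w (Kre (u * N (Omega w) j q) * Kre (u * Kconj (c * H (Omega w) a j))) = 0.
  pose b := Kabs u * (Kabs c * ((l * r)%:R * (1 + t^-1))) : R.
  have b0 : 0 <= b.
    by do 2!(apply: mulr_ge0; first exact: Kabs_ge0); rewrite (le_trans _ (nmH 0))// nm_ge0.
  have [||||||] := @stein (D u j q)
     (fun X => Kre (u * Kconj (c * H X a j))) (fun=> 0) (fun=> b).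
  - by have [] := KmeasM (Kmeas_cst u) (Kmeas_conj (KmeasM (Kmeas_cst c) (mH a j))).
  - exact: measurable_cst.
  - exact: Pint_cst.
  - move=> X; rewrite (le_trans (Kre_abs_le _))// !KabsM Kabs_conj KabsM.
    do 2!(rewrite ler_wpM2l ?Kabs_ge0//).
    by rewrite (le_trans _ (nmH X))// Kabs_le_nm.
  - by move=> X; rewrite normr0.
  - move=> X s s0 s1; rewrite /H M_shift subrr mulr0 subr0 normr0.
    by rewrite mulr_ge0 ?sqr_ge0.
  move=> _ i2; rewrite Pexp_cst => /eqP.
  rewrite mulf_eq0 (negbTE kdim_neq0) /= => /eqP e.
  have rE w : rdot (D u j q) (Omega w) = Kre (u * N (Omega w) j q) by exact: rdot_dir.
  split; first by apply: eq_integrable i2 => // w _; rewrite /= rE.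
  by rewrite -[RHS]e; apply: eq_Rintegral => w _; rewrite rE.
pose A u j w := Kre (u * N (Omega w) j q) * Kre (u * Kconj (c * H (Omega w) a j)).
have iA u j : Pint P (A u j) by have [] := St u j.
have iA1 u : Pint P (fun w => \sum_j A u j w) by apply: Pint_sum.
transitivity (\int[P]_w \sum_(u <- @dirs R k) \sum_j A u j w).
  apply: eq_Rintegral => w _; rewrite exchange_big /=.
  under [RHS]eq_bigr do rewrite sum_dirs_mul.
  rewrite -/(H (Omega w)) /Zt [(_ *m N _) a q]mxE mulr_sumr Kre_sum.
  apply: eq_bigr => j _; rewrite -[RHS]Kre_conj KconjM !KconjK.
  by rewrite mulrA mulrC.
rewrite Pexp_sum// big1// => u _; rewrite Pexp_sum// big1// => j _.
by have [] := St u j.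
Qed.

End GaussianMoments.

Section GaussianLeak.
Variables (r : nat) (Q : 'M[K]_(n, r)).
Hypothesis QQ : adjmx Q *m Q = 1%:M.
Hypothesis rl : (r < l - alpha k)%N.

Let M w : 'M[K]_(l, r) := adjmx (Omega w) *m Q.
Let mM : mxmeas M.
Proof. by apply: mxmeas_sketch; exact: mxmeas_of_measurable. Qed.

Let c : R := (kdim k)%:R * (l%:R - r%:R) - (alpha k)%:R.
Let kap : R := (kdim k)%:R * r%:R.
Let err t w := gauss_err Q t (Omega w).

Let kdim_gt0 : 0 < (kdim k)%:R :> R. Proof. by rewrite ltr0n; case: (k). Qed.

Let c_gt0 : 0 < c. Proof. by rewrite /c kdim_alpha mulr_gt0// alpha_gap. Qed.

Let merr t : 0 < t -> measurable_fun setT (err t).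
Proof.
move=> t0; have m1 := measurable_tau mM t0; have m2 := measurable_tau2 mM t0.
apply: measurable_funD; first apply: measurable_funD.
- by apply: measurable_funM => //; exact: measurable_funM.
- apply: measurable_funM => //; apply: measurable_funM => //.
  exact: measurable_funX.
- by apply: measurable_funM => //; exact: measurable_funM.
Qed.

Let err_le t w : 0 < t -> t <= 1 ->
  `|err t w| <= 2 * t * (tau (M w) t + tau (M w) t ^+ 2 + tau2 (M w) t).
Proof.
move=> t0 t1; rewrite /err /gauss_err -/(M w).
have h1 := tau_ge0 (M w) t0; have h2 := tau2_ge0 (M w) t.
have h3 := sqr_ge0 (tau (M w) t).
have k1 : (kdim k)%:R <= 2 :> R by rewrite ler_nat; case: (k).
have a1 : (alpha k)%:R <= 2 :> R by rewrite ler_nat; case: (k).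
have a0 : 0 <= (alpha k)%:R :> R by [].
have {}h1 : 0 <= t * tau (M w) t by rewrite mulr_ge0// ltW.
have {}h2 : 0 <= t * tau2 (M w) t by rewrite mulr_ge0// ltW.
have {}h3 : 0 <= t * tau (M w) t ^+ 2 by rewrite mulr_ge0// ltW.
rewrite ger0_norm; last by rewrite !addr_ge0// mulr_ge0// ltW.
rewrite -mulrA !mulrDr; nra.
Qed.

Let err_ge t w : 0 < t -> t <= 1 -> - 0 <= err t w.
Proof.
move=> t0 t1; rewrite oppr0 /err /gauss_err.
by rewrite !addr_ge0// !mulr_ge0 ?tau2_ge0 ?tau_ge0 ?sqr_ge0 ?(ltW t0).
Qed.

Let identity t : 0 < t -> t <= 1 ->
  \int[P]_w (c * tau (M w) t + err t w) = kap.
Proof. by move=> t0 _; exact: gauss_identity. Qed.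

Let zero_le2 : 0 <= 2 :> R. Proof. by []. Qed.

Lemma gauss_leak : leak_moments P Omega Q (r%:R / (l%:R - r%:R - (alpha k)%:R)).
Proof.
have unitM := ae_gram_unit mM c_gt0 zero_le2 merr err_le err_ge identity.
have Etau t := Exp_tau_le mM c_gt0 zero_le2 merr err_le err_ge identity (t := t).
have irho0 := Pint_rho0 mM c_gt0 zero_le2 merr err_le err_ge identity.
have Erho0 := Exp_rho0 mM c_gt0 zero_le2 merr err_le err_ge identity.
have {}Erho0 : \int[P]_w rho0 (M w) = r%:R / (l%:R - r%:R - (alpha k)%:R).
  by rewrite Erho0 /kap /c kdim_alpha -mulf_div divff ?mul1r// gt_eqF.
have irho t : 0 < t -> Pint P (fun w => rho (M w) t) by exact: Pint_rho.
have Erho t : 0 < t -> t <= 1 -> \int[P]_w rho (M w) t <= (kap + 0) / c.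
  move=> t0 t1; rewrite (le_trans _ (Etau t t0 t1))//; apply: Pexp_le.
  - exact: irho.
  - exact: Pint_tau.
  - by move=> w; rewrite [leRHS]tau_split// lerDl mulr_ge0 ?tau2_ge0// ltW.
(* [rho] is the regularized second moment for [N = 1], which gives convergence of its mean. *)
have crho : \int[P]_w rho (M w) (tseq m) @[m --> \oo] --> \int[P]_w rho0 (M w).
  have m1 : mxmeas (fun _ : T => 1%:M : 'M[K]_l) by exact: mxmeas_cst.
  have := @cvg_mpinv_second_moment _ _ _ P k l r l M (fun=> 1%:M) mM m1.
  have e0 w : rdot (mpinv (M w) *m 1%:M) (mpinv (M w) *m 1%:M) = rho0 (M w).
    by rewrite mulmx1.
  move=> h; rewrite (_ : (fun m => \int[P]_w rho (M w) (tseq m)) = fun m =>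
      \int[P]_w rdot (res (M w) (tseq m) *m adjmx (M w) *m 1%:M)
                     (res (M w) (tseq m) *m adjmx (M w) *m 1%:M)); last first.
    by apply/funext => m; apply: eq_Rintegral => w _; rewrite mulmx1 rhoE.
  rewrite (_ : \int[P]_w rho0 (M w) =
      \int[P]_w rdot (mpinv (M w) *m 1%:M) (mpinv (M w) *m 1%:M)); last first.
    by apply: eq_Rintegral => w _; rewrite e0.
  by apply: h; apply: eq_integrable irho0 => // w _; rewrite /= e0.
split=> // p E QE.
pose N w : 'M[K]_(l, p) := adjmx (Omega w) *m E.
have mN : mxmeas N by apply: mxmeas_sketch; exact: mxmeas_of_measurable.
have S2 t (t0 : 0 < t) := gauss_second_moment QE t0 (Q := Q).
have iL : Pint P (fun w => rdot (leak Omega Q E w) (leak Omega Q E w)).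
  apply: (mpinv_second_moment mM mN (B := rdot E E * ((kap + 0) / c))).
    by move=> t t0 _; have [] := S2 t t0.
  move=> t t0 t1; have [_ ->] := S2 t t0.
  rewrite RintegralZl//; last exact: irho.
  by rewrite ler_wpM2l ?rdotxx_ge0// Erho.
split => //.
  have c1 := cvg_mpinv_second_moment mM mN iL.
  apply: (cvg_unique (@Rhausdorff R) c1).
  rewrite (_ : (fun m => _) = fun m => rdot E E * \int[P]_w rho (M w) (tseq m)).
    by rewrite mulrC -Erho0; apply: cvgMl_tmp.
  apply/funext => m; have [_ ->] := S2 _ (tseq_gt0 m).
  by rewrite RintegralZl//; exact: irho (tseq_gt0 _).
move=> z a q; have [i1 c1] := cvg_mpinv_mean mM mN iL z a q.
split=> //; apply: (cvg_unique (@Rhausdorff R) c1).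
rewrite (_ : (fun m => _) = cst 0); first exact: cvg_cst.
by apply/funext => m; rewrite (gauss_mean QE z a q (tseq_gt0 m)).
Qed.

End GaussianLeak.

End Gaussian.

(** * Random orthonormal embeddings *)

Section Invariance.
Context d (T : measurableType d) {R : realType} (P : probability T R).

Lemma eq_law_integral_EFin d' (T' : measurableType d') (X Y : T -> T') :
  measurable_fun setT X -> measurable_fun setT Y ->
  (forall S, measurable S -> P (X @^-1` S) = P (Y @^-1` S)) ->
  forall f : T' -> R, measurable_fun setT f ->
    (\int[P]_w (f (X w))%:E = \int[P]_w (f (Y w))%:E)%E.
Proof.
move=> mX mY XY f mf.
have mF : measurable_fun setT (EFin \o f) by exact/measurable_EFinP.
rewrite integralE [RHS]integralE; congr (_ - _)%E.
  transitivity (\int[P]_w (EFin \o f)^\+ (X w))%E.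
    by apply: eq_integral => w _; rewrite !funeposE.
  rewrite (eq_law_integral mX mY XY (measurable_funepos mF))//.
  by apply: eq_integral => w _; rewrite !funeposE.
transitivity (\int[P]_w (EFin \o f)^\- (X w))%E.
  by apply: eq_integral => w _; rewrite !funenegE.
rewrite (eq_law_integral mX mY XY (measurable_funeneg mF))//.
by apply: eq_integral => w _; rewrite !funenegE.
Qed.

Lemma Pint_ae_eq f g : measurable_fun setT f -> Pint P g ->
  {ae P, forall w, f w = g w} -> Pint P f.
Proof.
move=> mf ig fg; have mg := PintP ig.
apply/integrableP; split; first exact/measurable_EFinP.
move/integrableP : ig => [_]; apply: le_lt_trans.
rewrite le_eqVlt; apply/orP; left; apply/eqP.
apply: ae_eq_integral => //.
- by apply: measurableT_comp => //; exact/measurable_EFinP.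
- by apply: measurableT_comp => //; exact/measurable_EFinP.
- by apply: filterS fg => w /= h _; rewrite h.
Qed.

Context {k : field_kind} {n l : nat}.
Local Notation K := (Kfield R k).
Local Notation Mx := 'M[K]_(n, l).
Variable Omega : T -> Mx.
Hypothesis mOmega : measurable_fun setT Omega.
Hypothesis inv_Omega : forall U : 'M[K]_n, unitary U ->
  forall S, measurable S ->
    P ((fun w => U *m Omega w) @^-1` S) = P (Omega @^-1` S).

Lemma invariant_integral (U : 'M[K]_n) (f : Mx -> R) : unitary U ->
  measurable_fun setT f ->
  (\int[P]_w (f (U *m Omega w))%:E = \int[P]_w (f (Omega w))%:E)%E.
Proof.
move=> uU mf; apply: eq_law_integral_EFin => //; last exact: inv_Omega.
apply: measurable_of_mxmeas; apply: mxmeasM; first exact: mxmeas_cst.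
exact: mxmeas_of_measurable.
Qed.

(** By invariance the mean of [f (U s *m Omega)] does not depend on [s], so its first-order term
    vanishes; the uniform remainder allows integrating the expansion. *)
Lemma invariant_derivative (U : R -> 'M[K]_n) (f f' : Mx -> R) (C : R) :
  (forall s, unitary (U s)) -> measurable_fun setT f -> measurable_fun setT f' ->
  (forall X, `|f X| <= C) -> (forall X, `|f' X| <= C) ->
  (forall X s, 0 < s -> s <= 1 ->
    `|f (U s *m X) - f X - s * f' X| <= s ^+ 2 * C) ->
  \int[P]_w f' (Omega w) = 0.
Proof.
move=> uU mf mf' fC f'C df.
have mc (g : Mx -> R) : measurable_fun setT g -> measurable_fun setT (fun w => g (Omega w)).
  by move=> mg; exact: measurableT_comp mg mOmega.
have i1 : Pint P (fun w => f (Omega w)).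
  by apply: (Pint_le (mc _ mf) (Pint_cst P C)) => w; exact: fC.
have i2 : Pint P (fun w => f' (Omega w)).
  by apply: (Pint_le (mc _ mf') (Pint_cst P C)) => w; exact: f'C.
apply: (@le_sqr_eq0 _ _ C) => s s0 s1.
have mUO : measurable_fun setT (fun w => U s *m Omega w).
  apply: measurable_of_mxmeas; apply: mxmeasM; first exact: mxmeas_cst.
  exact: mxmeas_of_measurable.
have i3 : Pint P (fun w => f (U s *m Omega w)).
  apply: (Pint_le _ (Pint_cst P C)) => [|w]; last exact: fC.
  exact: measurableT_comp mf mUO.
have e : \int[P]_w f (U s *m Omega w) = \int[P]_w f (Omega w).
  by rewrite /Rintegral invariant_integral.
have i4 := PintB i3 i1; have i5 := PintZ s i2.
have -> : s * \int[P]_w f' (Omega w) =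
    - \int[P]_w (f (U s *m Omega w) - f (Omega w) - s * f' (Omega w)).
  by rewrite RintegralB// RintegralB// RintegralZl// e; ring.
rewrite normrN -(@Pexp_cst _ _ R P (s ^+ 2 * C)).
apply: Pexp_norm_le; [exact: PintB|exact: Pint_cst|].
by move=> w; exact: df.
Qed.

End Invariance.

(** * Rotations mixing a subspace with its complement *)

Section Rotation.
Context {R : realType} {k : field_kind}.
Local Notation K := (Kfield R k).
Variables (n : nat) (H : 'M[K]_n).
Hypotheses (HA : adjmx H = - H) (H3 : H *m H *m H = - H).

Definition sg (s : R) : R := 2 * s / (1 + s ^+ 2).

Lemma sgE s : sg s * (1 + s ^+ 2) = 2 * s.
Proof. by rewrite /sg mulfVK// gt_eqF// ltr_wpDr ?sqr_ge0. Qed.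

(* As [H^3 = - H], this is the exponential of [theta H] for [s = tan (theta / 2)],
   since [sg s = sin theta] and [sg s * s = 1 - cos theta]. *)
Definition rot (s : R) : 'M[K]_n := 1%:M + toK (sg s) *: (H + toK s *: (H *m H)).

Lemma adj_rot s : adjmx (rot s) = 1%:M - toK (sg s) *: (H - toK s *: (H *m H)).
Proof.
rewrite /rot adjmxD adjmx1 adjmxZ Kconj_toK adjmxD adjmxZ Kconj_toK adjmxM HA.
rewrite mulNmx mulmxN opprK; set Y := toK s *: (H *m H).
by congr (_ + _); rewrite -scalerN opprB addrC.
Qed.

Lemma rot_unitary s : unitary (rot s).
Proof.
rewrite /unitary adj_rot /rot; set A := H - _; set B := H + _.
have AB : A *m B = toK (1 + s ^+ 2) *: (H *m H).
  rewrite /A /B mulmxBl !mulmxDr -!scalemxAl -!scalemxAr !mulmxA H3.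
  rewrite mulNmx !scalerN scalerA -toKM -expr2 toKD scalerDl toK1 scale1r.
  set X := H *m H; set Y := toK s *: H.
  by apply/matrixP => i j; rewrite !mxE; ring.
rewrite mulmxBl mul1mx mulmxDr mulmx1 -scalemxAl -scalemxAr AB !scalerA -!toKM.
have BA : B - A = toK (2 * s) *: (H *m H).
  have -> : 2 * s = s + s by ring.
  rewrite /A /B toKD scalerDl; set X := _ *: _.
  by apply/matrixP => i j; rewrite !mxE; ring.
have -> : sg s * sg s * (1 + s ^+ 2) = sg s * (2 * s) by rewrite -mulrA sgE.
rewrite toKM -scalerA -BA (scalerBr _ B A).
set X := _ *: B; set Y := _ *: A.
by apply/matrixP => i j; rewrite !mxE; ring.
Qed.

End Rotation.

Section OrthonormalIdentity.
Context {R : realType} {k : field_kind} {n l r m : nat}.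
Local Notation K := (Kfield R k).
Local Notation Mx := 'M[K]_(n, l).
Variables (Q : 'M[K]_(n, r)) (V : 'M[K]_(n, m)).
Hypotheses (QQ : adjmx Q *m Q = 1%:M) (VV : adjmx V *m V = 1%:M).
Hypotheses (QV : adjmx Q *m V = 0).
Hypothesis QQVV : Q *m adjmx Q + V *m adjmx V = 1%:M.

Let VQ : adjmx V *m Q = 0.
Proof. by rewrite -[Q]adjmxK -adjmxM QV adjmx0. Qed.

Let M (X : Mx) : 'M[K]_(l, r) := adjmx X *m Q.
Let N (X : Mx) : 'M[K]_(l, m) := adjmx X *m V.

Variable Xm : 'M[K]_(r, m).
(** [Xm] is a partial isometry, which is what gives the generator its cubic relation. *)
Hypotheses (XXX : Xm *m adjmx Xm *m Xm = Xm) (nXm : nm Xm <= 1).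

(* Generates rotations mixing the range of [Q] with that of [V]. *)
Definition rotgen : 'M[K]_n := Q *m Xm *m adjmx V - V *m adjmx Xm *m adjmx Q.

Let HQ : rotgen *m Q = - (V *m adjmx Xm).
Proof.
by rewrite mulmxBl -!mulmxA VQ QQ !mulmx0 mulmx1 sub0r.
Qed.

Let HV : rotgen *m V = Q *m Xm.
Proof.
by rewrite mulmxBl -!mulmxA VV QV !mulmx0 mulmx1 subr0.
Qed.

Let HHQ : rotgen *m rotgen *m Q = - (Q *m Xm *m adjmx Xm).
Proof. by rewrite -mulmxA HQ mulmxN mulmxA HV. Qed.

Let HHV : rotgen *m rotgen *m V = - (V *m adjmx Xm *m Xm).
Proof. by rewrite -mulmxA HV mulmxA HQ mulNmx. Qed.

Lemma adj_rotgen : adjmx rotgen = - rotgen.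
Proof. by rewrite /rotgen adjmxB !adjmxM !adjmxK !mulmxA opprB. Qed.

Lemma rotgen3 : rotgen *m rotgen *m rotgen = - rotgen.
Proof.
rewrite {3}/rotgen mulmxBr !mulmxA HHQ HHV.
rewrite !mulNmx -(mulmxA Q Xm) -(mulmxA Q) XXX.
have AXA : adjmx Xm *m Xm *m adjmx Xm = adjmx Xm.
  by rewrite -[in RHS]XXX !adjmxM adjmxK mulmxA.
by rewrite -(mulmxA V) -(mulmxA V) AXA opprK /rotgen opprB addrC.
Qed.

Let U s := rot rotgen s.

Let adjU_Q s : adjmx (U s) *m Q =
  Q + toK (sg s) *: (V *m adjmx Xm) - toK (sg s * s) *: (Q *m Xm *m adjmx Xm).
Proof.
rewrite adj_rot ?adj_rotgen// mulmxBl mul1mx -scalemxAl mulmxBl -scalemxAl HQ HHQ.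
rewrite toKM -scalerA; set a := V *m _; set b := Q *m _ *m _.
by apply/matrixP => x y; move: a b => a b; rewrite !mxE; ring.
Qed.

Let adjU_V s : adjmx (U s) *m V =
  V - toK (sg s) *: (Q *m Xm) - toK (sg s * s) *: (V *m adjmx Xm *m Xm).
Proof.
rewrite adj_rot ?adj_rotgen// mulmxBl mul1mx -scalemxAl mulmxBl -scalemxAl HV HHV.
rewrite toKM -scalerA; set a := Q *m _; set b := V *m _ *m _.
by apply/matrixP => x y; move: a b => a b; rewrite !mxE; ring.
Qed.

(** First- and second-order parts of the sketches along the rotation; the factor 2 is the derivative
    of [sg] at 0. [M2] and [N2] still depend on [s], but boundedly, as [|sg s|] and [|sg s / s|] are
    at most 2 for [0 < s <= 1]. *)
Let M1 X : 'M[K]_(l, r) := toK 2 *: (N X *m adjmx Xm).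
Let M2 s X : 'M[K]_(l, r) := toK (- sg s) *: (N X *m adjmx Xm)
  - toK (sg s / s) *: (M X *m Xm *m adjmx Xm).
Let N1 X : 'M[K]_(l, m) := toK (- 2) *: (M X *m Xm).
Let N2 s X : 'M[K]_(l, m) := toK (sg s) *: (M X *m Xm)
  - toK (sg s / s) *: (N X *m adjmx Xm *m Xm).

Let sg2 (s : R) : s != 0 -> sg s = s * 2 + s ^+ 2 * (- sg s).
Proof. by move=> s0; have := sgE s; lra. Qed.

Let sgs (s : R) : s != 0 -> sg s * s = s ^+ 2 * (sg s / s).
Proof. by move=> s0; rewrite expr2; field. Qed.

Let sgZ p q s (A : 'M[K]_(p, q)) : s != 0 ->
  toK (sg s) *: A = toK s *: (toK 2 *: A) + toK (s ^+ 2) *: (toK (- sg s) *: A).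
Proof. by move=> s0; rewrite !scalerA -!toKM -scalerDl -toKD -sg2. Qed.

Let sgsZ p q s (A : 'M[K]_(p, q)) : s != 0 ->
  toK (sg s * s) *: A = toK (s ^+ 2) *: (toK (sg s / s) *: A).
Proof. by move=> s0; rewrite scalerA -toKM -sgs. Qed.

Let M_rot s X : s != 0 -> M (U s *m X) = M X + toK s *: M1 X + toK (s ^+ 2) *: M2 s X.
Proof.
move=> s0; rewrite /M adjmxM -mulmxA adjU_Q mulmxBr mulmxDr -!scalemxAr !mulmxA.
rewrite -/(M X) -/(N X) /M1 /M2.
by rewrite (sgZ (N X *m adjmx Xm) s0) (sgsZ (M X *m Xm *m adjmx Xm) s0) scalerBr !addrA.
Qed.

Let N_rot s X : s != 0 -> N (U s *m X) = N X + toK s *: N1 X + toK (s ^+ 2) *: N2 s X.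
Proof.
move=> s0; rewrite /N adjmxM -mulmxA adjU_V !mulmxBr -!scalemxAr !mulmxA.
rewrite -/(M X) -/(N X) /N1 /N2.
rewrite [in LHS](sgZ (M X *m Xm) s0) (sgsZ (N X *m adjmx Xm *m Xm) s0) scalerBr opprD !addrA !toKN !scaleNr !scalerN opprK.
by [].
Qed.

Lemma nm_isometry (X : Mx) : adjmx X *m X = 1%:M -> nm X <= (n * l)%:R.
Proof.
move=> XX; rewrite -[leRHS]mulr1; apply: nm_le_entry => // a b.
have := @gram_diag R k n l X b; rewrite XX mxE eqxx mulr1n => h.
have : Kabs (X a b) ^+ 2 <= 1.
  rewrite -[leRHS](Kre_toK (k := k)) toK1 h (bigD1 a)//= lerDl.
  by apply: sumr_ge0 => *; exact: sqr_ge0.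
by have := Kabs_ge0 (X a b); rewrite expr2; nra.
Qed.

(** Product rule with explicit remainder: 6 is 3 + 2 + 1, from [|B'| <= 3 c], [|A + s A1| <= 2 c]
    and the term [s^2 A1 B1]. *)
Lemma mx_prod_expand p q v (A A' A1 : 'M[K]_(p, q)) (B B' B1 : 'M[K]_(q, v)) c s :
  0 < s -> s <= 1 -> nm A <= c -> nm A1 <= c -> nm B <= c -> nm B1 <= c ->
  nm (A' - A - toK s *: A1) <= s ^+ 2 * c -> nm (B' - B - toK s *: B1) <= s ^+ 2 * c ->
  nm (A' *m B' - A *m B - toK s *: (A1 *m B + A *m B1)) <= s ^+ 2 * (6 * c ^+ 2).
Proof.
move=> s0 s1 Ac A1c Bc B1c A'c B'c.
pose RA := A' - A - toK s *: A1; pose RB := B' - B - toK s *: B1.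
rewrite -/RA in A'c; rewrite -/RB in B'c.
have c0 : 0 <= c := le_trans (nm_ge0 A) Ac.
have s2 : s ^+ 2 <= 1 by rewrite expr_le1// ltW.
have -> : A' *m B' - A *m B - toK s *: (A1 *m B + A *m B1) =
    RA *m B' + (A + toK s *: A1) *m RB + toK (s ^+ 2) *: (A1 *m B1).
  rewrite /RA /RB !mulmxBl !mulmxBr !mulmxDl -!scalemxAl -!scalemxAr scalerDr.
  rewrite scalerA -toKM -expr2.
  set X1 := A' *m B'; set X2 := A *m B'; set X3 := A1 *m B'; set X4 := A *m B.
  set X5 := A *m B1; set X6 := A1 *m B; set X7 := A1 *m B1.
  apply/matrixP => x y; move: X1 X2 X3 X4 X5 X6 X7 => X1 X2 X3 X4 X5 X6 X7.
  by rewrite expr2 toKM !mxE; ring.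
have hB' : nm B' <= 3 * c.
  have -> : B' = RB + (B + toK s *: B1) by rewrite /RB [B + _]addrC addrA !subrK.
  have -> : 3 * c = c + (c + c) by ring.
  apply: nmD_le; first by rewrite (le_trans B'c)// ler_piMl.
  by apply: nmD_le => //; rewrite nm_toK ?(ltW s0)// (le_trans _ B1c)// ler_piMl ?nm_ge0.
have hA : nm (A + toK s *: A1) <= 2 * c.
  have -> : 2 * c = c + c by ring.
  by apply: nmD_le => //; rewrite nm_toK ?(ltW s0)// (le_trans _ A1c)// ler_piMl ?nm_ge0.
have -> : s ^+ 2 * (6 * c ^+ 2) = s ^+ 2 * c * (3 * c) + 2 * c * (s ^+ 2 * c) + s ^+ 2 * (c * c).
  by ring.
apply: nmD_le; first by apply: nmD_le; exact: nmM_le.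
by rewrite nm_toK ?sqr_ge0// ler_wpM2l ?sqr_ge0// nmM_le.
Qed.

(** Derivative at 0 of [N^* M S] along the rotation. The factor [N^*] gives the field the shape of
    [Xm^*], so that it can be paired with the generators. *)
Definition rot_deriv t X : 'M[K]_(m, r) :=
  adjmx (N1 X) *m (M X *m res (M X) t) + adjmx (N X) *m dMres (M X) t (M1 X).

(** Regularization bounds [M S] but not [N], which is bounded because [X] is an isometry. *)
Lemma rot_expand t : 0 < t -> exists2 C, 0 <= C &
  forall X, adjmx X *m X = 1%:M ->
  [/\ nm (adjmx (N X) *m (M X *m res (M X) t)) <= C, nm (rot_deriv t X) <= C &
   forall s, 0 < s -> s <= 1 ->
   let Y := U s *m X in
   nm (adjmx (N Y) *m (M Y *m res (M Y) t) - adjmx (N X) *m (M X *m res (M X) t)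
       - toK s *: rot_deriv t X) <= s ^+ 2 * C].
Proof.
(* [b] bounds [M] and [N]; [4 b] then bounds [M1], [N1] and the two terms of [M2] and of [N2]. *)
move=> t0; pose b : R := (n * l)%:R * (nm Q + nm V); pose c := 4 * b.
have b0 : 0 <= b by rewrite mulr_ge0// addr_ge0 ?nm_ge0.
have c0 : 0 <= c by rewrite mulr_ge0.
have [C0 C00 HC] := @Mres_expand R k l r t c t0 c0.
pose C1 := c + C0; have C10 : 0 <= C1 by rewrite addr_ge0.
exists (6 * C1 ^+ 2); first by rewrite mulr_ge0 ?sqr_ge0.
move=> X XX; have nX := nm_isometry XX.
have bM : nm (M X) <= b.
  apply: (@le_trans _ _ ((n * l)%:R * nm Q)); first by rewrite nmM_le ?nm_adj.
  by rewrite ler_wpM2l// lerDl nm_ge0.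
have bN : nm (N X) <= b.
  apply: (@le_trans _ _ ((n * l)%:R * nm V)); first by rewrite nmM_le ?nm_adj.
  by rewrite ler_wpM2l// lerDr nm_ge0.
have mulX p (A : 'M[K]_(p, r)) a : nm A <= a -> nm (A *m Xm) <= a.
  by move=> Aa; rewrite -[a]mulr1 nmM_le.
have mulX' p (A : 'M[K]_(p, m)) a : nm A <= a -> nm (A *m adjmx Xm) <= a.
  by move=> Aa; rewrite -[a]mulr1 nmM_le ?nm_adj.
have scb p q (A : 'M[K]_(p, q)) z : `|z| <= 2 -> nm A <= b -> nm (toK z *: A) <= 2 * b.
  by move=> z2 Ab; rewrite nmZ Kabs_toK ler_pM ?nm_ge0.
have b2c : 2 * b <= c by rewrite /c; lra.
have cM1 : nm (M1 X) <= c.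
  by rewrite (le_trans (scb _ _ _ _ _ (mulX' _ _ _ bN)))// ger0_norm.
have cN1 : nm (N1 X) <= c.
  by rewrite (le_trans (scb _ _ _ _ _ (mulX _ _ _ bM)))// normrN ger0_norm.
have [hF hdF _] := HC (M X) (M1 X) (M1 X) 1 ltr01 (lexx _) cM1 cM1.
have C0C1 : C0 <= C1 by rewrite lerDr.
have cC1 : c <= C1 by rewrite lerDl.
have nN : nm (adjmx (N X)) <= C1 by rewrite nm_adj (le_trans bN)//; lra.
have nN1 : nm (adjmx (N1 X)) <= C1 by rewrite nm_adj (le_trans cN1).
have nF := le_trans hF C0C1; have ndF := le_trans hdF C0C1.
have sqC1 : 0 <= C1 ^+ 2 by exact: sqr_ge0.
split.
- rewrite (le_trans (nmM_le nN nF))//; move: sqC1; rewrite expr2; lra.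
- rewrite (le_trans (nmD_le (nmM_le nN1 nF) (nmM_le nN ndF)))//.
  move: sqC1; rewrite expr2; lra.
move=> s s0 s1; have sn0 : s != 0 by rewrite gt_eqF.
rewrite /= M_rot// N_rot//.
have sgs2 : `|sg s / s| <= 2.
  rewrite /sg mulrAC mulfK// normrM ger0_norm// normfV ler_pdivrMr; last first.
    by rewrite normr_gt0 gt_eqF// ltr_wpDr ?sqr_ge0.
  by rewrite ler_peMr// ger0_norm ?addr_ge0 ?sqr_ge0// lerDl sqr_ge0.
have ssg2 : `|sg s| <= 2.
  have -> : sg s = s * (sg s / s) by field.
  by rewrite normrM gtr0_norm// (le_trans _ sgs2)// ler_piMl.
have cM2 : nm (M2 s X) <= c.
  have -> : c = 2 * b + 2 * b by rewrite /c; ring.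
  apply: nmB_le; apply: scb; rewrite ?normrN//; first exact: mulX'.
  by apply: mulX'; exact: mulX.
have cN2 : nm (N2 s X) <= c.
  have -> : c = 2 * b + 2 * b by rewrite /c; ring.
  apply: nmB_le; apply: scb => //; first exact: mulX.
  by apply: mulX; exact: mulX'.
have [_ _ h] := HC (M X) (M1 X) (M2 s X) s s0 s1 cM1 cM2.
apply: mx_prod_expand => //.
  have -> : adjmx (N X + toK s *: N1 X + toK (s ^+ 2) *: N2 s X) - adjmx (N X)
      - toK s *: adjmx (N1 X) = toK (s ^+ 2) *: adjmx (N2 s X).
    rewrite adjmxD (adjmxD (N X)) (adjmxZ (toK s)) (adjmxZ (toK (s ^+ 2))) !Kconj_toK.
    set a := adjmx (N X); set b1 := toK s *: adjmx (N1 X); set b2 := _ *: adjmx (N2 s X).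
    by apply/matrixP => x y; move: a b1 b2 => a b1 b2; rewrite !mxE; ring.
  by rewrite nm_toK ?sqr_ge0// nm_adj ler_wpM2l ?sqr_ge0// (le_trans cN2).
by rewrite (le_trans h)// ler_wpM2l ?sqr_ge0.
Qed.

End OrthonormalIdentity.

(** * Divergence along the rotations *)

Section OrthonormalDivergence.
Context {R : realType} {k : field_kind} {n l r m : nat}.
Local Notation K := (Kfield R k).
Local Notation Mx := 'M[K]_(n, l).
Variables (Q : 'M[K]_(n, r)) (V : 'M[K]_(n, m)).

Let M (X : Mx) : 'M[K]_(l, r) := adjmx X *m Q.
Let N (X : Mx) : 'M[K]_(l, m) := adjmx X *m V.

Lemma rot_deriv_entry t (u : K) j i X : rot_deriv Q V (u *: delta_mx j i) t X i j =
  toK 2 * (- (Kconj u * (adjmx (M X) *m (M X *m res (M X) t)) j j)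
  + Kconj u * ((adjmx (N X) *m N X) i i * res (M X) t j j)
  - u * ((adjmx (N X) *m (M X *m res (M X) t)) i j *
         (adjmx (N X) *m (M X *m res (M X) t)) i j)
  - Kconj u * ((adjmx (N X) *m (M X *m res (M X) t *m adjmx (M X)) *m N X) i i
               * res (M X) t j j)).
Proof.
rewrite /rot_deriv /dMres -/(M X) -/(N X).
set A := M X; set B := N X; set S := res A t; set F := A *m S.
set G := F *m adjmx A.
have scaleE p q v (Y : 'M[K]_(p, q)) x y : (v *: Y) x y = v * Y x y by rewrite mxE.
have addE p q (Y Z : 'M[K]_(p, q)) x y : (Y + Z) x y = Y x y + Z x y by rewrite mxE.
have subE p q (Y Z : 'M[K]_(p, q)) x y : (Y - Z) x y = Y x y - Z x y by rewrite !mxE.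
have e1 : (adjmx (toK (- 2) *: (A *m (u *: delta_mx j i))) *m F) i j =
    - (toK 2 * (Kconj u * (adjmx A *m F) j j)).
  rewrite adjmxZ Kconj_toK adjmxM adjmxZ adjmx_delta -!scalemxAl !scaleE toKN.
  rewrite -mulmxA -[delta_mx i j]mul1mx mul_delta_entry mxE eqxx mul1r.
  by rewrite mulNr.
pose D : 'M[K]_(l, r) := toK 2 *: (B *m adjmx (u *: delta_mx j i)).
have DE : D = (toK 2 * Kconj u) *: (B *m delta_mx i j).
  by rewrite /D adjmxZ adjmx_delta -scalemxAr scalerA.
have adjD : adjmx D = (toK 2 * u) *: (delta_mx j i *m adjmx B).
  by rewrite DE adjmxZ KconjM Kconj_toK KconjK adjmxM adjmx_delta.
have e2 : (adjmx B *m (D *m S)) i j =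
    toK 2 * (Kconj u * ((adjmx B *m B) i i * S j j)).
  by rewrite DE -scalemxAl -scalemxAr scaleE !mulmxA mul_delta_entry -mulrA.
have e3 : (adjmx B *m (F *m (adjmx D *m F))) i j =
    toK 2 * (u * ((adjmx B *m F) i j * (adjmx B *m F) i j)).
  have -> : adjmx B *m (F *m (adjmx D *m F)) = (toK 2 * u) *:
      ((adjmx B *m F) *m delta_mx j i *m (adjmx B *m F)).
    by rewrite adjD -scalemxAl -!scalemxAr !mulmxA.
  by rewrite scaleE mul_delta_entry -mulrA.
have e4 : (adjmx B *m (G *m (D *m S))) i j =
    toK 2 * (Kconj u * ((adjmx B *m G *m B) i i * S j j)).
  have -> : adjmx B *m (G *m (D *m S)) = (toK 2 * Kconj u) *:
      ((adjmx B *m G *m B) *m delta_mx i j *m S).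
    by rewrite DE -scalemxAl -!scalemxAr !mulmxA.
  by rewrite scaleE mul_delta_entry -mulrA.
rewrite addE e1 !mulmxBr !subE e2 e3 e4; ring.
Qed.

(** The terms of the divergence that carry a factor [t], after every trace is expressed through
    [tau] and [tau2]. *)
Definition orth_err t (A : 'M[K]_(l, r)) : R :=
  (kdim k)%:R * (m%:R * (t * tau A t) - t * r%:R * tau A t + t * (1 + t) * tau A t ^+ 2)
  + (alpha k)%:R * (t * (1 + t) * tau2 A t - 2 * (t * tau A t)).

Hypothesis QQVV : Q *m adjmx Q + V *m adjmx V = 1%:M.

(** For an isometry [X], completeness of [Q] and [V] eliminates [N] in favour of [M]. *)
Lemma NN_isometry X : adjmx X *m X = 1%:M -> N X *m adjmx (N X) = 1%:M - M X *m adjmx (M X).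
Proof.
move=> XX; rewrite /N /M !adjmxM !adjmxK !mulmxA -(mulmxA _ V) -(mulmxA _ Q).
have -> : V *m adjmx V = 1%:M - Q *m adjmx Q by rewrite -QQVV addrC addKr.
by rewrite mulmxBr mulmx1 mulmxBl XX.
Qed.

Lemma rdot1l p : rdot (1%:M : 'M[K]_p) 1%:M = p%:R.
Proof. by rewrite rdot_trace adjmx1 mulmx1 mxtrace1 Kre_natr. Qed.

Lemma rdot1r p (A : 'M[K]_p) : rdot 1%:M A = Kre (\tr A).
Proof. by rewrite rdot_trace adjmx1 mul1mx. Qed.

(** All traces reduce to [tau] and [tau2] by [NN_isometry]; the remaining [|M|_F^2] occurs in [trBB]
    and [trG] and cancels. The constant term collects [- m r] from [trW] and [- r] from [YY],
    weighted by [kdim k] and [- alpha k]. The overall 2 is the derivative of [sg] at 0. *)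
Lemma div_orth t X : 0 < t -> adjmx X *m X = 1%:M ->
  \sum_(u <- dirs) \sum_j \sum_i Kre (u * rot_deriv Q V (u *: delta_mx j i) t X i j) =
  2 * (((kdim k)%:R * (l%:R - r%:R) - (alpha k)%:R) * tau (M X) t
       + orth_err t (M X) - r%:R * ((kdim k)%:R * m%:R - (alpha k)%:R)).
Proof.
move=> t0 XX; have NN := NN_isometry XX.
set A := M X in NN *; set B := N X in NN *; set S := res A t; set F := A *m S.
set G := F *m adjmx A; set Y := adjmx B *m F; set W := adjmx A *m F.
transitivity (\sum_j \sum_i \sum_(u <- dirs)
    (2 * (- Kre (u * (Kconj u * W j j)) + Kre (u * (Kconj u * ((adjmx B *m B) i i * S j j)))
     - Kre (u * (u * (Y i j * Y i j)))
     - Kre (u * (Kconj u * ((adjmx B *m G *m B) i i * S j j)))))).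
  rewrite exchange_big; apply: eq_bigr => j _; rewrite exchange_big.
  apply: eq_bigr => i _; apply: eq_bigr => u _.
  rewrite rot_deriv_entry mulrCA Kre_toKM; congr (_ * _).
  by rewrite !mulrBr mulrDr mulrN !KreB KreD KreN.
under eq_bigr => j _.
  under eq_bigr => i _.
    rewrite -mulr_sumr !sumrB big_split /= sumrN !sum_dirs_conj sum_dirs_sqr alpha_sqr.
    over.
  rewrite -mulr_sumr !sumrB big_split /= sumrN sumr_const card_ord -!mulr_sumr.
  rewrite -[\sum_i Kre ((adjmx B *m B) i i * S j j)]Kre_sum -mulr_suml.
  rewrite -[\sum_i Kre ((adjmx B *m G *m B) i i * S j j)]Kre_sum -mulr_suml.
  over.
rewrite -mulr_sumr; congr (2 * _).
rewrite !sumrB big_split /= sumrN -!mulr_sumr -!Kre_sum -!mulr_sumr.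
rewrite sumrMnl -mulr_sumr -Kre_sum.
rewrite -/(\tr W) -/(\tr (adjmx B *m B)) -/(\tr S) -/(\tr (adjmx B *m G *m B)).
have trS0 : Kim (\tr S) = 0 by rewrite Kim_herm_tr// res_adj.
rewrite !KreM trS0 !mulr0 !subr0 -/(tau A t).
have trW : Kre (\tr W) = r%:R - t * tau A t.
  by rewrite /W /F mxtrace_mulC trace_MresM.
have trBB : Kre (\tr (adjmx B *m B)) = l%:R - rdot A A.
  rewrite mxtrace_mulC NN linearB /= mxtrace1 KreB Kre_natr mxtrace_mulC.
  by rewrite -rdot_trace.
have SW := res_gram A t0; rewrite -/S in SW.
have trG : Kre (\tr (adjmx B *m G *m B)) = (1 + t) * (r%:R - t * tau A t) - rdot A A.
  rewrite mxtrace_mulC mulmxA NN mulmxBl mul1mx linearB /= KreB.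
  have -> : Kre (\tr G) = r%:R - t * tau A t by rewrite /G /F trace_MresM.
  have -> : \tr (A *m adjmx A *m G) = \tr (gram A *m (gram A *m S)).
    have -> : A *m adjmx A *m G = A *m (adjmx A *m A *m S *m adjmx A).
      by rewrite /G /F !mulmxA.
    rewrite mxtrace_mulC.
    have -> : adjmx A *m A *m S *m adjmx A *m A = gram A *m S *m gram A.
      by rewrite /gram !mulmxA.
    by rewrite mxtrace_mulC.
  rewrite (gram_res A t0) mulmxBr mulmx1 -scalemxAr (gram_res A t0).
  rewrite scalerBr scalerA -toKM opprB addrCA !linearD /= !linearN /= !mxtraceZ.
  rewrite !KreD !KreN !Kre_toKM mxtrace1 Kre_natr -/(tau A t) -rdot_trace.
  ring.
have YY : \sum_j \sum_i Kabs (Y i j) ^+ 2 =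
    (1 + 2 * t) * tau A t - r%:R - t * (1 + t) * tau2 A t.
  rewrite exchange_big -rdotxx /Y rdotMl adjmxK mulmxA NN mulmxBl mul1mx.
  rewrite rdotBr -/(rho A t) -mulmxA rdotC rdotMl.
  have -> : adjmx A *m F = 1%:M - toK t *: S by rewrite /F mulmxA -/(gram A) gram_res.
  rewrite rdotBr rdotZr !(rdotC _ 1%:M) (rdotC _ S) !rdotBr !rdotZr.
  rewrite rdot1l rdot1r (rdotC _ 1%:M) rdot1r -/(tau A t) -/(tau2 A t).
  have := tau_split A t0; lra.
rewrite YY trW trBB trG /orth_err.
ring.
Qed.

End OrthonormalDivergence.

(** * Integrated divergence of an orthonormal embedding *)

Section OrthonormalLeak.
Context d (T : measurableType d) {R : realType} (P : probability T R).
Context {k : field_kind} {n l : nat}.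
Local Notation K := (Kfield R k).
Local Notation Mx := 'M[K]_(n, l).
Variable Omega : T -> Mx.
Hypothesis mOmega : measurable_fun setT Omega.
Hypothesis inv_Omega : forall U : 'M[K]_n, unitary U ->
  forall S, measurable S ->
    P ((fun w => U *m Omega w) @^-1` S) = P (Omega @^-1` S).
Hypothesis iso_Omega : {ae P, forall w, adjmx (Omega w) *m Omega w = 1%:M}.
Variables (r : nat) (Q : 'M[K]_(n, r)).
Hypothesis QQ : adjmx Q *m Q = 1%:M.

(* The bounds of [rot_expand] hold on isometries only, hence the cut-off [chi]. *)
Let isoset : set Mx := [set X | rdot (adjmx X *m X - 1%:M) (adjmx X *m X - 1%:M) = 0].

Let isosetP X : isoset X <-> adjmx X *m X = 1%:M.
Proof.
split=> [/rdotxx_eq0/eqP|XX]; first by rewrite subr_eq0 => /eqP.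
by apply/eqP; rewrite XX subrr -(scale0r 0) rdotxxZ Kabs0 expr0n mul0r.
Qed.

Let chi : Mx -> R := \1_isoset.

Let mchi : measurable_fun setT chi.
Proof.
have mh : mxmeas (fun X : Mx => adjmx X *m X - 1%:M).
  apply: mxmeasB; last exact: mxmeas_cst.
  by apply: mxmeasM; [apply: mxmeas_adj|]; exact: mxmeas_id.
apply: measurable_indic; have := measurable_fun_rdot mh mh => /(_ measurableT [set 0]).
by rewrite setTI; apply; exact: measurable_set1.
Qed.

Let chi1 X : adjmx X *m X = 1%:M -> chi X = 1.
Proof. by move=> /isosetP h; rewrite /chi indicE mem_set. Qed.

Let chi0 X : adjmx X *m X != 1%:M -> chi X = 0.
Proof. by move=> /eqP h; rewrite /chi indicE memNset// => /isosetP. Qed.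

Variables (m : nat) (V : 'M[K]_(n, m)).
Hypotheses (VV : adjmx V *m V = 1%:M) (QV : adjmx Q *m V = 0).
Hypothesis QQVV : Q *m adjmx Q + V *m adjmx V = 1%:M.

Let M w : 'M[K]_(l, r) := adjmx (Omega w) *m Q.
Let mM : mxmeas M.
Proof. by apply: mxmeas_sketch; exact: mxmeas_of_measurable. Qed.

Let measurable_rot_deriv Xm t : 0 < t -> mxmeas (rot_deriv (l := l) Q V Xm t).
Proof.
move=> t0; have mQ := mxmeas_sketch Q (mxmeas_id (l := l)); have mV := mxmeas_sketch V (mxmeas_id (l := l)).
have mMX : mxmeas (fun X : Mx => toK (- 2) *: (adjmx X *m Q *m Xm)).
  by apply: mxmeasZ; [exact: Kmeas_cst | apply: mxmeasM => //; exact: mxmeas_cst].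
have mNX : mxmeas (fun X : Mx => toK 2 *: (adjmx X *m V *m adjmx Xm)).
  by apply: mxmeasZ; [exact: Kmeas_cst | apply: mxmeasM => //; exact: mxmeas_cst].
apply: mxmeasD; last first.
  by apply: mxmeasM; [exact: mxmeas_adj | exact: mxmeas_dMres].
apply: mxmeasM; first exact: mxmeas_adj.
by apply: mxmeasM => //; exact: mxmeas_res.
Qed.

Let Dv t (u : K) j i (X : Mx) : R := Kre (u * rot_deriv Q V (u *: delta_mx j i) t X i j).

Let rot_deriv_mean t u j i : 0 < t -> u \in @dirs R k ->
  Pint P (fun w => chi (Omega w) * Dv t u j i (Omega w)) /\
  \int[P]_w (chi (Omega w) * Dv t u j i (Omega w)) = 0.
Proof.
move=> t0 ud; pose Xm : 'M[K]_(r, m) := u *: delta_mx j i.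
(* A direction [u] has modulus 1, so [Xm] is a partial isometry. *)
have XXX : Xm *m adjmx Xm *m Xm = Xm.
  have h (z : K) (A : 'M[K]_(r, m)) (B : 'M[K]_(m, r)) :
      (u *: A) *m (z *: B) *m (u *: A) = (u * (z * u)) *: (A *m B *m A).
    by rewrite -scalemxAr -!scalemxAl -scalemxAr -scalemxAl !scalerA; congr (_ *: _); ring.
  by rewrite /Xm adjmxZ adjmx_delta h !mul_delta_mx Kconj_dirs// mulr1.
have nXm : nm Xm <= 1 by rewrite nmZ nm_delta mulr1 dirs_abs.
have [C C0 HC] := rot_expand (l := l) QQ VV QV nXm t0.
pose Z (X : Mx) := adjmx (adjmx X *m V) *m (adjmx X *m Q *m res (adjmx X *m Q) t).
pose f (X : Mx) : R := chi X * Kre (u * Z X i j).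
pose f' (X : Mx) : R := chi X * Dv t u j i X.
have KB (A : 'M[K]_(m, r)) c : nm A <= c -> `|Kre (u * A i j)| <= c.
  move=> Ac; rewrite (le_trans (Kre_abs_le _))// KabsM dirs_abs// mul1r.
  by rewrite (le_trans _ Ac)// Kabs_le_nm.
have uU s : unitary (rot (rotgen Q V Xm) s).
  by apply: rot_unitary; [exact: adj_rotgen | exact: rotgen3].
have mf : measurable_fun setT f.
  apply: measurable_funM => //.
  have mQ := mxmeas_sketch Q (mxmeas_id (l := l)); have mV := mxmeas_sketch V (mxmeas_id (l := l)).
  have mZ : mxmeas Z.
    apply: mxmeasM; first exact: mxmeas_adj.
    by apply: mxmeasM => //; exact: mxmeas_res.
  exact: Kmeas_re (mZ i j).
have mf' : measurable_fun setT f'.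
  by apply: measurable_funM => //; exact: Kmeas_re (measurable_rot_deriv Xm t0 i j).
have fC X : `|f X| <= C.
  rewrite /f; have [XX|XX] := eqVneq (adjmx X *m X) 1%:M.
    by rewrite chi1// mul1r; have [h _ _] := HC X XX; exact: KB.
  by rewrite chi0// mul0r normr0.
have f'C X : `|f' X| <= C.
  rewrite /f'; have [XX|XX] := eqVneq (adjmx X *m X) 1%:M.
    by rewrite chi1// mul1r; have [_ h _] := HC X XX; exact: KB.
  by rewrite chi0// mul0r normr0.
split.
  by apply: (Pint_le _ (Pint_cst P C)) => [|w]; [exact: measurableT_comp mf' mOmega|exact: f'C].
apply: (invariant_derivative mOmega inv_Omega uU mf mf' fC f'C) => X s s0 s1.
(* Rotations preserve isometries, so the cut-off is constant along the orbit and contributes no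
   derivative. *)
have isoU : adjmx (rot (rotgen Q V Xm) s *m X) *m (rot (rotgen Q V Xm) s *m X) =
    adjmx X *m X.
  by rewrite adjmxM -mulmxA (mulmxA (adjmx (rot _ _))) uU mul1mx.
rewrite /f /f'; have [XX|XX] := eqVneq (adjmx X *m X) 1%:M; last first.
  by rewrite !chi0 ?isoU// !mul0r subrr mulr0 subrr normr0 mulr_ge0// sqr_ge0.
rewrite !chi1 ?isoU// !mul1r.
have [_ _ /(_ s s0 s1) /= h] := HC X XX; have := KB _ _ h.
congr (_ <= _); congr `|_|; rewrite /Dv -Kre_toKM -!KreB; congr Kre.
by rewrite !mxE; ring.
Qed.

Hypothesis rl : (r < l - alpha k)%N.

Let c : R := (kdim k)%:R * (l%:R - r%:R) - (alpha k)%:R.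
Let kap : R := r%:R * ((kdim k)%:R * m%:R - (alpha k)%:R).
Let err t w := orth_err (m := m) t (M w).

Let c_gt0 : 0 < c.
Proof. by rewrite /c kdim_alpha mulr_gt0// ?(alpha_gap rl)// ltr0n; case: (k). Qed.

Let merr t : 0 < t -> measurable_fun setT (err t).
Proof.
move=> t0; have m1 := measurable_tau mM t0; have m2 := measurable_tau2 mM t0.
apply: measurable_funD; apply: measurable_funM => //.
  apply: measurable_funD; last by apply: measurable_funM => //; exact: measurable_funX.
  by apply: measurable_funB; do 2![apply: measurable_funM => //].
by apply: measurable_funB; do 2![apply: measurable_funM => //].
Qed.

Let identity t : 0 < t -> t <= 1 -> \int[P]_w (c * tau (M w) t + err t w) = kap.
Proof.
move=> t0 _; pose s := @dirs R k.
(* Indexed by positions in [dirs], so that each summand comes with the membership that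
   [rot_deriv_mean] requires. *)
pose G w := \sum_(a < size s) \sum_j \sum_i
  chi (Omega w) * Dv t (nth 0 s a) j i (Omega w).
have H (b : 'I_(size s)) j i := rot_deriv_mean j i t0 (mem_nth 0 (ltn_ord b)).
have iG : Pint P G by do 3!apply: Pint_sum => ?; exact: (H _ _ _).1.
have G0 : \int[P]_w G w = 0.
  rewrite /G Pexp_sum => [|b]; last by do 2!apply: Pint_sum => ?; exact: (H b _ _).1.
  rewrite big1// => b _; rewrite Pexp_sum => [|j]; last first.
    by apply: Pint_sum => ?; exact: (H b j _).1.
  rewrite big1// => j _; rewrite Pexp_sum => [|i]; last exact: (H b j i).1.
  by rewrite big1// => i _; exact: (H b j i).2.
have GE w : adjmx (Omega w) *m Omega w = 1%:M ->
    G w = 2 * (c * tau (M w) t + err t w - kap).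
  move=> XX; rewrite -(div_orth QQVV t0 XX) (big_nth 0) big_mkord /G.
  apply: eq_bigr => a _; apply: eq_bigr => j _; apply: eq_bigr => i _.
  by rewrite chi1// mul1r.
have i4 := PintZ 2^-1 iG; have i5 := Pint_cst P kap.
transitivity (\int[P]_w (2^-1 * G w + kap)).
  apply: Pexp_ae_eq.
  - apply: measurable_funD; last exact: merr.
    by apply: measurable_funM => //; exact: measurable_tau.
  - exact: PintP (PintD i4 i5).
  - by apply: filterS iso_Omega => w /GE ->; field.
by rewrite RintegralD// RintegralZl// G0 mulr0 add0r Pexp_cst.
Qed.

Let q : R := (kdim k)%:R.
Let a : R := (alpha k)%:R.
Let C0 : R := q * (m%:R + r%:R) + 2 * q + 2 * a.
(** Only [- t r tau] and [- 2 t tau] in [orth_err] are negative, with weights [q] and [a], and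
    [t * tau <= r^2]. *)
Let C1 : R := (q * r%:R + 2 * a) * (r * r)%:R.

Let q0 : 0 <= q. Proof. by []. Qed.
Let a0 : 0 <= a. Proof. by []. Qed.
Let m0 : 0 <= m%:R :> R. Proof. by []. Qed.
Let r0 : 0 <= r%:R :> R. Proof. by []. Qed.

Let C00 : 0 <= C0. Proof. by rewrite /C0 !addr_ge0// mulr_ge0// addr_ge0. Qed.

Let err_le t w : 0 < t -> t <= 1 ->
  `|err t w| <= C0 * t * (tau (M w) t + tau (M w) t ^+ 2 + tau2 (M w) t).
Proof.
move=> t0 t1; rewrite /err /orth_err -/q -/a.
have := tau_ge0 (M w) t0; have := tau2_ge0 (M w) t.
set x := tau _ _; set y := tau2 _ _ => y0 x0; have x2 := sqr_ge0 x.
have -> : q * (m%:R * (t * x) - t * r%:R * x + t * (1 + t) * x ^+ 2) +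
    a * (t * (1 + t) * y - 2 * (t * x)) =
  t * (q * (m%:R * x) - q * (r%:R * x) + (1 + t) * (q * x ^+ 2)
       + (1 + t) * (a * y) - 2 * (a * x)) by ring.
rewrite normrM gtr0_norm// [leRHS]mulrAC [leRHS]mulrC ler_pM2l//.
have f1 : 0 <= q * (m%:R * x) by rewrite !mulr_ge0.
have f2 : 0 <= q * (r%:R * x) by rewrite !mulr_ge0.
have f3 : 0 <= q * x ^+ 2 by rewrite mulr_ge0.
have f4 : 0 <= a * y by rewrite mulr_ge0.
have f5 : 0 <= a * x by rewrite mulr_ge0.
have f6 : (1 + t) * (q * x ^+ 2) <= 2 * (q * x ^+ 2) by rewrite ler_wpM2r//; lra.
have f7 : (1 + t) * (a * y) <= 2 * (a * y) by rewrite ler_wpM2r//; lra.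
have f8 : 0 <= (1 + t) * (q * x ^+ 2) by rewrite mulr_ge0 ?addr_ge0 ?(ltW t0).
have f9 : 0 <= (1 + t) * (a * y) by rewrite mulr_ge0 ?addr_ge0 ?(ltW t0).
apply: (@le_trans _ _ (q * (m%:R * x) + q * (r%:R * x) + 2 * (q * x ^+ 2)
    + 2 * (a * y) + 2 * (a * x))); first by rewrite ler_norml; apply/andP; split; lra.
rewrite -subr_ge0 (_ : _ - _ = q * (m%:R + r%:R) * (x ^+ 2 + y) + 2 * q * (x + y)
    + 2 * a * x ^+ 2); last by rewrite /C0; ring.
by rewrite !addr_ge0// !mulr_ge0// addr_ge0.
Qed.

Let err_ge t w : 0 < t -> t <= 1 -> - C1 <= err t w.
Proof.
move=> t0 t1; rewrite /err /orth_err -/q -/a.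
have := tau_ge0 (M w) t0; have := tau2_ge0 (M w) t; have := scaled_tau_le (M w) t0.
set x := tau _ _; set y := tau2 _ _ => tx y0 x0.
have f1 : 0 <= t * (q * (m%:R * x)) by rewrite !mulr_ge0 ?(ltW t0).
have f2 : 0 <= t * ((1 + t) * (q * x ^+ 2)).
  by rewrite !mulr_ge0 ?addr_ge0 ?sqr_ge0 ?(ltW t0).
have f3 : 0 <= t * ((1 + t) * (a * y)) by rewrite !mulr_ge0 ?addr_ge0 ?(ltW t0).
have f4 : (q * r%:R + 2 * a) * (t * x) <= C1.
  by apply: ler_wpM2l => //; rewrite addr_ge0// mulr_ge0.
lra.
Qed.

Lemma orth_gram_unit : {ae P, forall w, gram (M w) \in unitmx}.
Proof.
have := ae_gram_unit mM c_gt0 C00 merr err_le err_ge identity.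
by [].
Qed.

Lemma orth_Pint_rho0 : Pint P (fun w => rho0 (M w)).
Proof.
have := Pint_rho0 mM c_gt0 C00 merr err_le err_ge identity.
by [].
Qed.

Lemma orth_Exp_rho0 : \int[P]_w rho0 (M w) =
  r%:R * (m%:R - (alpha k)%:R) / (l%:R - r%:R - (alpha k)%:R).
Proof.
rewrite (Exp_rho0 mM c_gt0 C00 merr err_le err_ge identity) /kap /c !kdim_alpha.
have h := alpha_gap rl (R := R).
have qn0 : (kdim k)%:R != 0 :> R by rewrite pnatr_eq0; case: (k).
by field; rewrite qn0 gt_eqF.
Qed.

End OrthonormalLeak.

(** * Moments of the leak by symmetry *)

Section OrthonormalLeakMoments.
Context d (T : measurableType d) {R : realType} (P : probability T R).
Context {k : field_kind} {n l : nat}.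
Local Notation K := (Kfield R k).
Local Notation Mx := 'M[K]_(n, l).
Variable Omega : T -> Mx.
Hypothesis mOmega : measurable_fun setT Omega.
Hypothesis inv_Omega : forall U : 'M[K]_n, unitary U ->
  forall S, measurable S ->
    P ((fun w => U *m Omega w) @^-1` S) = P (Omega @^-1` S).
Hypothesis iso_Omega : {ae P, forall w, adjmx (Omega w) *m Omega w = 1%:M}.
Hypothesis le_ln : (l <= n)%N.
Variables (r : nat) (Q : 'M[K]_(n, r)).
Hypothesis QQ : adjmx Q *m Q = 1%:M.
Hypothesis rl : (r < l - alpha k)%N.

(** The leak as a function of the embedding matrix, so that it can be composed with unitary maps. *)
Let lk p (E : 'M[K]_(n, p)) (X : Mx) : 'M[K]_(r, p) := leak (fun X => X) Q E X.

Let mlk p (E : 'M[K]_(n, p)) : mxmeas (lk E).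
Proof. by apply: mxmeasM; [apply: mxmeas_mpinv|]; exact: mxmeas_sketch mxmeas_id. Qed.

Let mlk2 p (E : 'M[K]_(n, p)) : measurable_fun setT (fun X => rdot (lk E X) (lk E X)).
Proof. by apply: measurable_fun_rdot; exact: mlk. Qed.

Let lkM p q (E : 'M[K]_(n, p)) (F : 'M[K]_(p, q)) X : lk (E *m F) X = lk E X *m F.
Proof. by rewrite /lk /leak !mulmxA. Qed.

Let lkZ p (E : 'M[K]_(n, p)) z X : lk (z *: E) X = z *: lk E X.
Proof. by rewrite /lk /leak -!scalemxAr. Qed.

Let lk_col p (E : 'M[K]_(n, p)) j X : lk (col j E) X = col j (lk E X).
Proof. by rewrite !colE lkM. Qed.

(** Rotating the embedding by a unitary that fixes [Q] amounts to rotating the residual, so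
    invariance of the law becomes symmetry in [E]. *)
Let lk_unitary (U : 'M[K]_n) p (E : 'M[K]_(n, p)) X : U *m Q = Q ->
  lk E (adjmx U *m X) = lk (U *m E) X.
Proof.
by move=> UQ; rewrite /lk /leak adjmxM adjmxK -!mulmxA UQ.
Qed.

Variables (m : nat) (V : 'M[K]_(n, m)).
Hypotheses (mE : m = (n - r)%N) (VV : adjmx V *m V = 1%:M) (QV : adjmx Q *m V = 0).
Hypothesis QQVV : Q *m adjmx Q + V *m adjmx V = 1%:M.

Let rn : (r < n)%N.
Proof. by rewrite (leq_trans rl)// (leq_trans (leq_subr _ _)). Qed.

Let mnat : m%:R = n%:R - r%:R :> R.
Proof. by rewrite mE natrB// ltnW. Qed.

Let i0 := orth_Pint_rho0 mOmega inv_Omega iso_Omega QQ VV QV QQVV rl.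

(** As [N N^* = 1 - M M^*], the left side is [|M^+|_F^2 - |M^+ M|_F^2], and [M^+ M = 1] where the
    Gram matrix is invertible. *)
Let rdot_lkV : {ae P, forall w, rdot (lk V (Omega w)) (lk V (Omega w)) =
  rho0 (adjmx (Omega w) *m Q) - r%:R}.
Proof.
have gu := orth_gram_unit mOmega inv_Omega iso_Omega QQ VV QV QQVV rl.
apply: filterS2 iso_Omega gu => w XX Wu.
have NN := NN_isometry QQVV XX.
set X := Omega w in XX Wu NN *; set A := adjmx X *m Q in Wu NN *.
have [pE _] := gram_inv_mpinv Wu.
have YM : mpinv A *m A = 1%:M by rewrite pE -mulmxA mulVmx.
rewrite /lk /leak -/A -rdot_adj adjmxM rdotMl adjmxK mulmxA NN mulmxBl mul1mx.
rewrite rdotBr rdot_adj -/(rho0 A) -mulmxA [X in _ - X]rdotC rdotMl.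
have -> : adjmx A *m adjmx (mpinv A) = 1%:M by rewrite -adjmxM YM adjmx1.
by rewrite rdot1l.
Qed.

Let v : R := (n%:R - l%:R) / (n%:R - r%:R) * (r%:R / (l%:R - r%:R - (alpha k)%:R)).

Let pV : Pint P (fun w => rdot (lk V (Omega w)) (lk V (Omega w))).
Proof.
apply: (Pint_ae_eq _ (PintB i0 (Pint_cst P r%:R)) rdot_lkV).
exact: measurableT_comp (mlk2 V) mOmega.
Qed.

Let eV : \int[P]_w rdot (lk V (Omega w)) (lk V (Omega w)) = m%:R * v.
Proof.
rewrite (Pexp_ae_eq (PintP pV) (PintP (PintB i0 (Pint_cst P r%:R))) rdot_lkV).
rewrite RintegralB//; last exact: Pint_cst.
rewrite Pexp_cst (orth_Exp_rho0 mOmega inv_Omega iso_Omega QQ VV QV QQVV rl) /v mnat.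
have h := alpha_gap rl (R := R).
have h2 : n%:R - r%:R != 0 :> R by rewrite subr_eq0 eqr_nat gtn_eqF.
(* The numerators combine as [(m - alpha) - (l - r - alpha) = n - l]. *)
by field; rewrite h2 gt_eqF.
Qed.

Let Qcol p (E : 'M[K]_(n, p)) j : adjmx Q *m E = 0 -> adjmx Q *m col j E = 0.
Proof. by move=> QE; rewrite colE mulmxA QE mul0mx. Qed.

Let splitE p (E : 'M[K]_(n, p)) : adjmx Q *m E = 0 -> E = V *m (adjmx V *m E).
Proof.
by move=> QE; rewrite -[LHS]mul1mx -QQVV mulmxDl -!mulmxA QE mulmx0 add0r.
Qed.

(** [E = V V^* E], so its leak is the leak of [V] times a fixed matrix. *)
Let pE p (E : 'M[K]_(n, p)) : adjmx Q *m E = 0 ->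
  Pint P (fun w => rdot (lk E (Omega w)) (lk E (Omega w))).
Proof.
move=> QE; apply: (Pint_le _ (PintZ (nm (adjmx V *m E) ^+ 2 * ((r * m) ^ 2)%:R) pV)).
  exact: measurableT_comp (mlk2 E) mOmega.
by move=> w; rewrite ger0_norm ?rdotxx_ge0// {1 2}(splitE QE) lkM rdotM_le.
Qed.

Let Phi (b : 'M[K]_(n, 1)) : R := \int[P]_w rdot (lk b (Omega w)) (lk b (Omega w)).

Let Phi_unit b b' : adjmx Q *m b = 0 -> adjmx Q *m b' = 0 ->
  rdot b b = 1 -> rdot b' b' = 1 -> Phi b = Phi b'.
Proof.
move=> Qb Qb' bb b'b'; have [U [g [uU UQ g1 Ub]]] := householder Qb Qb' bb b'b'.
rewrite /Phi /Rintegral.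
rewrite -(invariant_integral mOmega inv_Omega (unitary_adj uU) (mlk2 b)).
congr fine; apply: eq_integral => w _.
by rewrite lk_unitary// Ub lkZ rdotxxZ g1 expr1n mul1r.
Qed.

Let Phi_V j b : adjmx Q *m b = 0 -> rdot b b = 1 -> Phi (col j V) = Phi b.
Proof.
move=> Qb bb; apply: Phi_unit => //.
  exact: Qcol.
have := @gram_diag R k n m V j; rewrite VV mxE eqxx mulr1n -toK1 Kre_toK => h.
by rewrite rdotxx h; apply: eq_bigr => i _; rewrite big_ord1 mxE.
Qed.

Let m_gt0 : m%:R != 0 :> R.
Proof. by rewrite mE pnatr_eq0 subn_eq0 -ltnNge. Qed.

(** The [m] columns of [V] contribute equally by symmetry, and their total is [m v]. *)
Let Phi_v b : adjmx Q *m b = 0 -> rdot b b = 1 -> Phi b = v.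
Proof.
move=> Qb bb; apply: (mulfI m_gt0); rewrite -eV.
under [RHS]eq_Rintegral => w _.
  rewrite rdot_cols; under eq_bigr do rewrite -lk_col; over.
rewrite Pexp_sum; last first.
  by move=> j; apply: pE; exact: Qcol.
rewrite (eq_bigr (fun=> Phi b)) => [|j _]; last exact: Phi_V.
by rewrite sumr_const card_ord mulr_natl.
Qed.

Let Phi_col b : adjmx Q *m b = 0 -> Phi b = v * rdot b b.
Proof.
move=> Qb; have [b0|b0] := eqVneq (rdot b b) 0.
  rewrite b0 mulr0 (rdotxx_eq0 b0) /Phi -(Pexp_cst P 0); apply: eq_Rintegral => w _.
  have -> : (0 : 'M[K]_(n, 1)) = 0 *: 0 by rewrite scale0r.
  by rewrite lkZ rdotxxZ Kabs0 expr0n mul0r.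
have bp : 0 < rdot b b by rewrite lt_def b0 rdotxx_ge0.
pose s := Num.sqrt (rdot b b).
have s2 : s ^+ 2 = rdot b b by rewrite sqr_sqrtr ?rdotxx_ge0.
have s0 : s != 0 by rewrite gt_eqF// sqrtr_gt0.
pose e : 'M[K]_(n, 1) := toK s^-1 *: b.
have bE : b = toK s *: e by rewrite /e scalerA -toKM mulfV// toK1 scale1r.
have ee : rdot e e = 1.
  by rewrite rdotxxZ Kabs_toK real_normK ?num_real// exprVn s2 mulVf.
have Qe : adjmx Q *m e = 0 by rewrite /e -scalemxAr Qb scaler0.
have ie := pE Qe.
rewrite -s2 mulrC -(Phi_v Qe ee) /Phi -RintegralZl//.
apply: eq_Rintegral => w _.
by rewrite {1 2}bE lkZ rdotxxZ Kabs_toK real_normK ?num_real.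
Qed.

Let reflect_mean p (E : 'M[K]_(n, p)) c a q : adjmx Q *m E = 0 ->
  Pint P (fun w => Kre (c * lk E (Omega w) a q)) /\
  \int[P]_w Kre (c * lk E (Omega w) a q) = 0.
Proof.
move=> QE; have mf := Kmeas_re c (mlk E a q).
have if0 : Pint P (fun w => Kre (c * lk E (Omega w) a q)).
  apply: (Pint_le _ (PintZ (Kabs c) (PintD (Pint_cst P 1) (pE QE)))).
    exact: measurableT_comp mf mOmega.
  by move=> w; exact: Kre_le_rdot.
split=> //; pose U : 'M[K]_n := toK 2 *: (Q *m adjmx Q) - 1%:M.
have adjU : adjmx U = U.
  by rewrite /U adjmxB adjmxZ Kconj_toK adjmxM adjmxK adjmx1.
have UQ : U *m Q = Q.
  rewrite /U mulmxBl mul1mx -scalemxAl -mulmxA QQ mulmx1.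
  have -> : 2 = 1 + 1 :> R by [].
  by rewrite toKD toK1 scalerDl scale1r addrK.
have UE : U *m E = (-1) *: E.
  by rewrite /U mulmxBl mul1mx -scalemxAl -mulmxA QE mulmx0 scaler0 sub0r scaleN1r.
have uU : unitary U.
  rewrite /unitary adjU {2}/U mulmxBr mulmx1 -scalemxAr mulmxA UQ /U.
  by rewrite opprB addrCA subrr addr0.
pose f X := Kre (c * lk E X a q).
have h : \int[P]_w f (U *m Omega w) = \int[P]_w f (Omega w).
  by rewrite /Rintegral (invariant_integral mOmega inv_Omega uU mf).
(* The leak is odd under [U], which fixes [Q] and negates [E], while the law is invariant. *)
have fN w : f (U *m Omega w) = -1 * f (Omega w).
  by rewrite /f -adjU lk_unitary// UE lkZ mxE !mulN1r mulrN KreN.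
move: h; under eq_Rintegral do rewrite fN.
rewrite RintegralZl// /f; lra.
Qed.

Lemma orth_leak : leak_moments P Omega Q v.
Proof.
have gu := orth_gram_unit mOmega inv_Omega iso_Omega QQ VV QV QQVV rl.
split=> // p E QE.
split=> [||c a q]; [exact: pE|  |exact: reflect_mean].
have Qc j := Qcol j QE.
transitivity (\int[P]_w \sum_j rdot (lk (col j E) (Omega w)) (lk (col j E) (Omega w))).
  apply: eq_Rintegral => w _; rewrite -/(lk E (Omega w)) rdot_cols.
  by apply: eq_bigr => j _; rewrite lk_col.
rewrite Pexp_sum; last by move=> j; exact: pE.
by rewrite (rdot_cols E) mulr_sumr; apply: eq_bigr => j _; exact: Phi_col.
Qed.

End OrthonormalLeakMoments.

(** * The sketched least-squares problem *)

Section SketchAndSolve.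
Context d (T : measurableType d) {R : realType} (P : probability T R).
Context {k : field_kind} {n l : nat}.
Local Notation K := (Kfield R k).

(** Take [- i] over C and 0 over R: statements about imaginary parts follow from those about
    [Kre (c * _)]. *)
Lemma Kim_as_Kre : exists u : K, forall z, Kim z = Kre (u * z).
Proof.
case: (k) => /=; first by exists 0 => z; rewrite mul0r.
exists (0 -i* 1)%C => -[a b] /=.
by rewrite mul0r sub0r mulN1r opprK.
Qed.

Lemma Kexpectation_eq (X : T -> K) (z : K) :
  \int[P]_w Kre (X w) = Kre z -> \int[P]_w Kim (X w) = Kim z ->
  Kexpectation P X = z.
Proof.
rewrite /Rintegral => hr hi; apply: K_eq; move: X z hr hi.
  by rewrite /Kexpectation; case: (k) => X z hr hi /=; rewrite expectation.unlock.
by rewrite /Kexpectation; case: (k) => X z hr hi //=; rewrite expectation.unlock.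
Qed.

Variable Omega : T -> 'M[K]_(n, l).
Hypothesis mOmega : measurable_fun setT Omega.
Variables (m p : nat) (A : 'M[K]_(n, m)) (B : 'M[K]_(n, p)).
Let r := \rank A.
Variables (Q : 'M[K]_(n, r)) (v : R).
Hypotheses (QQ : adjmx Q *m Q = 1%:M) (QA : Q *m (adjmx Q *m A) = A).
Hypothesis FF : (adjmx Q *m A) *m adjmx (adjmx Q *m A) \in unitmx.
Hypothesis AQ0 : forall p (E : 'M[K]_(n, p)), adjmx A *m E = 0 -> adjmx Q *m E = 0.
Hypothesis leakQ : leak_moments P Omega Q v.

Let Xhat w := mpinv (adjmx (Omega w) *m A) *m (adjmx (Omega w) *m B).
Let F : 'M[K]_(r, m) := adjmx Q *m A.
Let Fp : 'M[K]_(m, r) := adjmx F *m invmx (F *m adjmx F).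
Let E : 'M[K]_(n, p) := B - A *m (mpinv A *m B).

Let FFp : F *m Fp = 1%:M.
Proof. by rewrite /Fp mulmxA mulmxV. Qed.

(** Reverse-order law for a full-rank factorization: the right side is [F^+ C^+], and the Penrose
    equations determine the pseudoinverse. *)
Let mpinv_factor q (C : 'M[K]_(q, r)) : adjmx C *m C \in unitmx ->
  mpinv (C *m F) = Fp *m (invmx (adjmx C *m C) *m adjmx C).
Proof.
move=> Cu; apply: penrose_unique (mpinvP _) _.
exact: (@penrose_full_rank R k q r m C F Cu FF).
Qed.

Let mpinvA : mpinv A = Fp *m adjmx Q.
Proof. by rewrite -{1}QA mpinv_factor QQ ?unitmx1// invmx1 mul1mx. Qed.

Let QE : adjmx Q *m E = 0.
Proof.
apply: AQ0; have [AYA _ AYh _] := mpinvP A.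
by rewrite /E mulmxBr !mulmxA -{1}AYA adjmxM AYh !mulmxA subrr.
Qed.

(** Almost surely the sketched pseudoinverse is [F^+ M^+]. On [B = A A^+ B + E], the relation
    [M^+ M = 1] recovers [A^+ B] from the first term, and the second contributes the leak. *)
Let XhatE : {ae P, forall w, Xhat w = mpinv A *m B + Fp *m leak Omega Q E w}.
Proof.
have [gu _] := leakQ; apply: filterS gu => w Wu.
set X := Omega w in Wu *; set M := adjmx X *m Q in Wu.
have [pM _] := gram_inv_mpinv Wu.
have MM : mpinv M *m M = 1%:M by rewrite pM -mulmxA mulVmx.
have MF : adjmx X *m A = M *m F by rewrite -[in LHS]QA mulmxA.
rewrite /Xhat -/X MF mpinv_factor// -pM /leak -/X -/M.
have BE : B = A *m (mpinv A *m B) + E by rewrite /E addrC subrK.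
rewrite [in LHS]BE !mulmxDr; congr (_ + _); last by rewrite !mulmxA.
have -> : Fp *m mpinv M *m (adjmx X *m (A *m (mpinv A *m B))) =
    Fp *m ((mpinv M *m M) *m (F *m mpinv A)) *m B.
  by rewrite (mulmxA _ A) MF !mulmxA.
by rewrite MM mul1mx mpinvA (mulmxA F) FFp mul1mx.
Qed.

Let mXhat : mxmeas Xhat.
Proof.
have mO := mxmeas_of_measurable mOmega.
by apply: mxmeasM; [apply: mxmeas_mpinv|]; exact: mxmeas_sketch.
Qed.

Let Xhat_entry c a q :
  Pint P (fun w => Kre (c * Xhat w a q)) /\
  \int[P]_w Kre (c * Xhat w a q) = Kre (c * (mpinv A *m B) a q).
Proof.
have [_ /(_ _ _ QE) [_ _ h]] := leakQ.
pose g w := \sum_j Kre (c * Fp a j * leak Omega Q E w j q).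
have ig : Pint P g by apply: Pint_sum => j; have [] := h (c * Fp a j) j q.
have g0 : \int[P]_w g w = 0.
  by rewrite Pexp_sum => [|j]; [rewrite big1// => j _|]; have [] := h (c * Fp a j) j q.
have ic := Pint_cst P (Kre (c * (mpinv A *m B) a q)).
have mX : measurable_fun setT (fun w => Kre (c * Xhat w a q)).
  exact: Kmeas_re (mXhat a q).
have ae : {ae P, forall w, Kre (c * Xhat w a q) = Kre (c * (mpinv A *m B) a q) + g w}.
  apply: filterS XhatE => w ->; rewrite mxE mulrDr KreD; congr (_ + _).
  by rewrite mxE mulr_sumr Kre_sum; apply: eq_bigr => j _; rewrite mulrA.
have i1 := Pint_ae_eq mX (PintD ic ig) ae; split=> //.
rewrite (Pexp_ae_eq mX (PintP (PintD ic ig)) ae).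
by rewrite RintegralD// Pexp_cst g0 addr0.
Qed.

Lemma sketch_integrable : integrable_mx P Xhat.
Proof.
move=> a q; split; last have [u uE] := Kim_as_Kre.
  have [+ _] := Xhat_entry 1 a q.
  by apply: eq_integrable => // w _; rewrite /= mul1r.
have [+ _] := Xhat_entry u a q.
by apply: eq_integrable => // w _; rewrite /= uE.
Qed.

Lemma sketch_expectation : expectation_mx P Xhat = mpinv A *m B.
Proof.
apply/matrixP => a q; rewrite mxE; apply: Kexpectation_eq.
  have [_] := Xhat_entry 1 a q; rewrite mul1r => <-.
  by apply: eq_Rintegral => w _; rewrite mul1r.
have [u uE] := Kim_as_Kre; have [_] := Xhat_entry u a q; rewrite uE => <-.
by apply: eq_Rintegral => w _; rewrite uE.
Qed.

(** Pythagoras: [E] is orthogonal to the range of [Q], so almost surely the squared error is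
    [|E|_F^2] plus the squared norm of the leak, whose mean is [v |E|_F^2]. *)
Lemma sketch_residual :
  ('E_P[fun w => (frobenius_norm (B - A *m Xhat w) ^+ 2)%R] =
   ((1 + v) * lsq_min A B)%:E)%E.
Proof.
have [_ /(_ _ _ QE) [iL eL _]] := leakQ.
have ic := Pint_cst P (rdot E E).
pose f w := frobenius_norm (B - A *m Xhat w) ^+ 2.
have ae : {ae P, forall w, f w = rdot E E + rdot (leak Omega Q E w) (leak Omega Q E w)}.
  apply: filterS XhatE => w h; rewrite /f h mulmxDr opprD addrA -/E.
  (* [A F^+ = Q F F^+ = Q]. *)
  have -> : A *m (Fp *m leak Omega Q E w) = Q *m leak Omega Q E w.
    by rewrite -{1}QA -/F mulmxA -(mulmxA Q) FFp mulmx1.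
  rewrite frobenius_pythagoras ?frobenius_rdot; last first.
    by rewrite mulmxN mulmxA -[adjmx E *m Q]adjmxK adjmxM adjmxK QE adjmx0 mul0mx oppr0.
  congr (_ + _); rewrite -scaleN1r rdotxxZ KabsN Kabs1 expr1n mul1r.
  by rewrite rdotMl mulmxA QQ mul1mx.
have mf : measurable_fun setT f.
  have mD : mxmeas (fun w => B - A *m Xhat w).
    by apply: mxmeasB; [exact: mxmeas_cst | apply: mxmeasM => //; exact: mxmeas_cst].
  by rewrite /f; under eq_fun do rewrite frobenius_rdot; exact: measurable_fun_rdot.
have i1 := Pint_ae_eq mf (PintD ic iL) ae.
rewrite expectation.unlock -/f (PexpE i1) (Pexp_ae_eq mf (PintP (PintD ic iL)) ae).
rewrite RintegralD// Pexp_cst eL; congr EFin.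
have [-> _] := lsq_minP A B; rewrite -/E frobenius_rdot; ring.
Qed.

End SketchAndSolve.

Theorem theorem2p1 (R : realType) (k : field_kind) (n l d p : nat)
    (n_gt0 : (0 < n)%N) (l_gt0 : (0 < l)%N)
    (d_gt0 : (0 < d)%N) (p_gt0 : (0 < p)%N) (le_ln : (l <= n)%N)
    (disp : measure_display) (T : measurableType disp) (P : probability T R)
    (Omega : {RV P >-> 'M[Kfield R k]_(n, l)})
    (A : 'M[Kfield R k]_(n, d)) (B : 'M[Kfield R k]_(n, p))
    (ltrl : (\rank A < l - alpha k)%N) :
  let r : nat := \rank A in
  let Xhat := fun w =>
    mpinv (adjmx (Omega w) *m A) *m (adjmx (Omega w) *m B) in
  [/\ gaussian_embedding Omega \/ orthonormal_embedding Omega ->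
        integrable_mx P Xhat /\ expectation_mx P Xhat = mpinv A *m B,
      gaussian_embedding Omega ->
        ('E_P[fun w => (frobenius_norm (B - A *m Xhat w) ^+ 2)%R] =
         ((1 + r%:R / (l%:R - r%:R - (alpha k)%:R)) * lsq_min A B)%R%:E)%E
    & orthonormal_embedding Omega ->
        ('E_P[fun w => (frobenius_norm (B - A *m Xhat w) ^+ 2)%R] =
         ((1 + (n%:R - l%:R) / (n%:R - r%:R) *
               (r%:R / (l%:R - r%:R - (alpha k)%:R))) * lsq_min A B)%R%:E)%E].
Proof.
move=> r Xhat; have mO : measurable_fun setT Omega by exact: measurable_funP.
have [Q [QQ QA FF AQ0]] := orthonormal_range A.
have gauss : gaussian_embedding Omega ->
    leak_moments P Omega Q (r%:R / (l%:R - r%:R - (alpha k)%:R)).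
  by move=> [law ind]; exact: gauss_leak.
have orth : orthonormal_embedding Omega -> leak_moments P Omega Q
    ((n%:R - l%:R) / (n%:R - r%:R) * (r%:R / (l%:R - r%:R - (alpha k)%:R))).
  move=> [inv iso]; have [m [V [mE VV QV QQVV]]] := orthonormal_complement QQ.
  apply: (orth_leak mO _ iso le_ln QQ ltrl mE VV QV QQVV) => U uU S mS.
  by rewrite (inv U uU S mS).
split=> [[/gauss|/orth] h|/gauss h|/orth h].
- by split; [exact: sketch_integrable h | exact: sketch_expectation h].
- by split; [exact: sketch_integrable h | exact: sketch_expectation h].
- exact: sketch_residual h.
- exact: sketch_residual h.
Qed.
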